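(* Let $\nu>0$, let $f\in H^{-1}(\mathbb{T}^2)$ be independent of time, and let $u_0\in H^1(\mathbb{T}^2)$ with $\nabla\cdot u_0=0$. Let $u$ be the unique solution of the two-dimensional Navier–Stokes equations $$u_t+(u\cdot\nabla)u-\nu\Delta u+\nabla p=f,\qquad \nabla\cdot u=0 \quad\text{on } \mathbb{T}^2,$$ with $u(0)=u_0$. Then there exists $T=T(u_0,f)>0$ such that $u\in L^\infty([0,t_0],H^1(\mathbb{T}^2))$ for all $0<t_0<T$.
   Context: $\mathbb{T}^2=(\mathbb{R}/2\pi\mathbb{Z})^2$ is the two-dimensional torus, and $\nu>0$ is the fixed viscosity. All functions and distributions (velocity fields and forces) are $\mathbb{R}^2$-valued with zero spatial mean. For $s\in\mathbb{R}$, $H^s(\mathbb{T}^2)$ is the Sobolev space of zero-mean vector-valued distributions on $\mathbb{T}^2$ with finite norm $\|u\|_{H^s}=\big(\sum_{n\in\mathbb{Z}^2\setminus\{0\}}|n|^{2s}|\hat u(n)|^2\big)^{1/2}$, where $\hat u(n)$ is the $n$-th Fourier coefficient. The solution is understood in the Leray sense: for $f\in H^{-1}$ and divergence-free $u_0\in L^2$ there is a unique divergence-free $u$ with $u\in C([0,\tau],L^2)\cap L^2([0,\tau],H^1)$ for every $\tau>0$ that satisfies $u(0)=u_0$ and the equations in the sense of distributions (for some pressure $p$). The viscosity is regarded as fixed, so $T$ may also depend on $\nu$. *)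

(* Defs.v *)
From HB Require Import structures.
From mathcomp Require Import all_boot all_order all_algebra.
From mathcomp Require Import all_classical all_reals all_analysis.
From mathcomp Require Import complex.

Set Implicit Arguments.
Unset Strict Implicit.
Unset Printing Implicit Defensive.

Import Order.TTheory GRing.Theory Num.Theory.
Import numFieldNormedType.Exports.

Local Open Scope classical_set_scope.
Local Open Scope ring_scope.

(* The torus (R/2piZ)^2 is represented by the plane: functions on it are
   2pi-periodic functions on R * R, integrated over one period cell. *)
Definition cell (R : realType) : set (R * R) :=
  `[0, 2 * pi] `*` `[0, 2 * pi].
Arguments cell R : clear implicits.

Definition area (R : realType) :
    {measure set (measurableTypeR R * measurableTypeR R) -> \bar R} :=
  (@lebesgue_measure R \x @lebesgue_measure R)%E.
Arguments area R : clear implicits.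

Definition torus_fun (R : realType) (g : R * R -> R) : Prop :=
  periodic g (2 * pi, 0) /\ periodic g (0, 2 * pi).

Definition unit_vec (R : realType) (i : 'I_2) : R * R :=
  if i == 0 then (1, 0) else (0, 1).

Definition partial (R : realType) (i : 'I_2) (g : R * R -> R) : R * R -> R :=
  fun x => 'D_(unit_vec R i) g x.

(* Space-time functions have arguments (t, x) : R * (R * R). *)
Definition dt (R : realType) (g : R * (R * R) -> R) : R * (R * R) -> R :=
  fun z => 'D_((1, 0) : R * (R * R)) g z.

Definition dx (R : realType) (i : 'I_2) (g : R * (R * R) -> R) :
    R * (R * R) -> R :=
  fun z => 'D_((0, unit_vec R i) : R * (R * R)) g z.

Definition iter_derive (R : realType) (V : normedModType R) (vs : seq V)
    (g : V -> R) : V -> R :=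
  foldr (fun v h => fun x : V => 'D_v h x) g vs.

Definition smooth (R : realType) (V : normedModType R) (g : V -> R) : Prop :=
  forall vs : seq V, continuous (iter_derive vs g) /\
    forall v x, derivable (iter_derive vs g) x v.

(* [derivs_le vs N g M]: every iterated derivative of g of order at most N in
   the directions vs is bounded by M in absolute value. *)
Definition derivs_le (R : realType) (V : normedModType R) (vs : seq V)
    (N : nat) (g : V -> R) (M : R) : Prop :=
  forall ws : seq V, (size ws <= N)%N -> {subset ws <= vs} ->
    forall x, `|iter_derive ws g x| <= M.

Definition test_fun (R : realType) (g : R * R -> R) : Prop :=
  smooth g /\ torus_fun g.

(* Real scalar distributions on the torus. *)
Definition is_distribution (R : realType) (F : (R * R -> R) -> R) : Prop :=
  (forall (a : R) (g h : R * R -> R), test_fun g -> test_fun h ->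
     F (fun x => a * g x + h x) = a * F g + F h) /\
  exists (N : nat) (C : R), forall (g : R * R -> R) (M : R), test_fun g ->
    derivs_le [:: unit_vec R 0; unit_vec R 1] N g M -> `|F g| <= C * M.

(* Test functions on the open set (0, +oo) x T^2, with time support in the
   compact interval [a, b]. *)
Definition st_test_on (R : realType) (a b : R) (g : R * (R * R) -> R) : Prop :=
  [/\ smooth g,
      forall t, torus_fun (fun x => g (t, x)) &
      forall t x, ~ (a <= t <= b) -> g (t, x) = 0].

Definition st_test (R : realType) (g : R * (R * R) -> R) : Prop :=
  exists a b : R, 0 < a /\ st_test_on a b g.

(* Real scalar distributions on (0, +oo) x T^2. *)
Definition is_st_distribution (R : realType)
    (F : (R * (R * R) -> R) -> R) : Prop :=
  (forall (a : R) (g h : R * (R * R) -> R), st_test g -> st_test h ->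
     F (fun z => a * g z + h z) = a * F g + F h) /\
  forall a b : R, 0 < a -> exists (N : nat) (C : R),
    forall (g : R * (R * R) -> R) (M : R), st_test_on a b g ->
    derivs_le [:: (1, 0) : R * (R * R); (0, unit_vec R 0); (0, unit_vec R 1)] N g M ->
    `|F g| <= C * M.

(* Vector fields and vector-valued distributions are given by components. *)
Definition vfield (R : realType) := 'I_2 -> R * R -> R.
Definition vdistr (R : realType) := 'I_2 -> (R * R -> R) -> R.

Definition distr_of (R : realType) (v : vfield R) : vdistr R :=
  fun j phi => \int[area R]_(x in cell R) (v j x * phi x).

(* n-th Fourier coefficient (2pi)^-2 <F, exp(-i n.x)> of a real distribution. *)
Definition fourier (R : realType) (F : (R * R -> R) -> R) (n : int * int) :
    R[i] :=
  let phase (x : R * R) : R := n.1%:~R * x.1 + n.2%:~R * x.2 in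
  Complex ((2 * pi) ^- 2 * F (fun x => cos (phase x)))
          (- ((2 * pi) ^- 2 * F (fun x => sin (phase x)))).

Definition freq_norm (R : realType) (n : int * int) : R :=
  Num.sqrt (n.1%:~R ^+ 2 + n.2%:~R ^+ 2).

Definition Hs_norm (R : realType) (s : R) (F : vdistr R) : \bar R :=
  ((\esum_(n in [set n : int * int | n != 0%R])
      (freq_norm R n `^ (2 * s)
       * \sum_(j < 2) ComplexField.Normc.normc (fourier (F j) n) ^+ 2)%R%:E)
   `^ 2^-1)%E.

Definition in_Hs (R : realType) (s : R) (F : vdistr R) : Prop :=
  [/\ forall j, is_distribution (F j),
      forall j, fourier (F j) 0 = 0 &
      (Hs_norm s F < +oo)%E].

Definition div_free (R : realType) (F : vdistr R) : Prop :=
  forall psi, test_fun psi -> \sum_(j < 2) F j (partial j psi) = 0.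

Definition in_L2 (R : realType) (v : vfield R) : Prop :=
  forall j, [/\
    measurable_fun (setT : set (measurableTypeR R * measurableTypeR R)) (v j),
    torus_fun (v j),
    (\int[area R]_(x in cell R) ((v j x) ^+ 2)%:E < +oo)%E &
    (\int[area R]_(x in cell R) v j x) = 0].

Definition L2_dist (R : realType) (v w : vfield R) : \bar R :=
  ((\int[area R]_(x in cell R)
      (\sum_(j < 2) (v j x - w j x) ^+ 2)%R%:E) `^ 2^-1)%E.

Definition continuous_L2 (R : realType) (tau : R) (u : R -> vfield R) : Prop :=
  (forall t, 0 <= t <= tau -> in_L2 (u t)) /\
  (forall t, 0 <= t <= tau ->
     L2_dist (u s) (u t) @[s --> within `[0, tau]%classic (nbhs t)]
       --> (0 : \bar R)%E).

(* Since the spaces H^s are separable, with dual H^{-s} in which test fields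
   are dense, this is strong (Bochner) measurability for H^s-valued maps. *)
Definition weakly_measurable (R : realType) (tau : R) (F : R -> vdistr R) :
    Prop :=
  forall j psi, test_fun psi ->
    measurable_fun `[0, tau]%classic (fun t => F t j psi).

Definition in_L2_Hs (R : realType) (s tau : R) (F : R -> vdistr R) : Prop :=
  [/\ weakly_measurable tau F,
      {ae @lebesgue_measure R, forall t, 0 <= t <= tau -> in_Hs s (F t)} &
      (\int[@lebesgue_measure R]_(t in `[0%R, tau]) (Hs_norm s (F t) ^+ 2)
         < +oo)%E].

Definition in_Linfty_Hs (R : realType) (s tau : R) (F : R -> vdistr R) : Prop :=
  [/\ weakly_measurable tau F,
      {ae @lebesgue_measure R, forall t, 0 <= t <= tau -> in_Hs s (F t)} &
      exists M : R, {ae @lebesgue_measure R, forall t, 0 <= t <= tau ->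
        (Hs_norm s (F t) <= M%:E)%E}].

(* u_t + (u.grad) u - nu Laplace u + grad p = f in the sense of distributions
   on (0, +oo) x T^2.  As u is divergence free, (u.grad) u is the distribution
   div (u (x) u). *)
Definition navier_stokes (R : realType) (nu : R) (f : vdistr R)
    (u : R -> vfield R) (p : (R * (R * R) -> R) -> R) : Prop :=
  forall phi : 'I_2 -> R * (R * R) -> R, (forall j, st_test (phi j)) ->
    - (\int[@lebesgue_measure R]_(t in `]0, +oo[)
        (\int[area R]_(x in cell R) (\sum_(j < 2)
           (u t j x * dt (phi j) (t, x)
            + \sum_(i < 2) u t i x * u t j x * dx i (phi j) (t, x)
            + nu * u t j x * \sum_(i < 2) dx i (dx i (phi j)) (t, x)))))
    - p (fun z => \sum_(j < 2) dx j (phi j) z)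
    = \int[@lebesgue_measure R]_(t in `]0, +oo[)
        (\sum_(j < 2) f j (fun x => phi j (t, x))).

Definition leray_solution (R : realType) (nu : R) (f : vdistr R)
    (u0 : vfield R) (u : R -> vfield R) : Prop :=
  [/\ forall tau, 0 < tau ->
        continuous_L2 tau u /\ in_L2_Hs 1 tau (fun t => distr_of (u t)),
      forall t, 0 <= t -> div_free (distr_of (u t)),
      {ae area R, forall x, cell R x -> forall j, u 0 j x = u0 j x} &
      exists p, is_st_distribution p /\ navier_stokes nu f u p].

(* Main.v *)
(* In Fourier variables the solution solves, mode by mode, a quadratic system
   x' = - nu lam x + F + B(x, x) on the lattice Z^2: testing the equation with a
   function of time times a divergence-free trigonometric field removes the
   pressure. Restricted to the frequencies |n| <= N, the system holds up to an
   error controlled by |n| times the L^2 norm of the tail u - P_N u, and the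
   square of N times this norm is integrable in time because u is in L^2 H^1.
   The truncated system has Picard iterates bounded in H^1, uniformly in N, on an
   interval [0, T] determined by u0 and f alone, since the forcing divided by
   nu lam is in H^1 and on a short interval the bilinear term contracts. A Gronwall
   argument in H^-1, needing only u in L^2 H^1 and the estimate
   <|n| (X * D), D>_{H^-1} <= eps |D|_0^2 + C (1 + |X|_1^2 + |X|_0^2 |X|_1^2) |D|_{-1}^2,
   shows that the modes of u are limits of those of the iterates, so u inherits
   their H^1 bound. *)
Require Import Defs.
From HB Require Import structures.
From mathcomp Require Import all_boot all_order all_algebra.
From mathcomp Require Import all_classical all_reals all_analysis.
From mathcomp Require Import measurable_realfun finmap zify ring lra.
Set Implicit Arguments.
Unset Strict Implicit.
Unset Printing Implicit Defensive.
Import Order.TTheory GRing.Theory Num.Theory.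
Import numFieldNormedType.Exports.
Import HBNNSimple.
Local Open Scope classical_set_scope.
Local Open Scope ring_scope.

(** * Lattice sums *)

(** A force in H^-1 rules out the direct H^1 energy estimate, which would ask for f in L^2, and a
    Leray solution is not known to stay in H^1, so no H^1 estimate is made on u itself. The iterates
    are bounded mode by mode: the supremum over [0, T] of each mode is estimated before anything is
    squared and summed, and for a force constant in time Duhamel's formula then costs 1 / (nu lam)
    per mode, a gain of two full derivatives. The product of two H^1 fields lies in H^(1/2) in
    dimension two; after the derivative in the nonlinearity, this smoothing leaves half a derivative
    to spare. The slack makes high frequencies small and a short time makes the finitely many low
    ones small, uniformly in the truncation. The comparison takes place in H^-1 because its weight
    cancels the factor |n| in front of the truncation error. Convergence of the iterates is never
    discussed: the modes in a fixed box are compared with one late iterate of one large truncated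
    system. *)

Definition fnorm (n : int * int) : nat := maxn `|n.1|%N `|n.2|%N.

Lemma fnorm0 n : (fnorm n == 0%N) = (n == 0).
Proof.
case: n => a b; rewrite /fnorm /= -leqn0 geq_max !leqn0 !absz_eq0.
by rewrite -[RHS]/((a, b) == (0, 0)) xpair_eqE.
Qed.

Lemma fnormN n : fnorm (- n) = fnorm n.
Proof. by case: n => a b; rewrite /fnorm /= !abszN. Qed.

Lemma fnormD n k : (fnorm (n + k)%R <= fnorm n + fnorm k)%N.
Proof. case: n k => a b [c d]; rewrite /fnorm /=; lia. Qed.

Lemma fnormB n k : (fnorm (n - k)%R <= fnorm n + fnorm k)%N.
Proof. by rewrite -(fnormN k) fnormD. Qed.

Definition irange (N : nat) : seq int := [seq (i%:Z - N%:Z) | i <- iota 0 N.*2.+1].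

Arguments irange : simpl never.

Lemma mem_irange N a : (a \in irange N) = (`|a| <= N)%N.
Proof.
apply/mapP/idP => [[i]|h]; first by rewrite mem_iota => /andP[_ h] ->; lia.
by exists (absz (a + N%:Z)); [rewrite mem_iota|]; lia.
Qed.

Lemma uniq_irange N : uniq (irange N).
Proof. by rewrite map_inj_uniq ?iota_uniq // => i j; lia. Qed.

(** The origin is left out because all fields have zero mean and the weights divide by [fnorm n].
    Locked to keep simplification from enumerating the list. *)
HB.lock Definition box (N : nat) : seq (int * int) :=
  [seq n <- [seq (a, b) | a <- irange N, b <- irange N] | n != 0].

Lemma mem_box N n : (n \in box N) = (0 < fnorm n <= N)%N.
Proof.
rewrite box.unlock mem_filter lt0n fnorm0; congr (_ && _).
case: n => a b; rewrite /fnorm geq_max -!mem_irange.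
by apply/allpairsPdep/andP => [[c [d [? ? [-> ->]]]]|[? ?]] //; exists a, b.
Qed.

Lemma uniq_box N : uniq (box N).
Proof.
by rewrite box.unlock filter_uniq// allpairs_uniq ?uniq_irange// => -[? ?] [? ?].
Qed.

Lemma uniq_fbox (p : pred (int * int)) N : uniq [seq n <- box N | p n].
Proof. by rewrite filter_uniq// uniq_box. Qed.

Lemma box0F N : (0 : int * int) \in box N = false.
Proof. by rewrite mem_box /fnorm. Qed.

Lemma boxN N n : (- n \in box N) = (n \in box N).
Proof. by rewrite !mem_box fnormN. Qed.

Lemma size_box N : size (box N) = (4 * N * N.+1)%N.
Proof.
rewrite box.unlock.
have h : size [seq (a, b) | a <- irange N, b <- irange N] = (N.*2.+1 ^ 2)%N.
  by rewrite size_allpairs size_map size_iota mulnn.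
have := count_predC (fun n => n != 0) [seq (a, b) | a <- irange N, b <- irange N].
rewrite h -size_filter.
have -> : count (predC (fun n => n != 0)) [seq (a, b) | a <- irange N, b <- irange N] = 1%N.
  rewrite (eq_count (a2 := pred1 0)); last by move=> x /=; rewrite negbK.
  rewrite count_uniq_mem; last by rewrite allpairs_uniq ?uniq_irange// => -[? ?] [? ?].
  apply/eqP; rewrite eqb1; by apply/allpairsPdep; exists 0, 0; rewrite !mem_irange.
move=> e; apply/eqP; rewrite -(eqn_add2r 1) [X in X == _]e; apply/eqP; nia.
Qed.

Section Sums.
Variable R : realFieldType.
Implicit Types (N : nat) (f g : int * int -> R).

Lemma sum_box_filter N M f : (N <= M)%N ->
  \sum_(n <- box M | (fnorm n <= N)%N) f n = \sum_(n <- box N) f n.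
Proof.
move=> NM; rewrite -big_filter; apply: perm_big; apply: uniq_perm.
- by rewrite uniq_fbox.
- exact: uniq_box.
- by move=> n; rewrite mem_filter !mem_box; apply/idP/idP; lia.
Qed.

Lemma sum_boxS N f : \sum_(n <- box N.+1) f n =
  \sum_(n <- box N) f n + \sum_(n <- box N.+1 | fnorm n == N.+1) f n.
Proof.
rewrite (bigID (fun n => (fnorm n <= N)%N)) /= sum_box_filter//; congr (_ + _).
rewrite big_seq_cond [RHS]big_seq_cond; apply: eq_bigl => n.
rewrite mem_box; lia.
Qed.

(** In the max norm the shell of radius N + 1 has exactly 8 (N + 1) points. This is the reason for
    that norm: radial lattice sums become sums in one variable, estimated by induction on the
    radius. *)
Lemma sum_boxS_radial N (phi : nat -> R) : \sum_(n <- box N.+1) phi (fnorm n) =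
  \sum_(n <- box N) phi (fnorm n) + (8 * N.+1)%:R * phi N.+1.
Proof.
rewrite sum_boxS; congr (_ + _).
rewrite (eq_bigr (fun=> phi N.+1)); last by move=> n /eqP ->.
rewrite -big_filter big_const_seq count_predT iter_addr_0 size_filter mulr_natl.
congr (_ *+ _).
have := size_box N.+1; rewrite -(count_predC (fun n => (fnorm n <= N)%N)).
rewrite -size_filter.
have -> : size [seq n <- box N.+1 | (fnorm n <= N)%N] = size (box N).
  apply: perm_size; apply: uniq_perm; rewrite ?uniq_fbox ?uniq_box// => n.
  by rewrite mem_filter !mem_box; lia.
rewrite size_box (eq_in_count (a2 := fun n => fnorm n == N.+1)).
  by move=> h; set c := count _ _; have : (4 * N * N.+1 + c = 4 * N.+1 * N.+2)%N by []; clear; nia.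
by move=> n; rewrite mem_box /=; lia.
Qed.

Lemma box0 : box 0 = [::].
Proof. by apply/size0nil; rewrite size_box. Qed.

Lemma sum_box_inv N : \sum_(n <- box N) (fnorm n)%:R^-1 <= 8 * N%:R :> R.
Proof.
elim: N => [|N IH]; first by rewrite box0 big_nil mulr0.
rewrite (sum_boxS_radial N (fun r => r%:R^-1)) natrM mulfK ?pnatr_eq0//.
by rewrite -[X in _ <= _ * X]natr1 mulrDr mulr1 lerD2r.
Qed.

Lemma sum_box1 N : \sum_(n <- box N) 1 <= 8 * N%:R ^+ 2 :> R.
Proof.
rewrite big_const_seq count_predT iter_addr_0 size_box.
rewrite -natrX -natrM ler_nat; nia.
Qed.

Lemma sum_box_inv3 N : \sum_(n <- box N) (fnorm n)%:R^-1 ^+ 3 <= 16 :> R.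
Proof.
case: N => [|N]; first by rewrite box0 big_nil.
(* Strengthened to make the induction close: the shell of radius r contributes 8 / r^2, which is at
   most 8 / (r - 1) - 8 / r. The first shell gives equality. *)
suff : \sum_(n <- box N.+1) (fnorm n)%:R^-1 ^+ 3 <= 16 - 8 / N.+1%:R :> R.
  move=> h; apply: (le_trans h); rewrite gerBl; apply: divr_ge0 => //.
elim: N => [|N IH].
  rewrite (sum_boxS_radial 0 (fun r => r%:R^-1 ^+ 3)) box0 big_nil invr1; lra.
rewrite (sum_boxS_radial N.+1 (fun r => r%:R^-1 ^+ 3)) natrM.
apply: (le_trans (lerD IH (lexx _))).
set a : R := N.+1%:R; have a1 : 1 <= a by rewrite /a ler1n.
have -> : N.+2%:R = a + 1 :> R by rewrite /a natr1.
have a0 : a != 0 by lra.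
have a0' : a + 1 != 0 by lra.
clearbody a.
rewrite -subr_ge0.
have -> : 16 - 8 / (a + 1) - (16 - 8 / a + 8 * (a + 1) * (a + 1)^-1 ^+ 3) =
  8 / (a * (a + 1) ^+ 2) by field; rewrite ?a0 ?a0'.
by apply: divr_ge0 => //; apply: mulr_ge0; [lra|apply: sqr_ge0].
Qed.

(** The true growth is logarithmic. Linear growth is enough: this sum multiplies the squared
    truncation error, whose time integral decays like N^-2. *)
Lemma sum_box_inv2 N : \sum_(n <- box N) (fnorm n)%:R^-1 ^+ 2 <= 8 * N%:R :> R.
Proof.
apply: le_trans (sum_box_inv N); rewrite big_seq [leRHS]big_seq; apply: ler_sum => n.
rewrite mem_box => /andP[n0 _]; rewrite expr2 ger_pMl ?invr_gt0 ?ltr0n//.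
by rewrite invf_le1 ?ltr0n// ler1n.
Qed.

(** Meant for the translations in a convolution, which do not preserve the box. As [f] vanishes
    outside the box, points that leave it contribute nothing, and injectivity prevents
    repetitions. *)
Lemma sum_inj_le N f (h : int * int -> int * int) : injective h ->
  (forall n, 0 <= f n) -> (forall n, n \notin box N -> f n = 0) ->
  \sum_(n <- box N) f (h n) <= \sum_(n <- box N) f n.
Proof.
move=> hi f0 fN.
rewrite -(big_map h xpredT f) (bigID (mem (box N))) /=.
rewrite [X in _ + X]big1 ?addr0//; rewrite -big_filter.
set s := seq.filter _ _.
have us : uniq s by apply: filter_uniq; rewrite map_inj_uniq// uniq_box.
rewrite [leRHS](bigID (mem s)) /= -[leLHS]addr0; apply: lerD; last first.
  by apply: sumr_ge0.
rewrite -[leRHS]big_filter le_eqVlt; apply/orP; left; apply/eqP/perm_big.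
apply: uniq_perm => //; first by rewrite uniq_fbox.
move=> n; rewrite /s !mem_filter /=; by case: (n \in box N); rewrite ?andbT ?andbF.
Qed.

Lemma sum_conv_sym N (n : int * int) (F : int * int -> int * int -> R) :
  \sum_(k <- box N | n - k \in box N) F k (n - k) =
  \sum_(l <- box N | n - l \in box N) F (n - l) l.
Proof.
rewrite -big_filter -[RHS]big_filter.
rewrite [RHS](eq_bigr (fun l => (fun k => F k (n - k)) (n - l))); last first.
  by move=> l _; rewrite subKr.
rewrite -(big_map (fun l => n - l) xpredT (fun k => F k (n - k))).
apply: perm_big; apply: uniq_perm.
- by rewrite uniq_fbox.
- rewrite map_inj_uniq ?uniq_fbox// => x y /(congr1 (fun z => n - z)).
  by rewrite !subKr.
- move=> k; rewrite mem_filter; apply/idP/mapP => [/andP[h1 h2]|[l]].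
    by exists (n - k); rewrite ?subKr// mem_filter subKr h1 h2.
  by rewrite mem_filter => /andP[h1 h2] ->; rewrite subKr h1 h2.
Qed.

Lemma conv_box_le N f g : (forall n, 0 <= f n) -> (forall n, 0 <= g n) ->
  \sum_(n <- box N) \sum_(k <- box N | n - k \in box N) f k * g (n - k) <=
  (\sum_(k <- box N) f k) * (\sum_(k <- box N) g k).
Proof.
move=> f0 g0.
rewrite (eq_bigr (fun n => \sum_(k <- box N)
  (f k * (if n - k \in box N then g (n - k) else 0)))); last first.
  move=> n _; rewrite big_mkcond /=; apply: eq_bigr => k _.
  by case: ifP; rewrite ?mulr0.
rewrite exchange_big /= mulr_suml; apply: ler_sum => k _.
rewrite -mulr_sumr; apply: ler_wpM2l => //.
have -> : \sum_(k <- box N) g k = \sum_(k <- box N) (if k \in box N then g k else 0).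
  by rewrite [LHS]big_seq [RHS]big_seq; apply: eq_bigr => l ->.
apply: (@sum_inj_le N (fun n => if n \in box N then g n else 0) (fun n => n - k)).
- by move=> x y /(congr1 (fun z => z + k)); rewrite !subrK.
- by move=> n; case: ifP.
- by move=> n /negbTE ->.
Qed.

End Sums.

(** * Convolutions and trilinear estimates *)

Section Convolution.
Variable R : realFieldType.
Implicit Types (N : nat) (a b D X : int * int -> R) (n k l : int * int).

Lemma ler_of_sqr (x y : R) : 0 <= y -> x ^+ 2 <= y ^+ 2 -> x <= y.
Proof.
move=> y0 h; have [//|yx] := leP x y.
suff : y ^+ 2 < x ^+ 2 by rewrite ltNge h.
by rewrite ltr_pXn2r ?nnegrE//; lra.
Qed.

(** Cauchy-Schwarz without square roots: [z i ^+ 2] is compared with the product [u i * v i], so a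
    weight and its inverse can be put into the two factors directly. *)
Lemma cauchy_weight (I : eqType) (s : seq I) (P : pred I) (z u v : I -> R) :
  (forall i, 0 <= u i) -> (forall i, 0 <= v i) ->
  (forall i, i \in s -> P i -> z i ^+ 2 <= u i * v i) ->
  (\sum_(i <- s | P i) z i) ^+ 2 <=
  (\sum_(i <- s | P i) u i) * (\sum_(i <- s | P i) v i).
Proof.
move=> u0 v0; elim: s => [_|i s IH zuv]; first by rewrite !big_nil expr0n mul0r.
have {}IH : (\sum_(j <- s | P j) z j) ^+ 2 <=
    (\sum_(j <- s | P j) u j) * (\sum_(j <- s | P j) v j).
  by apply: IH => j js; apply: zuv; rewrite inE js orbT.
rewrite !big_cons; case: ifP => // Pi.
move: IH (u0 i) (v0 i) (zuv i (mem_head _ _) Pi).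
have : 0 <= \sum_(j <- s | P j) u j by apply: sumr_ge0.
have : 0 <= \sum_(j <- s | P j) v j by apply: sumr_ge0.
move: (\sum_(j <- s | P j) z j) (\sum_(j <- s | P j) u j) (\sum_(j <- s | P j) v j).
move: (z i) (u i) (v i) => x a b S U V V0 U0 SUV a0 b0 xab.
(* The cross term: (S x)^2 is at most (U b)(V a), and the geometric mean is at most the arithmetic
   mean. *)
have h : 2 * (S * x) <= U * b + V * a.
  have Ub : 0 <= U * b by exact: mulr_ge0.
  have Va : 0 <= V * a by exact: mulr_ge0.
  apply: ler_of_sqr; first lra.
  have : S ^+ 2 * x ^+ 2 <= (U * V) * (a * b) by apply: ler_pM => //; exact: sqr_ge0.
  have : 0 <= (U * b - V * a) ^+ 2 by exact: sqr_ge0.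
  nra.
nra.
Qed.

Definition sqnorm (m N : nat) a : R := \sum_(n <- box N) (fnorm n)%:R ^+ m * a n ^+ 2.

Definition conv N a b n : R := \sum_(k <- box N | n - k \in box N) a k * b (n - k).

Lemma sqnorm_ge0 m N a : 0 <= sqnorm m N a.
Proof. by apply: sumr_ge0 => n _; rewrite mulr_ge0 ?sqr_ge0// exprn_ge0. Qed.

Lemma fnorm_ge1 N n : n \in box N -> 1 <= (fnorm n)%:R :> R.
Proof. by rewrite mem_box ler1n => /andP[]. Qed.

Lemma ler_sum_subpred (I : eqType) (s : seq I) (P Q : pred I) (f : I -> R) :
  (forall i, i \in s -> P i -> Q i) -> (forall i, 0 <= f i) ->
  \sum_(i <- s | P i) f i <= \sum_(i <- s | Q i) f i.
Proof.
move=> PQ f0; rewrite big_mkcond [leRHS]big_mkcond /= big_seq [leRHS]big_seq.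
apply: ler_sum => i /PQ; case: (P i) => [->//|_]; by case: ifP.
Qed.

(** Cauchy-Schwarz with the weights |k|^2 |n - k|^2 leaves the sum over k of |n| |k|^-2 |n - k|^-2,
    to be bounded uniformly in n. As |n| is at most |k| + |n - k|, each term is at most |k|^-3 + |n
    - k|^-3, and both cubic sums are at most 16. This is the product rule from H^1 times H^1 to
    H^(1/2) in dimension two. *)
Lemma conv_sqnorm N a b :
  \sum_(n <- box N) (fnorm n)%:R * conv N a b n ^+ 2 <=
  32 * sqnorm 2 N a * sqnorm 2 N b.
Proof.
pose wt n : R := (fnorm n)%:R.
pose A n := wt n ^+ 2 * a n ^+ 2; pose B n := wt n ^+ 2 * b n ^+ 2.
have A0 n : 0 <= A n by rewrite mulr_ge0 ?sqr_ge0.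
have B0 n : 0 <= B n by rewrite mulr_ge0 ?sqr_ge0.
rewrite -mulrA mulrC.
apply: (@le_trans _ _ ((\sum_(n <- box N) conv N A B n) * 32)); last first.
  by apply: ler_wpM2r => //; exact: conv_box_le.
rewrite mulr_suml big_seq [leRHS]big_seq; apply: ler_sum => n nN.
have n1 : 1 <= wt n by exact: fnorm_ge1 nN.
have h : conv N a b n ^+ 2 <= conv N A B n *
    \sum_(k <- box N | n - k \in box N) ((wt k)^-1 * (wt (n - k))^-1) ^+ 2.
  apply: cauchy_weight => k => [||kN lN].
  - exact: mulr_ge0.
  - exact: sqr_ge0.
  - have := fnorm_ge1 kN; have := fnorm_ge1 lN; rewrite -/(wt k) -/(wt (n - k)).
    move=> ? ?; rewrite le_eqVlt; apply/orP; left; apply/eqP.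
    by rewrite /A /B; field; rewrite !gt_eqF//; lra.
apply: (le_trans (ler_wpM2l _ h)); first exact: ler0n.
rewrite mulrCA; apply: ler_wpM2l.
  by apply: sumr_ge0 => k _; exact: mulr_ge0.
rewrite mulr_sumr.
apply: (@le_trans _ _ (\sum_(k <- box N | n - k \in box N)
    ((wt k)^-1 ^+ 3 + (wt (n - k))^-1 ^+ 3))).
  rewrite big_seq_cond [leRHS]big_seq_cond; apply: ler_sum => k /andP[kN lN].
  have := fnorm_ge1 kN; have := fnorm_ge1 lN; rewrite -/(wt k) -/(wt (n - k)).
  have : wt n <= wt k + wt (n - k).
    by rewrite -natrD ler_nat -{1}(subrK k n) addrC; exact: fnormD.
  rewrite -/(wt n); move: (wt n) (wt k) (wt (n - k)) => x y z xyz z1 y1.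
  have z0 : 0 < z^-1 by rewrite invr_gt0; lra.
  have y0 : 0 < y^-1 by rewrite invr_gt0; lra.
  apply: (@le_trans _ _ ((y + z) * (y^-1 / z) ^+ 2)).
    by apply: ler_wpM2r => //; exact: sqr_ge0.
  have -> : (y + z) * (y^-1 / z) ^+ 2 = y^-1 * z^-1 ^+ 2 + y^-1 ^+ 2 * z^-1.
    by field; rewrite !gt_eqF//; lra.
  rewrite -subr_ge0.
  have -> : y^-1 ^+ 3 + z^-1 ^+ 3 - (y^-1 * z^-1 ^+ 2 + y^-1 ^+ 2 * z^-1) =
    (y^-1 + z^-1) * (y^-1 - z^-1) ^+ 2 by ring.
  by apply: mulr_ge0; [lra|exact: sqr_ge0].
rewrite big_split /= (_ : 32 = 16 + 16); last by lra.
have h0 k : 0 <= (wt k)^-1 ^+ 3 by rewrite exprn_ge0// invr_ge0 ler0n.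
apply: lerD.
  apply: le_trans (sum_box_inv3 R N).
  by apply: (@ler_sum_subpred _ _ _ xpredT).
rewrite (sum_conv_sym N n (fun k l => (wt l)^-1 ^+ 3)).
apply: le_trans (sum_box_inv3 R N).
by apply: (@ler_sum_subpred _ _ _ xpredT).
Qed.

Lemma sum_box_filter_le N L a : (forall n, 0 <= a n) ->
  \sum_(n <- box N | (fnorm n <= L)%N) a n <= \sum_(n <- box L) a n.
Proof.
move=> a0; have [LN|/ltnW NL] := leqP L N; first by rewrite sum_box_filter.
apply: (@le_trans _ _ (\sum_(n <- box N) a n)).
  by apply: (@ler_sum_subpred _ _ _ xpredT).
by rewrite -(sum_box_filter _ NL); apply: (@ler_sum_subpred _ _ _ xpredT).
Qed.

(** Cauchy-Schwarz with the weights |k|^-1 and |k|. The restriction to |k| at most |n| bounds the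
    sum of |k|^-1 by 8 |n|, independently of N. *)
Lemma conv_low N X D n : n \in box N ->
  (\sum_(k <- box N | (n - k \in box N) && (fnorm k <= fnorm n)%N) X k * D (n - k)) ^+ 2
  <= 8 * (fnorm n)%:R * conv N (fun k => (fnorm k)%:R * X k ^+ 2) (fun l => D l ^+ 2) n.
Proof.
move=> nN; pose wt n : R := (fnorm n)%:R.
pose P k := (n - k \in box N) && (fnorm k <= fnorm n)%N.
have i0 k : 0 <= (wt k)^-1 by rewrite invr_ge0 ler0n.
have v0 k : 0 <= wt k * X k ^+ 2 * D (n - k) ^+ 2.
  by apply: mulr_ge0 (sqr_ge0 _); apply: mulr_ge0 (sqr_ge0 _); exact: ler0n.
apply: (@le_trans _ _ ((\sum_(k <- box N | P k) (wt k)^-1) *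
    \sum_(k <- box N | P k) (wt k * X k ^+ 2 * D (n - k) ^+ 2))).
  apply: cauchy_weight => // k kN _.
  have := fnorm_ge1 kN; rewrite -/(wt k) => k1.
  rewrite le_eqVlt; apply/orP; left; apply/eqP; field.
  by rewrite gt_eqF//; lra.
apply: ler_pM; try by apply: sumr_ge0.
- apply: le_trans (sum_box_inv R (fnorm n)).
  apply: le_trans (sum_box_filter_le N (fnorm n) i0).
  by apply: ler_sum_subpred => // k _ /andP[].
- by apply: ler_sum_subpred => // k _ /andP[].
Qed.

Definition trilinear N X D : R := \sum_(n <- box N) conv N X D n * (D n / (fnorm n)%:R).

Definition energy N D : R := \sum_(n <- box N) (D n / (fnorm n)%:R) ^+ 2.

(** Interpolation of H^(1/2) between L^2 and H^1. It turns the fourth power of the H^(1/2) norm into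
    a quantity that is integrable in time for a field bounded in L^2 and square integrable in
    H^1. *)
Lemma sqnorm_interp N X : sqnorm 1 N X ^+ 2 <= sqnorm 0 N X * sqnorm 2 N X.
Proof.
apply: cauchy_weight => [n|n|n _ _];
  try by apply: mulr_ge0 (sqr_ge0 _); apply: exprn_ge0; exact: ler0n.
rewrite le_eqVlt; apply/orP; left; apply/eqP; ring.
Qed.

(** Here |k| exceeds |n|, so |n - k| is below 2 |k|. Young's inequality splits each product so that
    one square contains |k| X_k and an H^-1 density of [D], the other only [D]. In the latter the
    number of admissible indices, of order |n|^2, cancels the weight of the H^-1 density and leaves
    the L^2 norm. *)
Lemma trilinear_high N X D e : 0 < e -> (forall n, 0 <= X n) -> (forall n, 0 <= D n) ->
  \sum_(n <- box N) (\sum_(k <- box N | (n - k \in box N) && (fnorm n < fnorm k)%N)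
     X k * D (n - k)) * (D n / (fnorm n)%:R) <=
  e^-1 * sqnorm 2 N X * energy N D + 20 * e * sqnorm 0 N D.
Proof.
move=> e0 X0 D0; pose wt n : R := (fnorm n)%:R.
pose A k := (wt k * X k) ^+ 2; pose E k := (D k / wt k) ^+ 2.
have A0 k : 0 <= A k by exact: sqr_ge0.
have E0 k : 0 <= E k by exact: sqr_ge0.
(* [T1] and [T2] collect the squares that contain [X], [T3] and [T4] those that contain only [D].
   [T1] and [T3] serve the indices with |n - k| at most |n|, [T2] and [T4] the others. *)
pose T1 n := \sum_(k <- box N | n - k \in box N) A k * E (n - k).
pose T2 n := (\sum_(k <- box N) A k) * E n.
pose T3 n := \sum_(l <- box N | n - l \in box N) (fnorm l <= fnorm n)%N%:R * E n.
pose T4 n := \sum_(l <- box N | n - l \in box N) (fnorm n <= fnorm l)%N%:R * E l.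
apply: (@le_trans _ _ (\sum_(n <- box N)
    (e^-1 / 2 * (T1 n + T2 n) + e / 2 * (T3 n + 4 * T4 n)))).
  rewrite big_seq [leRHS]big_seq; apply: ler_sum => n nN.
  have n1 := fnorm_ge1 nN.
  have -> : T3 n = \sum_(k <- box N | n - k \in box N) (fnorm (n - k)%R <= fnorm n)%N%:R * E n.
    by rewrite (sum_conv_sym N n (fun k l => (fnorm l <= fnorm n)%N%:R * E n)).
  have -> : T4 n = \sum_(k <- box N | n - k \in box N) (fnorm n <= fnorm (n - k)%R)%N%:R * E (n - k).
    by rewrite (sum_conv_sym N n (fun k l => (fnorm n <= fnorm l)%N%:R * E l)).
  have hT2 : \sum_(k <- box N | n - k \in box N) A k * E n <= T2 n.
    rewrite /T2 mulr_suml; apply: (@ler_sum_subpred _ _ _ xpredT) => // k.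
    exact: mulr_ge0.
  apply: (@le_trans _ _ (e^-1 / 2 * (T1 n + \sum_(k <- box N | n - k \in box N) A k * E n)
     + e / 2 * (\sum_(k <- box N | n - k \in box N) (fnorm (n - k)%R <= fnorm n)%N%:R * E n
     + 4 * \sum_(k <- box N | n - k \in box N) (fnorm n <= fnorm (n - k)%R)%N%:R * E (n - k)))); last first.
    apply: lerD => //; apply: ler_wpM2l; last exact: lerD.
    by rewrite divr_ge0// invr_ge0 ltW.
  rewrite mulr_suml /T1 mulr_sumr -!big_split /= !mulr_sumr -!big_split /=.
  rewrite big_seq_cond [leRHS]big_seq_cond big_mkcond [leRHS]big_mkcond /=.
  apply: ler_sum => k _.
  have [kN|] := boolP (k \in box N) => //=.
  have [lN|] := boolP (n - k \in box N) => //=.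
  have k1 := fnorm_ge1 kN; have l1 := fnorm_ge1 lN.
  have e20 : 0 <= e / 2 by lra.
  have ei0 : 0 <= e^-1 / 2 by rewrite divr_ge0// invr_ge0 ltW.
  case: ifP => [nk|_]; last first.
    by apply: addr_ge0; apply: mulr_ge0 => //; apply: addr_ge0; do ?apply: mulr_ge0 => //.
  have amgm (x y : R) : x * y <= e^-1 / 2 * x ^+ 2 + e / 2 * y ^+ 2.
    rewrite -subr_ge0.
    have -> : e^-1 / 2 * x ^+ 2 + e / 2 * y ^+ 2 - x * y = (x - e * y) ^+ 2 / (2 * e).
      by field; rewrite gt_eqF.
    by rewrite divr_ge0 ?sqr_ge0// mulr_ge0// ltW.
  have nkR : wt n <= wt k by rewrite ler_nat ltnW.
  have ki0 : 0 < (wt k)^-1 by rewrite invr_gt0; rewrite /wt; lra.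
  have [ln|/ltnW nl] := leqP (fnorm (n - k)) (fnorm n).
  - have := amgm (wt k * X k * (D (n - k) / wt (n - k))) (D n / wt n * (wt (n - k) / wt k)).
    have -> : wt k * X k * (D (n - k) / wt (n - k)) * (D n / wt n * (wt (n - k) / wt k)) =
       X k * D (n - k) * (D n / wt n).
      by field; rewrite !gt_eqF// /wt; lra.
    move=> h; apply: (le_trans h); apply: lerD.
      apply: ler_wpM2l => //; rewrite exprMn -/(A k) -/(E (n - k)).
      by rewrite lerDl mulr_ge0.
    apply: ler_wpM2l => //; rewrite exprMn -/(E n) mul1r.
    have hE : E n * (wt (n - k) / wt k) ^+ 2 <= E n.
      rewrite ler_piMr// exprn_ile1//.
        by rewrite divr_ge0 /wt.
      by rewrite ler_pdivrMr ?mul1r /wt ?ler_nat; [rewrite (leq_trans ln)// ltnW|lra].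
    by apply: (le_trans hE); rewrite lerDl; do ?apply: mulr_ge0 => //.
  - have := amgm (wt k * X k * (D n / wt n)) (D (n - k) / wt k).
    have -> : wt k * X k * (D n / wt n) * (D (n - k) / wt k) =
       X k * D (n - k) * (D n / wt n).
      by field; rewrite !gt_eqF// /wt; lra.
    move=> h; apply: (le_trans h); apply: lerD.
      apply: ler_wpM2l => //; rewrite exprMn -/(A k) -/(E n).
      by rewrite lerDr mulr_ge0.
    apply: ler_wpM2l => //; rewrite nl mul1r mul0r add0r.
    have : (D (n - k) / wt k) ^+ 2 <= 4 * E (n - k).
      rewrite /E.
      have -> : 4 * (D (n - k) / wt (n - k)) ^+ 2 = (2 * (D (n - k) / wt (n - k))) ^+ 2 by ring.
      rewrite ler_pXn2r ?nnegrE//; try by do ?apply: mulr_ge0; rewrite ?invr_ge0 ?ler0n ?D0.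
      rewrite mulrCA; apply: ler_wpM2l => //.
      rewrite -[2]invrK -invfM lef_pV2 ?posrE; [|rewrite /wt; lra|rewrite /wt; lra].
      have : wt (n - k) <= wt n + wt k by rewrite -natrD ler_nat fnormB.
      lra.
    by [].
have hT1 : \sum_(n <- box N) T1 n <= sqnorm 2 N X * energy N D.
  apply: (le_trans (conv_box_le N A0 E0)); rewrite /sqnorm /energy.
  rewrite le_eqVlt; apply/orP; left; apply/eqP; congr (_ * _).
  by apply: eq_bigr => k _; rewrite /A exprMn.
have hT2 : \sum_(n <- box N) T2 n = sqnorm 2 N X * energy N D.
  by rewrite /T2 -mulr_sumr; congr (_ * _); apply: eq_bigr => k _; rewrite /A exprMn.
have count n L : n \in box N -> 0 <= L ->
   \sum_(l <- box N) (fnorm l <= fnorm n)%N%:R * (L / wt n ^+ 2) <= 8 * L.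
  move=> nN L0; have n1 := fnorm_ge1 nN.
  rewrite -mulr_suml mulrCA.
  have -> : \sum_(l <- box N) (fnorm l <= fnorm n)%N%:R =
      \sum_(l <- box N | (fnorm l <= fnorm n)%N) 1 :> R.
    by rewrite [RHS]big_mkcond /=; apply: eq_bigr => l _; case: leqP.
  have -> : 8 * L = L * (8 * wt n ^+ 2 / wt n ^+ 2).
    by field; rewrite gt_eqF// /wt; lra.
  apply: ler_wpM2l => //; apply: ler_wpM2r; first by rewrite invr_ge0 sqr_ge0.
  apply: le_trans (sum_box1 R (fnorm n)).
  exact: (@sum_box_filter_le N (fnorm n) (fun=> 1)).
have hT3 : \sum_(n <- box N) T3 n <= 8 * sqnorm 0 N D.
  rewrite /sqnorm mulr_sumr big_seq [leRHS]big_seq; apply: ler_sum => n nN.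
  rewrite expr0 mul1r; apply: le_trans (count n (D n ^+ 2) nN (sqr_ge0 _)).
  rewrite /T3 /E expr_div_n.
  by apply: (@ler_sum_subpred _ _ _ xpredT) => // l; rewrite mulr_ge0 ?divr_ge0 ?sqr_ge0.
have hT4 : \sum_(n <- box N) T4 n <= 8 * sqnorm 0 N D.
  rewrite /T4 (eq_bigr (fun n => \sum_(l <- box N)
      (if n - l \in box N then (fnorm n <= fnorm l)%N%:R * E l else 0))); last first.
    by move=> n _; rewrite big_mkcond.
  rewrite exchange_big /= /sqnorm mulr_sumr big_seq [leRHS]big_seq.
  apply: ler_sum => l lN.
  rewrite expr0 mul1r; apply: le_trans (count l (D l ^+ 2) lN (sqr_ge0 _)).
  rewrite /E expr_div_n; apply: ler_sum => n _.
  by case: ifP => // _; rewrite mulr_ge0 ?divr_ge0 ?sqr_ge0.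
clearbody T1 T2 T3 T4.
rewrite big_split /= -!mulr_sumr !big_split /= -mulr_sumr.
have -> : e^-1 * sqnorm 2 N X * energy N D =
   e^-1 / 2 * (sqnorm 2 N X * energy N D + sqnorm 2 N X * energy N D) by field; rewrite gt_eqF.
apply: lerD.
  by apply: ler_wpM2l; [rewrite divr_ge0// invr_ge0 ltW|rewrite hT2 lerD2r].
have -> : 20 * e * sqnorm 0 N D = e / 2 * (8 * sqnorm 0 N D + 4 * (8 * sqnorm 0 N D)) by field.
by apply: ler_wpM2l; [lra|apply: lerD => //; apply: ler_wpM2l].
Qed.

(** Young's inequality is used twice: on the inner sum, through [conv_low], which leaves the
    H^(-1/2) density D_n^2 / |n|, and then to split that density between L^2 and H^-1. The weights
    contain [s], the squared H^(1/2) norm of [X] with 1 added to allow division, so that the L^2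
    part does not depend on [X]. *)
Lemma trilinear_low N X D e : 0 < e -> (forall n, 0 <= X n) -> (forall n, 0 <= D n) ->
  \sum_(n <- box N) (\sum_(k <- box N | (n - k \in box N) && (fnorm k <= fnorm n)%N)
     X k * D (n - k)) * (D n / (fnorm n)%:R) <=
  2 * e * sqnorm 0 N D + (sqnorm 1 N X + 1) ^+ 2 / e ^+ 3 * energy N D.
Proof.
move=> e0 X0 D0; pose wt n : R := (fnorm n)%:R.
set s := sqnorm 1 N X + 1.
have s0 : 0 < s by rewrite /s ltr_wpDl// sqnorm_ge0.
pose A n := \sum_(k <- box N | (n - k \in box N) && (fnorm k <= fnorm n)%N) X k * D (n - k).
pose Q n := conv N (fun k => (fnorm k)%:R * X k ^+ 2) (fun l => D l ^+ 2) n.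
apply: (@le_trans _ _ (\sum_(n <- box N)
   (e / s * Q n + (e * D n ^+ 2 + s ^+ 2 / e ^+ 3 * (D n / wt n) ^+ 2)))).
  rewrite big_seq [leRHS]big_seq; apply: ler_sum => n nN.
  have n1 := fnorm_ge1 nN; rewrite -/(wt n) in n1 *.
  have := conv_low X D nN; rewrite -/(A n) -/(Q n) -/(wt n).
  move: (A n) (Q n) (D n) (wt n) n1 => a q d w w1 aq.
  apply: (@le_trans _ _ (e / (8 * s * w) * a ^+ 2 + 2 * s / e * d ^+ 2 / w)).
    rewrite -subr_ge0.
    have -> : e / (8 * s * w) * a ^+ 2 + 2 * s / e * d ^+ 2 / w - a * (d / w) =
      (e * a - 4 * s * d) ^+ 2 / (8 * s * w * e) by field; rewrite !gt_eqF//; lra.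
    by rewrite divr_ge0 ?sqr_ge0// !mulr_ge0// ltW//; lra.
  apply: lerD.
    have -> : e / s * q = e / (8 * s * w) * (8 * w * q) by field; rewrite !gt_eqF//; lra.
    by apply: ler_wpM2l => //; rewrite divr_ge0 ?(ltW e0)// !mulr_ge0 ?(ltW s0)//; lra.
  rewrite -subr_ge0.
  have -> : e * d ^+ 2 + s ^+ 2 / e ^+ 3 * (d / w) ^+ 2 - 2 * s / e * d ^+ 2 / w =
     (e ^+ 2 * w - s) ^+ 2 * d ^+ 2 / (e ^+ 3 * w ^+ 2).
    by field; rewrite !gt_eqF//; lra.
  apply: divr_ge0; first by apply: mulr_ge0; exact: sqr_ge0.
  by apply: mulr_ge0; [apply: exprn_ge0; exact: ltW|exact: sqr_ge0].
rewrite !big_split /= -!mulr_sumr -/(energy N D).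
rewrite [leLHS]addrA lerD2r.
have -> : \sum_(n <- box N) D n ^+ 2 = sqnorm 0 N D.
  by apply: eq_bigr => n _; rewrite mul1r.
have : \sum_(n <- box N) Q n <= sqnorm 1 N X * sqnorm 0 N D.
  apply: (le_trans (conv_box_le N _ _)).
  - by move=> k; rewrite mulr_ge0 ?sqr_ge0.
  - by move=> k; exact: sqr_ge0.
  rewrite le_eqVlt; apply/orP; left; apply/eqP; congr (_ * _); apply: eq_bigr => k _.
  by rewrite mul1r.
move=> h.
have : e / s * \sum_(n <- box N) Q n <= e * sqnorm 0 N D.
  have -> : e * sqnorm 0 N D = e / s * (s * sqnorm 0 N D) by field; rewrite gt_eqF.
  apply: ler_wpM2l; first by apply: divr_ge0; exact: ltW.
  apply: (le_trans h); apply: ler_wpM2r; first exact: sqnorm_ge0.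
  by rewrite /s lerDl.
lra.
Qed.

Lemma trilinear_le N X D e : 0 < e -> (forall n, 0 <= X n) -> (forall n, 0 <= D n) ->
  trilinear N X D <= e * sqnorm 0 N D +
   (40 / e * sqnorm 2 N X + 64 / e ^+ 3 * (2 + 2 * (sqnorm 0 N X * sqnorm 2 N X)))
   * energy N D.
Proof.
move=> e0 X0 D0; have E0 : 0 <= energy N D by apply: sumr_ge0 => n _; exact: sqr_ge0.
have -> : trilinear N X D =
  \sum_(n <- box N) (\sum_(k <- box N | (n - k \in box N) && (fnorm k <= fnorm n)%N)
     X k * D (n - k)) * (D n / (fnorm n)%:R) +
  \sum_(n <- box N) (\sum_(k <- box N | (n - k \in box N) && (fnorm n < fnorm k)%N)
     X k * D (n - k)) * (D n / (fnorm n)%:R).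
  rewrite -big_split /=; apply: eq_bigr => n _; rewrite -mulrDl; congr (_ * _).
  rewrite /conv (bigID (fun k => (fnorm k <= fnorm n)%N)) /=; congr (_ + _).
  by apply: eq_bigl => k; rewrite -ltnNge.
(* The low part spends 2 (e / 4) and the high part 20 (e / 40), in all e. *)
have e4 : 0 < e / 4 by lra.
have e40 : 0 < e / 40 by lra.
have h1 := trilinear_low N e4 X0 D0; have h2 := trilinear_high N e40 X0 D0.
apply: (le_trans (lerD h1 h2)).
have h3 : (sqnorm 1 N X + 1) ^+ 2 / (e / 4) ^+ 3 * energy N D <=
   64 / e ^+ 3 * (2 + 2 * (sqnorm 0 N X * sqnorm 2 N X)) * energy N D.
  apply: ler_wpM2r => //.
  have -> : (sqnorm 1 N X + 1) ^+ 2 / (e / 4) ^+ 3 = 64 / e ^+ 3 * (sqnorm 1 N X + 1) ^+ 2.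
    by field; rewrite gt_eqF.
  apply: ler_wpM2l; first by rewrite divr_ge0// exprn_ge0// ltW.
  have := sqnorm_interp N X; have := sqr_ge0 (sqnorm 1 N X - 1); nra.
have -> : (e / 40)^-1 * sqnorm 2 N X = 40 / e * sqnorm 2 N X by field; rewrite gt_eqF.
rewrite mulrDl; lra.
Qed.

End Convolution.

(** * Differential inequalities on the line *)

Section ODE.
Variable R : realType.
Implicit Types (f g h y : R -> R) (t : R).

Lemma nonincreasing_of_derive f df (T : R) : continuous f ->
  (forall t, 0 < t < T -> is_derive t 1 f (df t)) ->
  (forall t, 0 < t < T -> df t <= 0) ->
  forall t, 0 <= t <= T -> f t <= f 0.
Proof.
move=> cf fdf df0 t /andP[t0 tT].
move: t0; rewrite le_eqVlt => /predU1P[<-//|t0].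
have [x|x|c] := @MVT _ f df 0 t t0.
- by rewrite in_itv/= => /andP[x0 xt]; apply: fdf; rewrite x0 (lt_le_trans xt).
- exact: continuous_subspaceT.
- rewrite in_itv/= subr0 => /andP[c0 ct] E; rewrite -subr_le0 E.
  by rewrite mulr_le0_ge0 ?(ltW t0)// df0// c0 (lt_le_trans ct).
Qed.

Lemma is_derive_eq' f t (a b : R) : is_derive t 1 f a -> a = b -> is_derive t 1 f b.
Proof. by move=> ? <-. Qed.

Lemma is_derive_expR_comp f t (a : R) : is_derive t 1 f a ->
  is_derive t 1 (fun s => expR (f s)) (expR (f t) * a).
Proof.
by move=> fa; exact: (is_derive1_comp (is_derive_expR (f t)) fa).
Qed.

Lemma is_deriveM1 f g t (a b : R) : is_derive t 1 f a -> is_derive t 1 g b ->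
  is_derive t 1 (fun s => f s * g s) (a * g t + f t * b).
Proof.
move=> fa gb; apply: (is_derive_eq' (is_deriveM fa gb)).
by rewrite /GRing.scale/= addrC [g t * a]mulrC.
Qed.

Lemma is_deriveZ1 f t (c l : R) : is_derive t 1 f l -> is_derive t 1 (fun r => c * f r) (c * l).
Proof. by move=> h; exact: (is_deriveZ c h). Qed.

Lemma continuous_expR_comp f : continuous f -> continuous (fun s => expR (f s)).
Proof. by move=> cf t; apply: continuous_comp; [exact: cf|exact: continuous_expR]. Qed.

(** The function y exp (- G) - H is nonincreasing, as exp (- G) is at most 1. The coefficients enter
    through their primitives [G] and [H], so the argument involves derivatives only and no
    integral. *)
Lemma gronwall y dy g h G H (T : R) : continuous y -> continuous G -> continuous H ->
  (forall t, 0 < t < T -> is_derive t 1 y (dy t)) ->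
  (forall t, 0 < t < T -> is_derive t 1 G (g t)) ->
  (forall t, 0 < t < T -> is_derive t 1 H (h t)) ->
  G 0 = 0 -> H 0 = 0 ->
  (forall t, 0 < t < T -> dy t <= g t * y t + h t) ->
  (forall t, 0 < t < T -> 0 <= G t) -> (forall t, 0 < t < T -> 0 <= h t) ->
  forall t, 0 <= t <= T -> y t <= (y 0 + H t) * expR (G t).
Proof.
move=> cy cG cH yd Gd Hd G0 H0 ineq Gge0 hge0 t tT.
pose z s := y s * expR (- G s) - H s.
have cz : continuous z.
  move=> s; apply: cvgB; last exact: cH.
  apply: cvgM; first exact: cy.
  by apply: (@continuous_expR_comp (fun r => - G r)) => r; apply: cvgN; exact: cG.
have zd s : 0 < s < T -> is_derive s 1 z (dy s * expR (- G s) +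
     y s * (expR (- G s) * - g s) - h s).
  move=> sT; apply: is_deriveB; last exact: Hd.
  apply: is_deriveM1; first exact: yd.
  by apply: is_derive_expR_comp; apply: is_deriveN; exact: Gd.
have := nonincreasing_of_derive cz zd _ tT.
rewrite /z G0 H0 oppr0 expR0 mulr1 addr0 => key.
rewrite -ler_pdivrMr ?expR_gt0// -expRN -lerBlDr; apply: key => s sT.
have e1 : expR (- G s) <= 1 by rewrite -expR0 ler_expR oppr_le0 Gge0.
have e0 := expR_gt0 (- G s).
have := ineq s sT; have := hge0 s sT; nra.
Qed.

Lemma continuous_of_is_derive f g : (forall x : R, is_derive x 1 f (g x)) -> continuous f.
Proof.
move=> fg x; apply: differentiable_continuous; apply/derivable1_diffP.
by have [] := fg x.
Qed.

Lemma primitive_line f : continuous f ->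
  exists2 F : R -> R, F 0 = 0 & forall t : R, is_derive t 1 F (f t).
Proof.
move=> cf.
(* glued from the integrals based at [- a] *)
pose F1 (a b : R) := \int[@lebesgue_measure R]_(s in `[a, b]) f s.
have F1d (a b : R) : a < b -> is_derive b 1 (F1 a) (f b).
  move=> ab.
  have bu : b < b + 1 by lra.
  have int : (@lebesgue_measure R).-integrable `[a, (b + 1)] (EFin \o f).
    apply: continuous_compact_integrable; first exact: segment_compact.
    exact: continuous_subspaceT.
  have [d1 d2] := continuous_FTC1_closed bu int ab (cf b).
  by apply: (DeriveDef d1); rewrite -derive1E; exact: d2.
pose G (a b : R) := F1 (- a) b - F1 (- a) 0.
have Gd (a b : R) : - a < b -> is_derive b 1 (G a) (f b).
  move=> ab; rewrite -[f b]subr0; apply: is_deriveB; exact: F1d.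
have Geq (a a' b : R) : 0 < a -> a <= a' -> - a < b -> G a b = G a' b.
  move=> a0 aa' ab.
  pose H x := G a x - G a' x.
  have H0 : H 0 = 0 by rewrite /H /G !subrr.
  have Hd (x : R) : - a < x -> is_derive x 1 H 0.
    move=> ax; rewrite -[0](subrr (f x)); apply: is_deriveB; apply: Gd => //.
    by apply: le_lt_trans ax; rewrite lerN2.
  suff : H b = 0 by move/eqP; rewrite subr_eq0 => /eqP.
  have cH (x y : R) : - a < x -> {within `[x, y], continuous H}.
    move=> ax; apply: derivable_within_continuous => z; rewrite in_itv/= => /andP[xz _].
    by have [] := Hd z (lt_le_trans ax xz).
  have [b0|b0|->//] := ltgtP b 0.
    have [x|c _] := @MVT _ H (fun=> 0) b 0 b0 _ (cH b 0 ab).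
      by rewrite in_itv/= => /andP[bx _]; apply: Hd; exact: lt_trans bx.
    by rewrite mul0r H0 sub0r => /eqP; rewrite oppr_eq0 => /eqP.
  have a0' : - a < 0 by lra.
  have [x|c _] := @MVT _ H (fun=> 0) 0 b b0 _ (cH 0 b a0').
    by rewrite in_itv/= => /andP[bx _]; apply: Hd; exact: lt_trans bx.
  by rewrite mul0r H0 subr0.
exists (fun t => G (`|t : R| + 1) t); first by rewrite /G subrr.
move=> t.
have tt (s : R) : - (`|s| + 1) < s.
  by have := ler_norm (- s); rewrite normrN; lra.
have Gt : is_derive t 1 (G (`|t| + 2)) (f t) by apply: Gd; have := tt t; lra.
apply: near_eq_is_derive Gt.
near=> s; apply/esym; apply: Geq (tt s); first by rewrite ltr_wpDl.
- have : `|s - t| < 1.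
    rewrite distrC; near: s; apply: cvgr_dist_lt => //; exact: cvg_id.
  have := ler_normD (s - t) t; rewrite subrK; lra.
Unshelve. all: by end_near. Qed.

Lemma linear_ode_exists (a z0 : R) f : continuous f ->
  exists z : R -> R, [/\ continuous z, z 0 = z0 &
    forall t, 0 < t -> is_derive t 1 z (- a * z t + f t)].
Proof.
move=> cf.
have cea (c : R) : continuous (fun s => expR (c * s)).
  by apply: (@continuous_expR_comp (fun s => c * s)) => s; apply: cvgM; [exact: cvg_cst|exact: cvg_id].
have [|F F0 Fd] := @primitive_line (fun s => expR (a * s) * f s).
  by move=> s; apply: cvgM; [exact: cea|exact: cf].
have cF := continuous_of_is_derive Fd.
exists (fun t => expR (- a * t) * (z0 + F t)); split.
- by move=> s; apply: cvgM; [exact: cea|apply: cvgD; [exact: cvg_cst|exact: cF]].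
- by rewrite mulr0 expR0 F0 addr0 mul1r.
- move=> t _; have Ft := Fd t.
  have h1 : is_derive t 1 (fun s => - a * s) (- a).
    apply: (is_derive_eq' (is_deriveZ (- a) (is_derive_id t 1))).
    by rewrite /GRing.scale/= mulr1.
  have h2 : is_derive t 1 (fun s => z0 + F s) (0 + expR (a * t) * f t) by exact: is_deriveD.
  apply: (is_derive_eq' (is_deriveM1 (is_derive_expR_comp h1) h2)).
  have E : expR (- a * t) * expR (a * t) = 1.
    by rewrite -expRD mulNr addNr expR0.
  by rewrite add0r [X in _ + X]mulrA E mul1r; ring.
Qed.

Lemma linear_ode_le y dy (a C T : R) : 0 < a -> 0 <= C -> continuous y ->
  (forall t, 0 < t < T -> is_derive t 1 y (dy t)) ->
  (forall t, 0 < t < T -> dy t <= - a * y t + C) ->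
  forall t, 0 <= t <= T -> y t <= `|y 0| + C / a.
Proof.
move=> a0 C0 cy yd ineq t tT.
pose z s := (y s - C / a) * expR (a * s).
have cz : continuous z.
  move=> s; apply: cvgM; first by apply: cvgB; [exact: cy|exact: cvg_cst].
  by apply: (@continuous_expR_comp (fun r => a * r)) => r; apply: cvgM; [exact: cvg_cst|exact: cvg_id].
have zd s : 0 < s < T -> is_derive s 1 z ((dy s - 0) * expR (a * s) +
     (y s - C / a) * (expR (a * s) * a)).
  move=> sT; apply: is_deriveM1.
    by apply: is_deriveB; exact: yd.
  apply: is_derive_expR_comp.
  apply: (is_derive_eq' (is_deriveZ a (is_derive_id s 1))).
  by rewrite /GRing.scale/= mulr1.
have := nonincreasing_of_derive cz zd _ tT.
rewrite /z mulr0 expR0 mulr1 => key.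
have {}key : (y t - C / a) * expR (a * t) <= y 0 - C / a.
  apply: key => s sT; have := ineq s sT; have := expR_gt0 (a * s).
  have -> : (dy s - 0) * expR (a * s) + (y s - C / a) * (expR (a * s) * a) =
    expR (a * s) * (dy s + a * y s - C) by field; rewrite gt_eqF.
  by move=> e0 h; rewrite pmulr_rle0//; lra.
have C1 : 0 <= C / a by rewrite divr_ge0// ltW.
have [h|h] := leP (y t) (C / a); first by apply: (le_trans h); rewrite lerDr.
have e1 : 1 <= expR (a * t).
  by rewrite -expR0 ler_expR mulr_ge0 ?(ltW a0)//; case/andP: tT.
have := ler_norm (y 0); nra.
Qed.

End ODE.

(** * Quadratic systems on the lattice and their Picard iterates *)

Section Calculus.
Variable R : realType.

Lemma continuous_bigsum (J : Type) (s : seq J) (P : pred J) (f : J -> R -> R) :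
  (forall j, continuous (f j)) -> continuous (fun t => \sum_(j <- s | P j) f j t).
Proof.
move=> cf; elim: s => [|j s IH] t.
  under eq_fun do rewrite big_nil; exact: cvg_cst.
under eq_fun do rewrite big_cons.
by case: (P j); [apply: cvgD; [exact: cf|exact: IH]|exact: IH].
Qed.

Lemma is_derive_bigsum (J : eqType) (s : seq J) (f : J -> R -> R) (df : J -> R) (t : R) :
  (forall j, j \in s -> is_derive t 1 (f j) (df j)) ->
  is_derive t 1 (fun r => \sum_(j <- s) f j r) (\sum_(j <- s) df j).
Proof.
elim: s => [_|j s IH fd].
  under eq_fun do rewrite big_nil; rewrite big_nil; exact: is_derive_cst.
under eq_fun do rewrite big_cons.
rewrite big_cons; apply: is_deriveD; first by apply: fd; rewrite mem_head.
by apply: IH => i si; apply: fd; rewrite inE si orbT.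
Qed.

Lemma is_derive_linear (a t : R) : is_derive t 1 (fun s => a * s) a.
Proof.
apply: (is_derive_eq' (is_deriveZ a (is_derive_id t 1))).
by rewrite /GRing.scale/= mulr1.
Qed.

Lemma continuous_linear (a : R) : continuous (fun s => a * s).
Proof. by move=> t; apply: cvgM; [exact: cvg_cst|exact: cvg_id]. Qed.

(** The constant force [F] costs 1 / a. The bounded force [b] can be handled in two ways:
    subtracting K s from y costs K T, treating it like [F] costs K / a. The minimum makes the
    nonlinear term small by short time at low frequencies and by dissipation at high ones. *)
Lemma mode_le (a F K T : R) (y b : R -> R) : 0 < a -> 0 <= K -> continuous y ->
  (forall t, 0 < t < T -> is_derive t 1 y (- a * y t + (F + b t))) ->
  (forall t, 0 < t < T -> `|b t| <= K) ->
  forall t, 0 <= t <= T -> y t <= `|y 0| + `|F| / a + K * Num.min T a^-1.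
Proof.
move=> a0 K0 cy yd bK t tT.
have [_|_] := leP T a^-1.
  pose z s := y s - K * s.
  have cz : continuous z.
    by move=> s; apply: cvgB; [exact: cy|exact: continuous_linear].
  have zd s : 0 < s < T -> is_derive s 1 z (- a * y s + (F + b s) - K).
    by move=> sT; apply: is_deriveB; [exact: yd|exact: is_derive_linear].
  have zle s : 0 < s < T -> - a * y s + (F + b s) - K <= - a * z s + `|F|.
    move=> sT; have := bK s sT; rewrite /z ler_norml => /andP[_ b1].
    have : 0 <= a * (K * s).
      by rewrite mulr_ge0 ?(ltW a0)// mulr_ge0//; case/andP: sT => /ltW.
    have := ler_norm F; lra.
  have := linear_ode_le a0 (normr_ge0 F) cz zd zle tT.
  rewrite /z mulr0 subr0 lerBlDr => h; apply: (le_trans h); rewrite lerD2l.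
  by apply: ler_wpM2l => //; case/andP: tT.
have FK : 0 <= `|F| + K by rewrite addr_ge0.
have ineq s : 0 < s < T -> - a * y s + (F + b s) <= - a * y s + (`|F| + K).
  move=> sT; rewrite lerD2l lerD ?ler_norm//.
  by apply: le_trans (bK s sT); exact: ler_norm.
have := linear_ode_le a0 FK cy yd ineq tT.
by rewrite mulrDl addrA.
Qed.

Lemma norm_mode_le (a F K T : R) (y b : R -> R) : 0 < a -> 0 <= K -> continuous y ->
  (forall t, 0 < t < T -> is_derive t 1 y (- a * y t + (F + b t))) ->
  (forall t, 0 < t < T -> `|b t| <= K) ->
  forall t, 0 <= t <= T -> `|y t| <= `|y 0| + `|F| / a + K * Num.min T a^-1.
Proof.
move=> a0 K0 cy yd bK t tT; rewrite ler_norml; apply/andP; split; last first.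
  exact: mode_le bK t tT.
rewrite lerNl -[X in X + _ / _]normrN -[X in _ + X / _]normrN.
apply: (@mode_le a (- F) K T (fun s => - y s) (fun s => - b s)) => //.
- by move=> s; apply: cvgN; exact: cy.
- move=> s sT; apply: (is_derive_eq' (is_deriveN (yd s sT))); ring.
- by move=> s sT; rewrite normrN; exact: bK.
Qed.

End Calculus.

Section QuadraticSystem.
Variables (R : realType) (I : finType).
Variables (M : I -> int * int -> I -> I -> R) (C0 : R).
Hypothesis C00 : 0 <= C0.
Hypothesis MC0 : forall p n q r, `|M p n q r| <= C0 * (fnorm n)%:R.
Implicit Types (x y : I -> int * int -> R) (N : nat) (n : int * int).

Definition lam n : R := n.1%:~R ^+ 2 + n.2%:~R ^+ 2.

Lemma sqr_fnorm_le_lam n : (fnorm n)%:R ^+ 2 <= lam n.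
Proof.
have e (a : int) : (`|a|%N)%:R ^+ 2 = a%:~R ^+ 2 :> R.
  by rewrite natr_absz intr_norm real_normK// num_real.
rewrite /lam /fnorm -!e.
by case: leqP => _; rewrite ?lerDl ?lerDr sqr_ge0.
Qed.

Lemma lam_gt0 N n : n \in box N -> 0 < lam n.
Proof.
move=> /(@fnorm_ge1 R) n1; apply: lt_le_trans (sqr_fnorm_le_lam n).
by rewrite exprn_gt0//; lra.
Qed.

Definition mag x n : R := \sum_p `|x p n|.

Definition quad N x y p n : R :=
  \sum_(k <- box N | n - k \in box N) \sum_q \sum_r M p n q r * (x q k * y r (n - k)).

Lemma mag_ge0 x n : 0 <= mag x n.
Proof. exact: sumr_ge0. Qed.

Lemma quad_le N x y p n : `|quad N x y p n| <=
  C0 * (fnorm n)%:R * conv N (mag x) (mag y) n.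
Proof.
rewrite /quad /conv mulr_sumr; apply: (le_trans (ler_norm_sum _ _ _)).
apply: ler_sum => k _; apply: (le_trans (ler_norm_sum _ _ _)).
rewrite {1}/mag mulr_suml mulr_sumr; apply: ler_sum => q _.
apply: (le_trans (ler_norm_sum _ _ _)).
rewrite /mag !mulr_sumr; apply: ler_sum => r _.
by rewrite !normrM ler_wpM2r// mulr_ge0.
Qed.

Lemma quad_sub N x y p n : quad N x x p n - quad N y y p n =
  quad N x (fun q k => x q k - y q k) p n + quad N (fun q k => x q k - y q k) y p n.
Proof.
rewrite /quad -sumrB -big_split /=; apply: eq_bigr => k _.
rewrite -sumrB -big_split /=; apply: eq_bigr => q _.
rewrite -sumrB -big_split /=; apply: eq_bigr => r _; ring.
Qed.

Lemma continuous_quad N (x y : I -> int * int -> R -> R) p n :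
  (forall q k, continuous (x q k)) -> (forall q k, continuous (y q k)) ->
  continuous (fun t => quad N (fun q k => x q k t) (fun q k => y q k t) p n).
Proof.
move=> cx cy; apply: continuous_bigsum => k; apply: continuous_bigsum => q.
apply: continuous_bigsum => r t; apply: cvgM; first exact: cvg_cst.
by apply: cvgM; [exact: cx|exact: cy].
Qed.

Lemma ler_conv N (a b a' b' : int * int -> R) n :
  (forall k, k \in box N -> 0 <= a k <= a' k) ->
  (forall k, k \in box N -> 0 <= b k <= b' k) ->
  conv N a b n <= conv N a' b' n.
Proof.
move=> aa bb; rewrite /conv big_seq_cond [leRHS]big_seq_cond.
apply: ler_sum => k /andP[kN lN].
have /andP[? ?] := aa _ kN; have /andP[? ?] := bb _ lN; exact: ler_pM.
Qed.

Lemma convC N (a b : int * int -> R) n : conv N a b n = conv N b a n.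
Proof.
rewrite /conv (sum_conv_sym N n (fun k l => a k * b l)).
by apply: eq_bigr => k _; rewrite mulrC.
Qed.

Lemma convDl N (a a' b : int * int -> R) n :
  conv N (fun k => a k + a' k) b n = conv N a b n + conv N a' b n.
Proof. by rewrite -big_split /=; apply: eq_bigr => k _; rewrite mulrDl. Qed.

Lemma conv_ge0 N (a b : int * int -> R) n : (forall k, 0 <= a k) -> (forall k, 0 <= b k) ->
  0 <= conv N a b n.
Proof. by move=> a0 b0; apply: sumr_ge0 => k _; exact: mulr_ge0. Qed.

Lemma sqr_conv_le N (a b : int * int -> R) n :
  conv N a b n ^+ 2 <= sqnorm 0 N a * sqnorm 0 N b.
Proof.
apply: (@le_trans _ _ ((\sum_(k <- box N | n - k \in box N) a k ^+ 2) *
   (\sum_(k <- box N | n - k \in box N) b (n - k) ^+ 2))).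
  apply: cauchy_weight => [k|k|k _ _]; try exact: sqr_ge0.
  by rewrite exprMn.
apply: ler_pM; try by apply: sumr_ge0 => k _; exact: sqr_ge0.
  rewrite /sqnorm; under [leRHS]eq_bigr do rewrite mul1r.
  by apply: (@ler_sum_subpred _ _ _ _ xpredT) => // k; exact: sqr_ge0.
rewrite (sum_conv_sym N n (fun k l => b l ^+ 2)).
rewrite /sqnorm; under [leRHS]eq_bigr do rewrite mul1r.
by apply: (@ler_sum_subpred _ _ _ _ xpredT) => // k; exact: sqr_ge0.
Qed.

Lemma sqnorm0_le2 N (a : int * int -> R) : sqnorm 0 N a <= sqnorm 2 N a.
Proof.
rewrite /sqnorm big_seq [leRHS]big_seq; apply: ler_sum => n /(@fnorm_ge1 R) n1.
by rewrite ler_wpM2r ?sqr_ge0// expr0 exprn_ege1.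
Qed.

Lemma sqnormD_le m N (a b : int * int -> R) :
  sqnorm m N (fun n => a n + b n) <= 2 * sqnorm m N a + 2 * sqnorm m N b.
Proof.
rewrite /sqnorm !mulr_sumr -big_split /=; apply: ler_sum => n _.
have w0 : 0 <= (fnorm n)%:R ^+ m :> R by rewrite exprn_ge0.
have : 0 <= (fnorm n)%:R ^+ m * (a n - b n) ^+ 2 by rewrite mulr_ge0 ?sqr_ge0.
move: w0; move: (_ ^+ m) (a n) (b n) => w u v _; nra.
Qed.

Lemma sqr_mag_le x n : mag x n ^+ 2 <= #|I|%:R * \sum_p x p n ^+ 2.
Proof.
have -> : #|I|%:R = \sum_(p : I) 1 :> R by rewrite sumr_const.
apply: cauchy_weight => [p|p|p _ _]; rewrite ?sqr_ge0//.
by rewrite mul1r real_normK// num_real.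
Qed.

Lemma sqnorm_mag_le m N x : sqnorm m N (mag x) <= #|I|%:R * \sum_p sqnorm m N (x p).
Proof.
rewrite /sqnorm exchange_big /= mulr_sumr; apply: ler_sum => n _.
rewrite -mulr_sumr [leRHS]mulrCA ler_wpM2l ?exprn_ge0//; exact: sqr_mag_le.
Qed.

Lemma sum_sqr_le_mag x n : \sum_p x p n ^+ 2 <= mag x n ^+ 2.
Proof.
apply: (@le_trans _ _ (\sum_p `|x p n| * mag x n)); last by rewrite -mulr_suml expr2.
apply: ler_sum => p _; rewrite -[X in X ^+ 2]/(x p n) -real_normK ?num_real// expr2.
by rewrite ler_wpM2l// /mag (bigD1 p)//= lerDl sumr_ge0.
Qed.

Lemma sum_sqnorm_le_mag m N x : \sum_p sqnorm m N (x p) <= sqnorm m N (mag x).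
Proof.
rewrite /sqnorm exchange_big /=; apply: ler_sum => n _.
rewrite -mulr_sumr ler_wpM2l ?exprn_ge0//; exact: sum_sqr_le_mag.
Qed.

(** * Uniform bounds on the Picard iterates *)

Section Picard.
Variables (nu : R) (x0 F : I -> int * int -> R) (N : nat).
Hypothesis nu0 : 0 < nu.

Lemma picard_exists : exists w : nat -> I -> int * int -> R -> R,
  (forall p n t, w 0 p n t = 0) /\
  forall j p n, [/\ continuous (w j p n), w j.+1 p n 0 = x0 p n &
    forall t : R, 0 < t -> is_derive t 1 (w j.+1 p n)
      (- (nu * lam n) * w j.+1 p n t +
        (F p n + quad N (fun q k => w j q k t) (fun q k => w j q k t) p n))].
Proof.
(* Continuity of [v] is assumed inside the existential, so that [choice] yields a step defined on
   all trajectories. *)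
have step (v : I -> int * int -> R -> R) : exists v' : I -> int * int -> R -> R,
    (forall p n, continuous (v p n)) ->
    forall p n, [/\ continuous (v' p n), v' p n 0 = x0 p n &
      forall t : R, 0 < t -> is_derive t 1 (v' p n) (- (nu * lam n) * v' p n t +
        (F p n + quad N (fun q k => v q k t) (fun q k => v q k t) p n))].
  have [cv|] := pselect (forall p n, continuous (v p n)); last by exists v.
  have h (pn : I * (int * int)) : exists z : R -> R, [/\ continuous z, z 0 = x0 pn.1 pn.2 &
      forall t : R, 0 < t -> is_derive t 1 z (- (nu * lam pn.2) * z t +
        (F pn.1 pn.2 + quad N (fun q k => v q k t) (fun q k => v q k t) pn.1 pn.2))].
    apply: linear_ode_exists => t; apply: cvgD; first exact: cvg_cst.
    exact: continuous_quad.
  have [z hz] := choice h.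
  by exists (fun p n => z (p, n)) => _ p n; exact: (hz (p, n)).
have [S hS] := choice step.
exists (fun j => iter j S (fun _ _ _ => 0)); split => // j.
have cont i p n : continuous (iter i S (fun _ _ _ => 0) p n).
  elim: i p n => [|i IH] p n /=; first by move=> t; exact: cvg_cst.
  by have [] := hS _ IH p n.
by move=> p n; split => //; have [] := hS _ (cont j) p n.
Qed.

Variables (w : nat -> I -> int * int -> R -> R).
Hypothesis w0 : forall p n t, w 0 p n t = 0.
Hypothesis wS : forall j p n, [/\ continuous (w j p n), w j.+1 p n 0 = x0 p n &
    forall t : R, 0 < t -> is_derive t 1 (w j.+1 p n)
      (- (nu * lam n) * w j.+1 p n t +
        (F p n + quad N (fun q k => w j q k t) (fun q k => w j q k t) p n))].
Variables (T eta A : R).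
Hypothesis eta0 : 0 <= eta.
Hypothesis T0 : 0 < T.
(* an upper bound for the integral of [expR (- (nu * lam n) * s)] over [0, T] *)
Let kap n : R := Num.min T (nu * lam n)^-1.
(** The squared H^1 norm of |n| kap(n) g(n) puts the weight (|n|^2 kap(n))^2 on g(n)^2. For g a
    convolution, [conv_sqnorm] controls precisely the weight |n|; the factor [eta] is the smallness
    behind the contraction. *)
Hypothesis kap_eta : forall n, n \in box N ->
  ((fnorm n)%:R ^+ 2 * kap n) ^+ 2 <= eta * (fnorm n)%:R.
Let c n : R := \sum_p (`|x0 p n| + `|F p n| / (nu * lam n)).
Hypothesis cA : sqnorm 2 N c <= A.
(** Squared radius of a ball invariant under the Picard step: the data contribute 2 A, and [etaB]
    brings the quadratic part down to B / 4. *)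
Let B : R := 4 * A + 1.
Let K1 : R := #|I|%:R * C0.
Hypothesis etaB : 256 * K1 ^+ 2 * eta * B <= 1.

Let kap_ge0 n : n \in box N -> 0 <= kap n.
Proof.
by move=> /lam_gt0 l0; rewrite le_min (ltW T0) invr_ge0 mulr_ge0// ltW.
Qed.

Let c_ge0 n : n \in box N -> 0 <= c n.
Proof.
move=> /lam_gt0 l0; apply: sumr_ge0 => p _.
by rewrite addr_ge0// divr_ge0// mulr_ge0 ?ltW.
Qed.

Let K1_ge0 : 0 <= K1. Proof. by rewrite mulr_ge0. Qed.

(** Majorant, over all of [0, T], of the response of a mode to a force of size |n| g(n); the number
    of components is absorbed in [K1]. It is cut off to the box, where [lam] is positive. *)
Let sm (g : int * int -> R) n : R := if n \in box N then K1 * (fnorm n)%:R * kap n * g n else 0.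

Let sm_ge0 g : (forall n, 0 <= g n) -> forall n, 0 <= sm g n.
Proof.
move=> g0 n; rewrite /sm; case: ifP => // nN.
by rewrite mulr_ge0// mulr_ge0 ?kap_ge0// mulr_ge0.
Qed.

Let sqnorm_sm g : sqnorm 2 N (sm g) <=
  K1 ^+ 2 * eta * \sum_(n <- box N) (fnorm n)%:R * g n ^+ 2.
Proof.
rewrite /sqnorm mulr_sumr big_seq [leRHS]big_seq; apply: ler_sum => n nN.
rewrite /sm nN.
have -> : (fnorm n)%:R ^+ 2 * (K1 * (fnorm n)%:R * kap n * g n) ^+ 2 =
  K1 ^+ 2 * ((fnorm n)%:R ^+ 2 * kap n) ^+ 2 * g n ^+ 2 by ring.
rewrite mulrA ler_wpM2r ?sqr_ge0// -mulrA ler_wpM2l ?sqr_ge0//.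
exact: kap_eta.
Qed.

Let sqnorm_sm_conv a b : sqnorm 2 N (sm (conv N a b)) <=
  K1 ^+ 2 * eta * (32 * sqnorm 2 N a * sqnorm 2 N b).
Proof.
apply: (le_trans (sqnorm_sm _)); apply: ler_wpM2l; last exact: conv_sqnorm.
by rewrite mulr_ge0 ?sqr_ge0.
Qed.

Let c' n : R := if n \in box N then c n else 0.

Let sqnorm_c' : sqnorm 2 N c' <= A.
Proof.
apply: le_trans cA; rewrite le_eqVlt; apply/orP; left; apply/eqP.
rewrite /sqnorm big_seq [RHS]big_seq; apply: eq_bigr => n nN.
by rewrite /c' nN.
Qed.

Let A_ge0 : 0 <= A. Proof. exact: le_trans (sqnorm_ge0 _ _ _) cA. Qed.

(** The Picard recursion for majorants without time: [maj j n] dominates iterate j at frequency n on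
    the whole of [0, T], so the supremum in time stands inside the sum over frequencies. *)
Let maj := fix maj (j : nat) : int * int -> R :=
  if j is i.+1 then fun n => c' n + sm (conv N (maj i) (maj i)) n else fun=> 0.

Let maj_ge0 j n : 0 <= maj j n.
Proof.
elim: j n => [//|j IH] n /=; rewrite addr_ge0 ?sm_ge0//.
  by rewrite /c'; case: ifP => // /c_ge0.
by move=> k; exact: conv_ge0.
Qed.

Let sqnorm_maj j : sqnorm 2 N (maj j) <= B.
Proof.
elim: j => [|j IH].
  rewrite /sqnorm big1 ?addr_ge0 ?mulr_ge0// => n _.
  by rewrite expr0n mulr0.
apply: (le_trans (sqnormD_le _ _ _ _)).
have B0 : 0 <= B by rewrite /B; have := A_ge0; lra.
have h1 : 32 * sqnorm 2 N (maj j) * sqnorm 2 N (maj j) <= 32 * B * B.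
  by rewrite -!mulrA ler_wpM2l// ler_pM// sqnorm_ge0.
have k0 : 0 <= K1 ^+ 2 * eta by rewrite mulr_ge0 ?sqr_ge0.
have h2 := le_trans (sqnorm_sm_conv (maj j) (maj j)) (ler_wpM2l k0 h1).
have h3 : 64 * (K1 ^+ 2 * eta * B) * B <= B / 4.
  have : 256 * (K1 ^+ 2 * eta * B) <= 1 by have := etaB; lra.
  nra.
have := sqnorm_c'; have := A_ge0.
have : K1 ^+ 2 * eta * (32 * B * B) * 2 = 64 * (K1 ^+ 2 * eta * B) * B by ring.
move: h2 h3; rewrite /B; lra.
Qed.

(** Majorants of the differences of consecutive iterates, following the bilinear splitting of
    [quad_sub]. They start at [maj 1] because iterate 0 is zero. *)
Let dif := fix dif (j : nat) : int * int -> R :=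
  if j is i.+1 then fun n => sm (fun k => conv N (maj i.+1) (dif i) k + conv N (dif i) (maj i) k) n
  else maj 1.

Let dif_ge0 j n : 0 <= dif j n.
Proof.
elim: j n => [|j IH] n; first exact: maj_ge0.
apply: sm_ge0 => k; apply: addr_ge0; apply: conv_ge0 => // l; exact: maj_ge0.
Qed.

Let sqnorm_dif j : sqnorm 2 N (dif j) <= B / 2 ^+ j.
Proof.
elim: j => [|j IH]; first by rewrite expr0 divr1; exact: sqnorm_maj.
have B0 : 0 <= B by rewrite /B; have := A_ge0; lra.
apply: (@le_trans _ _ (sqnorm 2 N (fun n => sm (conv N (maj j.+1) (dif j)) n +
    sm (conv N (dif j) (maj j)) n))).
  rewrite le_eqVlt; apply/orP; left; apply/eqP; apply: eq_bigr => n _.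
  congr (_ * _ ^+ 2); rewrite /= /sm; case: ifP => _; rewrite ?addr0//.
  by rewrite mulrDr.
apply: (le_trans (sqnormD_le _ _ _ _)).
have k0 : 0 <= K1 ^+ 2 * eta by rewrite mulr_ge0 ?sqr_ge0.
have d0 := sqnorm_ge0 2 N (dif j).
have h1 : 32 * sqnorm 2 N (maj j.+1) * sqnorm 2 N (dif j) <= 32 * B * sqnorm 2 N (dif j).
  by rewrite ler_wpM2r// ler_wpM2l// sqnorm_maj.
have h2 : 32 * sqnorm 2 N (dif j) * sqnorm 2 N (maj j) <= 32 * B * sqnorm 2 N (dif j).
  by rewrite mulrAC ler_wpM2r// ler_wpM2l// sqnorm_maj.
have h3 := le_trans (sqnorm_sm_conv _ _) (ler_wpM2l k0 h1).
have h4 := le_trans (sqnorm_sm_conv _ _) (ler_wpM2l k0 h2).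
(* By [etaB] again, one step halves the squared norm. *)
have h5 : 128 * (K1 ^+ 2 * eta * B) * sqnorm 2 N (dif j) <= sqnorm 2 N (dif j) / 2.
  have : 256 * (K1 ^+ 2 * eta * B) <= 1 by have := etaB; lra.
  nra.
have : K1 ^+ 2 * eta * (32 * B * sqnorm 2 N (dif j)) * 4 =
  128 * (K1 ^+ 2 * eta * B) * sqnorm 2 N (dif j) by ring.
have -> : B / 2 ^+ j.+1 = B / 2 ^+ j / 2 by rewrite exprSr invfM mulrA.
move: h3 h4 h5 IH; lra.
Qed.

Let mag_maj j (t : R) n : 0 <= t <= T -> n \in box N ->
  mag (fun p k => w j p k t) n <= maj j n.
Proof.
elim: j t n => [|j IH] t n tT nN.
  by rewrite /mag big1// => p _; rewrite w0 normr0.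
have l0 : 0 < nu * lam n by rewrite mulr_gt0// (lam_gt0 nN).
rewrite /= /c' /sm nN /c.
have -> : K1 * (fnorm n)%:R * kap n * conv N (maj j) (maj j) n =
  \sum_(p : I) (C0 * (fnorm n)%:R * conv N (maj j) (maj j) n * kap n).
  by rewrite sumr_const -mulr_natl /K1; ring.
rewrite -big_split /=; apply: ler_sum => p _.
have [cw wz wd] := wS j p n.
have [cw' _ _] := wS j.+1 p n.
rewrite -wz; apply: (@norm_mode_le R (nu * lam n) (F p n)
  (C0 * (fnorm n)%:R * conv N (maj j) (maj j) n) T (w j.+1 p n)
  (fun s => quad N (fun q k => w j q k s) (fun q k => w j q k s) p n)) => //.
- by rewrite mulr_ge0 ?mulr_ge0// conv_ge0// => k; exact: maj_ge0.
- by move=> s /andP[s0 _]; exact: wd.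
- move=> s /andP[s0 sT]; apply: (le_trans (quad_le _ _ _ _ _)).
  rewrite ler_wpM2l ?mulr_ge0//; apply: ler_conv => k kN; rewrite mag_ge0 IH// !ltW//.
Qed.

Let mag_dif j (t : R) n : 0 <= t <= T -> n \in box N ->
  mag (fun p k => w j.+1 p k t - w j p k t) n <= dif j n.
Proof.
elim: j t n => [|j IH] t n tT nN.
  rewrite /dif; apply: le_trans (mag_maj 1 tT nN); rewrite le_eqVlt; apply/orP; left.
  by apply/eqP; apply: eq_bigr => p _; rewrite w0 subr0.
have l0 : 0 < nu * lam n by rewrite mulr_gt0// (lam_gt0 nN).
rewrite [dif _]/= /sm nN.
set Q := _ + _.
have Q0 : 0 <= Q.
  by apply: addr_ge0; apply: conv_ge0 => k;
    solve [exact: (maj_ge0 j.+1 k)|exact: maj_ge0|exact: dif_ge0].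
have -> : K1 * (fnorm n)%:R * kap n * Q =
  \sum_(p : I) (C0 * (fnorm n)%:R * Q * kap n).
  by rewrite sumr_const -mulr_natl /K1; ring.
apply: ler_sum => p _.
have [cw wz wd] := wS j p n.
have [cw' wz' wd'] := wS j.+1 p n.
have [cw'' _ _] := wS j.+2 p n.
pose y s := w j.+2 p n s - w j.+1 p n s.
have y0 : y 0 = 0 by rewrite /y wz wz' subrr.
have -> : C0 * (fnorm n)%:R * Q * kap n = `|y 0| + `|0 : R| / (nu * lam n) +
   C0 * (fnorm n)%:R * Q * kap n by rewrite y0 !normr0 mul0r !add0r.
apply: (@norm_mode_le _ _ _ _ _ y (fun s =>
   quad N (fun q k => w j.+1 q k s) (fun q k => w j.+1 q k s) p n -
   quad N (fun q k => w j q k s) (fun q k => w j q k s) p n)) => //.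
- by rewrite mulr_ge0 ?mulr_ge0.
- by move=> s; apply: cvgB; [exact: cw''|exact: cw'].
- move=> s /andP[s0 _]; apply: (is_derive_eq' (is_deriveB (wd' s s0) (wd s s0))).
  rewrite /y; ring.
- move=> s /andP[s0 sT]; rewrite quad_sub; apply: (le_trans (ler_normD _ _)).
  have sT' : 0 <= s <= T by rewrite !ltW.
  apply: (le_trans (lerD (quad_le _ _ _ _ _) (quad_le _ _ _ _ _))).
  rewrite -mulrDr ler_wpM2l ?mulr_ge0//; apply: lerD; apply: ler_conv => k kN;
    by rewrite mag_ge0 ?mag_maj ?IH.
Qed.

(** All that the comparison takes from the iterates; the recursion behind the majorants stays
    hidden. *)
Lemma picard_majorant : exists a g : nat -> int * int -> R,
  [/\ forall j n, 0 <= a j n /\ 0 <= g j n,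
      forall j, sqnorm 2 N (a j) <= B,
      forall j, sqnorm 2 N (g j) <= B / 2 ^+ j,
      forall j (t : R) n, 0 <= t <= T -> n \in box N ->
        mag (fun p k => w j p k t) n <= a j n &
      forall j (t : R) n, 0 <= t <= T -> n \in box N ->
        mag (fun p k => w j.+1 p k t - w j p k t) n <= g j n].
Proof. by exists maj, dif; split. Qed.

End Picard.

End QuadraticSystem.

(** * Comparison with the Picard iterates *)

Section Comparison.
Variables (R : realType) (I : finType).
Variables (M : I -> int * int -> I -> I -> R) (C0 : R).
Hypothesis C00 : 0 <= C0.
Hypothesis MC0 : forall p n q r, `|M p n q r| <= C0 * (fnorm n)%:R.
Implicit Types (N : nat) (n : int * int).
Variable nu : R.
Hypothesis nu0 : 0 < nu.

Let cI : R := #|I|%:R.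
Let cI0 : 0 <= cI. Proof. exact: ler0n. Qed.
(** The dissipation is 2 nu times the squared L^2 norm of the difference. With these two constants
    the trilinear estimate uses at most one nu of it and the truncation error the other; [cI] pays
    for replacing the square of [mag] by the sum of squares of the components. *)
Let e : R := nu / (2 * (C0 + 1) * (cI + 1)).
Let delta : R := nu / (cI + 1).
Let e0 : 0 < e.
Proof. by rewrite divr_gt0// !mulr_gt0// ltr_wpDl. Qed.
Let delta0 : 0 < delta.
Proof. by rewrite divr_gt0// ltr_wpDl. Qed.

(** Beyond frequency [L] dissipation alone bounds the left-hand side by nu^-2, which the spare
    factor |n| on the right absorbs. Below [L] it is at most (L^2 T)^2, small for short times.
    Neither [L] nor [T] depends on N. *)
Lemma small_time (eta : R) : 0 < eta -> exists2 T : R, 0 < T &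
  forall N n, n \in box N ->
    ((fnorm n)%:R ^+ 2 * Num.min T (nu * lam R n)^-1) ^+ 2 <= eta * (fnorm n)%:R.
Proof.
move=> eta0; pose L := Num.bound (nu ^+ 2 * eta)^-1.
have Lb : (nu ^+ 2 * eta)^-1 < L%:R.
  by apply: archi_boundP; rewrite invr_ge0 mulr_ge0 ?sqr_ge0 ?ltW.
pose T : R := Num.min 1 (eta / (L%:R ^+ 4 + 1)).
have L4 : 0 < L%:R ^+ 4 + 1 :> R by rewrite ltr_wpDl// exprn_ge0.
have T0 : 0 < T by rewrite lt_min ltr01 divr_gt0.
exists T => // N n nN.
have n1 := fnorm_ge1 R nN; have l0 := lam_gt0 R nN.
have nl0 : 0 < nu * lam R n by rewrite mulr_gt0.
set k := Num.min _ _.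
have k0 : 0 <= k by rewrite le_min (ltW T0) invr_ge0 ltW.
have k1 : k <= T by rewrite ge_min lexx.
have k2 : k <= (nu * lam R n)^-1 by rewrite ge_min lexx orbT.
set w : R := (fnorm n)%:R in n1 *.
have w2 : w ^+ 2 <= lam R n := sqr_fnorm_le_lam R n.
have [Ln|nL] := leqP L (fnorm n).
  have Lw : L%:R <= w by rewrite ler_nat.
  have h : w ^+ 2 * k <= nu^-1.
    apply: (@le_trans _ _ (lam R n * (nu * lam R n)^-1)).
      by apply: ler_pM => //; exact: sqr_ge0.
    by rewrite invfM mulrCA divff ?gt_eqF// mulr1.
  apply: (@le_trans _ _ (nu^-1 ^+ 2)).
    by rewrite ler_pXn2r ?nnegrE// ?mulr_ge0 ?sqr_ge0// invr_ge0 ltW.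
  apply: (@le_trans _ _ (eta * (nu ^+ 2 * eta)^-1)).
    rewrite le_eqVlt; apply/orP; left; apply/eqP; field.
    by rewrite !gt_eqF.
  by rewrite ler_wpM2l ?(ltW eta0)// (le_trans (ltW Lb)).
have wL : w <= L%:R by rewrite ler_nat ltnW.
apply: (@le_trans _ _ ((L%:R ^+ 2 * T) ^+ 2)).
  rewrite ler_pXn2r ?nnegrE// ?mulr_ge0 ?sqr_ge0 ?(ltW T0)//.
  apply: ler_pM => //; first exact: sqr_ge0.
  by rewrite ler_pXn2r ?nnegrE// (le_trans _ n1).
have T1 : T <= 1 by rewrite ge_min lexx.
have T2 : T * (L%:R ^+ 4 + 1) <= eta.
  by rewrite -ler_pdivlMr// ge_min lexx orbT.
apply: (@le_trans _ _ eta); last by rewrite ler_peMr// ltW.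
have -> : (L%:R ^+ 2 * T) ^+ 2 = (L%:R ^+ 4 * T) * T by ring.
apply: (@le_trans _ _ (L%:R ^+ 4 * T * 1)).
  by rewrite ler_wpM2l// mulr_ge0 ?(ltW T0)// exprn_ge0.
by rewrite mulr1; move: T2; rewrite mulrDr mulr1 [T * _]mulrC; lra.
Qed.

(** * Differential inequality for the H^-1 distance at a fixed time *)

Section Pointwise.
(** All quantities are taken at one instant. [x] is the solution; [v] and [w] are iterates j + 1 and
    j, with majorants [a] and [b], and [g] majorizes their difference; [q] measures the truncation
    error. Below, [r] bounds the defect of [v], whose equation has the nonlinear term evaluated at
    [w]. *)
Variables (N : nat) (F x v w dx dv : I -> int * int -> R) (a b g : int * int -> R) (q : R).
Hypothesis a0 : forall n, 0 <= a n.
Hypothesis b0 : forall n, 0 <= b n.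
Hypothesis g0 : forall n, 0 <= g n.
Hypothesis va : forall n, n \in box N -> mag v n <= a n.
Hypothesis wb : forall n, n \in box N -> mag w n <= b n.
Hypothesis vwg : forall n, n \in box N -> mag (fun p k => v p k - w p k) n <= g n.
Hypothesis dxE : forall p n, n \in box N ->
  `|dx p n - (- (nu * lam R n) * x p n + (F p n + quad M N x x p n))| <= (fnorm n)%:R * q.
Hypothesis dvE : forall p n,
  dv p n = - (nu * lam R n) * v p n + (F p n + quad M N w w p n).
Let d p n := x p n - v p n.
Let D := mag d.
Let X n := mag x n + a n.
Let r n := conv N a g n + conv N g b n.

Let D0 n : 0 <= D n. Proof. exact: mag_ge0. Qed.
Let X0 n : 0 <= X n. Proof. by rewrite addr_ge0 ?mag_ge0. Qed.
Let r0 n : 0 <= r n. Proof. by rewrite addr_ge0 ?conv_ge0. Qed.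

(** The nonlinear difference passes through the value at [v]: x against v is bilinear in [X] and
    [D], v against w is the defect [r]. One factor |n|^-1 cancels the |n| in front of the
    nonlinearity and of the error, the other stays with [d]. Dissipation comes from
    [sqr_fnorm_le_lam]. *)
Let mode_ineq p n : n \in box N ->
  2 * (d p n / (fnorm n)%:R) * ((dx p n - dv p n) / (fnorm n)%:R) <=
  - 2 * nu * d p n ^+ 2 +
  2 * (`|d p n| / (fnorm n)%:R) * (C0 * (conv N X D n + r n) + q).
Proof.
move=> nN; have n1 := fnorm_ge1 R nN.
have h1 := dxE p nN; rewrite dvE.
have h2 : `|quad M N x x p n - quad M N w w p n| <=
    C0 * (fnorm n)%:R * (conv N X D n + r n).
  have -> : quad M N x x p n - quad M N w w p n =
    (quad M N x x p n - quad M N v v p n) + (quad M N v v p n - quad M N w w p n) by ring.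
  rewrite !quad_sub; apply: (le_trans (ler_normD _ _)).
  rewrite mulrDr /r mulrDr; apply: lerD.
    apply: (le_trans (ler_normD _ _)).
    rewrite /X convDl mulrDr; apply: lerD.
      exact: quad_le.
    apply: (le_trans (quad_le MC0 _ _ _ _ _)); rewrite ler_wpM2l ?mulr_ge0//.
    rewrite [leRHS]convC; apply: ler_conv => k kN; first by rewrite mag_ge0/=.
    by rewrite mag_ge0 va.
  apply: (le_trans (ler_normD _ _)); apply: lerD;
    apply: (le_trans (quad_le MC0 _ _ _ _ _)); rewrite ler_wpM2l ?mulr_ge0//;
    by apply: ler_conv => k kN; rewrite mag_ge0 ?va ?wb ?vwg.
move: h1 h2; set Q := quad M N x x p n; set Q' := quad M N w w p n.
set E := dx p n - (- (nu * lam R n) * x p n + (F p n + Q)) => h1 h2.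
have -> : dx p n - (- (nu * lam R n) * v p n + (F p n + Q')) =
   - (nu * lam R n) * d p n + ((Q - Q') + E) by rewrite /E /d; ring.
set W : R := (fnorm n)%:R in n1 h1 h2 *.
have W0 : 0 < W by lra.
rewrite [(_ + (Q - Q' + E)) / W]mulrDl [leLHS]mulrDr; apply: lerD.
  have l2 : W ^+ 2 <= lam R n := sqr_fnorm_le_lam R n.
  have -> : 2 * (d p n / W) * (- (nu * lam R n) * d p n / W) =
     - 2 * nu * d p n ^+ 2 * (lam R n / W ^+ 2) by field; rewrite gt_eqF.
  have : 1 <= lam R n / W ^+ 2 by rewrite ler_pdivlMr ?mul1r// exprn_gt0.
  have : 0 <= nu * d p n ^+ 2 by rewrite mulr_ge0 ?sqr_ge0// ltW.
  nra.
apply: (le_trans (ler_norm _)).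
rewrite !normrM !normfV ger0_norm// !(gtr0_norm W0).
apply: ler_wpM2l; first by rewrite mulr_ge0// divr_ge0// ltW.
rewrite ler_pdivrMr//; apply: (le_trans (ler_normD _ _)).
by rewrite mulrDl; apply: lerD; [move: h2; lra|rewrite mulrC].
Qed.

Lemma energy_derivative_le :
  \sum_(n <- box N) \sum_p 2 * (d p n / (fnorm n)%:R) * ((dx p n - dv p n) / (fnorm n)%:R)
  <= (2 * C0 * (40 / e * sqnorm 2 N X + 64 / e ^+ 3 * (2 + 2 * (sqnorm 0 N X * sqnorm 2 N X)))
      + 1) * cI * (\sum_(n <- box N) \sum_p (d p n / (fnorm n)%:R) ^+ 2)
   + (C0 ^+ 2 * (\sum_(n <- box N) r n ^+ 2) + 8 * N%:R / delta * q ^+ 2).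
Proof.
set G := 40 / e * _ + _.
set y := \sum_(n <- box N) \sum_p _ ^+ 2.
have G0 : 0 <= G.
  have e1 := ltW e0; have e3 : 0 <= e ^+ 3 by exact: exprn_ge0.
  have s2 := sqnorm_ge0 2 N X; have s0 := sqnorm_ge0 0 N X.
  apply: addr_ge0; first by apply: mulr_ge0 => //; exact: divr_ge0.
  apply: mulr_ge0; first exact: divr_ge0.
  by apply: addr_ge0 => //; apply: mulr_ge0 => //; exact: mulr_ge0.
pose Z := \sum_(n <- box N) \sum_p d p n ^+ 2.
have DZ : sqnorm 0 N D <= cI * Z.
  rewrite /sqnorm /Z mulr_sumr; apply: ler_sum => n _; rewrite mul1r; exact: sqr_mag_le.
have Dy : energy N D <= cI * y.
  rewrite /energy /y mulr_sumr; apply: ler_sum => n _.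
  rewrite expr_div_n.
  have -> : \sum_p (d p n / (fnorm n)%:R) ^+ 2 = (\sum_p d p n ^+ 2) / (fnorm n)%:R ^+ 2.
    by rewrite mulr_suml; apply: eq_bigr => p _; rewrite expr_div_n.
  by rewrite mulrA ler_wpM2r ?invr_ge0 ?sqr_ge0//; exact: sqr_mag_le.
(* Young's inequality: the defect is paid by the energy itself, the truncation error by [delta]
   times the L^2 density of [D]. The factor |n|^-2 left on q^2 is summed by [sum_box_inv2]. *)
apply: (@le_trans _ _ (\sum_(n <- box N) (- 2 * nu * (\sum_p d p n ^+ 2) +
   2 * C0 * (conv N X D n * (D n / (fnorm n)%:R)) +
   ((D n / (fnorm n)%:R) ^+ 2 + C0 ^+ 2 * r n ^+ 2) +
   (delta * (D n) ^+ 2 + (fnorm n)%:R^-1 ^+ 2 * (q ^+ 2 / delta))))).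
  rewrite big_seq [leRHS]big_seq; apply: ler_sum => n nN.
  have n1 := fnorm_ge1 R nN.
  apply: (le_trans (ler_sum _ (fun p _ => mode_ineq p nN))).
  rewrite big_split /= -mulr_sumr.
  have -> : \sum_(p : I) 2 * (`|d p n| / (fnorm n)%:R) * (C0 * (conv N X D n + r n) + q) =
     2 * (D n / (fnorm n)%:R) * (C0 * (conv N X D n + r n) + q).
    by rewrite -mulr_suml -mulr_sumr -mulr_suml.
  rewrite -!addrA lerD2l.
  set W : R := (fnorm n)%:R in n1 *; have W0 : 0 < W by lra.
  set u := D n / W.
  have -> : D n = u * W by rewrite /u divfK// gt_eqF.
  have h1 : 2 * u * (C0 * r n) <= u ^+ 2 + C0 ^+ 2 * r n ^+ 2.
    have := sqr_ge0 (u - C0 * r n); lra.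
  have h2 : 2 * u * q <= delta * (u * W) ^+ 2 + W^-1 ^+ 2 * (q ^+ 2 / delta).
    rewrite -subr_ge0.
    have -> : delta * (u * W) ^+ 2 + W^-1 ^+ 2 * (q ^+ 2 / delta) - 2 * u * q =
      (delta * (u * W ^+ 2) - q) ^+ 2 / (delta * W ^+ 2) by field; rewrite !gt_eqF.
    by rewrite divr_ge0 ?sqr_ge0// mulr_ge0 ?sqr_ge0// ltW.
  move: h1 h2; lra.
rewrite !big_split /= -!mulr_sumr -/(trilinear N X D) -/(energy N D) -/Z.
have -> : \sum_(n <- box N) D n ^+ 2 = sqnorm 0 N D.
  by apply: eq_bigr => n _; rewrite mul1r.
rewrite -mulr_suml.
have tri := trilinear_le N e0 X0 D0; rewrite -/G in tri.
have E0 : 0 <= energy N D by apply: sumr_ge0 => n _; exact: sqr_ge0.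
have Z0 : 0 <= Z by apply: sumr_ge0 => n _; apply: sumr_ge0 => p _; exact: sqr_ge0.
have c1 : C0 + 1 != 0 by rewrite gt_eqF// ltr_wpDl.
have c2 : cI + 1 != 0 by rewrite gt_eqF// ltr_wpDl.
have nuZ : 0 <= nu * Z by apply: mulr_ge0 => //; exact: ltW.
have frac_ge0 (z : R) : 0 <= z -> 0 <= z / (z + 1) by move=> z0; rewrite divr_ge0// addr_ge0.
have frac_le1 (z : R) : 0 <= z -> z / (z + 1) <= 1.
  by move=> z0; rewrite ler_pdivrMr ?mul1r ?lerDl// ltr_wpDl.
have t1 : 2 * C0 * trilinear N X D <= nu * Z + 2 * C0 * G * energy N D.
  have h1 : 2 * C0 * trilinear N X D <= 2 * C0 * (e * sqnorm 0 N D + G * energy N D).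
    by apply: ler_wpM2l => //; rewrite mulr_ge0.
  apply: (le_trans h1); rewrite mulrDr mulrA; apply: lerD; last by rewrite mulrA.
  apply: (@le_trans _ _ (2 * C0 * e * (cI * Z))).
    by apply: ler_wpM2l => //; apply: mulr_ge0; [exact: mulr_ge0|exact: ltW].
  have -> : 2 * C0 * e * (cI * Z) = (C0 / (C0 + 1)) * (cI / (cI + 1)) * (nu * Z).
    by rewrite /e; field; rewrite c1 c2.
  by rewrite ler_piMl ?nuZ// mulr_ile1 ?frac_ge0 ?frac_le1.
have t2 : delta * sqnorm 0 N D <= nu * Z.
  apply: (@le_trans _ _ (delta * (cI * Z))); first by rewrite ler_wpM2l// ltW.
  have -> : delta * (cI * Z) = cI / (cI + 1) * (nu * Z).
    by rewrite /delta; field; rewrite c2.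
  by rewrite ler_piMl ?nuZ// frac_le1.
have t3 : (\sum_(n <- box N) (fnorm n)%:R^-1 ^+ 2) * (q ^+ 2 / delta) <=
    8 * N%:R / delta * q ^+ 2.
  have -> : 8 * N%:R / delta * q ^+ 2 = 8 * N%:R * (q ^+ 2 / delta) by ring.
  by rewrite ler_wpM2r ?sum_box_inv2// divr_ge0 ?sqr_ge0// ltW.
have t4 : (2 * C0 * G + 1) * energy N D <= (2 * C0 * G + 1) * cI * y.
  rewrite -[leRHS]mulrA; apply: ler_wpM2l => //.
  by rewrite addr_ge0// mulr_ge0// mulr_ge0.
move: t1 t2 t3 t4; lra.
Qed.

End Pointwise.

End Comparison.

Lemma exists_nat_ge (R : realType) (C : R) : exists n : nat, C <= n%:R.
Proof.
by exists (Num.bound `|C|); apply/ltW/(le_lt_trans (ler_norm _))/archi_boundP.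
Qed.

(* Up to a time T depending only on the data, the Picard iterates of every
   box-truncated system stay in an H^1 ball. The H^-1 distance from x to the
   iterates obeys a Gronwall inequality whose forcing vanishes as N and the
   iteration index grow. [q N] bounds the truncation error; the time integrals
   of the H^1 norm and of [q N ^+ 2] enter through their primitives [Gam N]
   and [Q N]. *)
Lemma quadratic_system_bound (R : realType) (I : finType)
    (M : I -> int * int -> I -> I -> R) (C0 nu A0 : R) (x0 F : I -> int * int -> R) :
  0 <= C0 -> 0 < nu ->
  (forall p n q r, `|M p n q r| <= C0 * (fnorm n)%:R) ->
  (forall N, \sum_p sqnorm 2 N (x0 p) <= A0) ->
  (forall N, \sum_p sqnorm 2 N (fun n => F p n / lam R n) <= A0) ->
  exists T B : R, 0 < T /\
    forall (x xd : I -> int * int -> R -> R) (q Gam Q : nat -> R -> R) (K0 A1 : R),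
    (forall p n, continuous (x p n)) ->
    (forall p n, x p n 0 = x0 p n) ->
    (forall p n t, 0 < t < T -> is_derive t 1 (x p n) (xd p n t)) ->
    (forall N p n t, n \in box N -> 0 < t < T ->
       `|xd p n t - (- (nu * lam R n) * x p n t +
         (F p n + quad M N (fun q k => x q k t) (fun q k => x q k t) p n))|
       <= (fnorm n)%:R * q N t) ->
    (forall N t, 0 <= t <= T -> \sum_p sqnorm 0 N (fun n => x p n t) <= K0) ->
    (forall N, [/\ continuous (Gam N), Gam N 0 = 0,
       forall t, 0 < t < T ->
         is_derive t 1 (Gam N) (\sum_p sqnorm 2 N (fun n => x p n t)) &
       forall t, 0 <= t <= T -> 0 <= Gam N t <= A1]) ->
    (forall N, [/\ continuous (Q N), Q N 0 = 0,
       forall t, 0 < t < T -> is_derive t 1 (Q N) (q N t ^+ 2) &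
       forall t, 0 <= t <= T -> N%:R ^+ 2 * Q N t <= A1]) ->
    forall N t, 0 <= t <= T -> \sum_p sqnorm 2 N (fun n => x p n t) <= B.
Proof.
move=> C00 nu0 MC0 x0A FA.
pose cI : R := #|I|%:R; have cI0 : 0 <= cI by exact: ler0n.
have A00 : 0 <= A0.
  by apply: le_trans (x0A 0%N); apply: sumr_ge0 => p _; exact: sqnorm_ge0.
(* Squared H^1 size of the majorant of the data, x0 and F / (nu lam), with [cI] from passing to
   [mag]. *)
pose A : R := 2 * (cI * A0) + 2 * (cI * (A0 / nu ^+ 2)).
have A_ge0 : 0 <= A.
  have h : 0 <= A0 / nu ^+ 2 by rewrite divr_ge0 ?sqr_ge0.
  by rewrite addr_ge0// mulr_ge0// mulr_ge0.
pose B : R := 4 * A + 1; have B0 : 0 <= B by rewrite addr_ge0// mulr_ge0.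
have cA N : sqnorm 2 N (fun n => \sum_p (`|x0 p n| + `|F p n| / (nu * lam R n))) <= A.
  have -> : sqnorm 2 N (fun n => \sum_p (`|x0 p n| + `|F p n| / (nu * lam R n))) =
      sqnorm 2 N (fun n => mag x0 n + mag (fun p n => F p n / lam R n / nu) n).
    rewrite /sqnorm big_seq [RHS]big_seq; apply: eq_bigr => n nN.
    have l0 := lam_gt0 R nN.
    congr (_ * _ ^+ 2); rewrite -big_split; apply: eq_bigr => p _; congr (_ + _).
    by rewrite !normrM !normfV (gtr0_norm l0) (gtr0_norm nu0) invfM mulrAC -mulrA mulrCA mulrA.
  apply: (le_trans (sqnormD_le _ _ _ _)); apply: lerD; rewrite ler_wpM2l//;
    apply: (le_trans (sqnorm_mag_le _ _ _)); rewrite ler_wpM2l//.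
  have -> : \sum_p sqnorm 2 N (fun n => F p n / lam R n / nu) =
      (\sum_p sqnorm 2 N (fun n => F p n / lam R n)) / nu ^+ 2.
    rewrite mulr_suml; apply: eq_bigr => p _; rewrite /sqnorm mulr_suml.
    by apply: eq_bigr => n _; rewrite expr_div_n mulrA.
  by rewrite ler_wpM2r ?invr_ge0 ?sqr_ge0.
(* Chosen for [etaB]; the added 1 covers the case C0 = 0. *)
pose eta : R := (256 * (cI * C0) ^+ 2 * B + 1)^-1.
have c0 : 0 <= 256 * (cI * C0) ^+ 2 * B.
  exact: (mulr_ge0 (mulr_ge0 (ler0n _ 256) (sqr_ge0 _)) B0).
have c1 : 0 < 256 * (cI * C0) ^+ 2 * B + 1 by rewrite ltr_wpDl.
have eta0 : 0 < eta by rewrite invr_gt0.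
have etaB : 256 * (cI * C0) ^+ 2 * eta * B <= 1.
  have -> : 256 * (cI * C0) ^+ 2 * eta * B = (256 * (cI * C0) ^+ 2 * B) * eta by ring.
  by rewrite ler_pdivrMr ?mul1r ?lerDl.
clearbody eta.
have [T T0 smallT] := small_time nu0 eta0.
(* [T] and the bound are fixed here, before the solution enters. The bound is twice the bound [B] on
   an iterate plus twice the squared distance to it, which will be at most 1. *)
exists T, (2 * B + 2); split => // x xd q Gam Q K0 A1 cx xz xdE ode bound GamP QP N0 t tT.
have A10 : 0 <= A1.
  have [_ _ _ /(_ 0)] := GamP 0%N; rewrite lexx (ltW T0).
  by move=> /(_ isT) /andP[h1 h2]; exact: le_trans h2.
have K00 : 0 <= K0.
  apply: le_trans (bound 0%N t tT).
  by apply: sumr_ge0 => p _; exact: sqnorm_ge0.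
pose e := nu / (2 * (C0 + 1) * (cI + 1)).
pose delta := nu / (cI + 1).
have e0 : 0 < e by rewrite divr_gt0// !mulr_gt0// ltr_wpDl.
have delta0 : 0 < delta by rewrite divr_gt0// ltr_wpDl.
pose K2 := 2 * (cI * K0) + 2 * B.
have K20 : 0 <= K2 by rewrite addr_ge0// mulr_ge0// mulr_ge0.
(* [k], [g0] and [g1] bound the Gronwall coefficient by an affine function of the squared H^1 norm
   of [x], using its L^2 bound. [E1] then bounds the Gronwall factor independently of the truncation
   and of the iterate. *)
pose k := 40 / e + 128 / e ^+ 3 * K2.
have k0 : 0 <= k.
  have e1 := ltW e0.
  apply: addr_ge0; first exact: divr_ge0.
  by apply: mulr_ge0 => //; apply: divr_ge0 => //; exact: exprn_ge0.
pose g0 := 128 / e ^+ 3 + k * (2 * B).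
have g00 : 0 <= g0.
  apply: addr_ge0; first by apply: divr_ge0 => //; apply: exprn_ge0; exact: ltW.
  by apply: mulr_ge0 => //; exact: mulr_ge0.
pose g1 := k * (2 * cI).
have g10 : 0 <= g1 by apply: mulr_ge0 => //; exact: mulr_ge0.
pose G1 := cI * (2 * C0 * (g0 * T + g1 * A1) + T).
pose E1 := expR G1; have E10 : 0 < E1 by exact: expR_gt0.
(* Order of the choices: N0 is given, the truncation N makes its error small, then the iterate j
   makes the Picard defect small; that defect contains the number of points of the box N, so j comes
   last. Passing from H^-1 back to H^1 in the box N0 costs N0^4, and each error is allowed 1 / 2. *)
have [N1 N1P] := exists_nat_ge (2 * (N0%:R ^+ 4 * (8 * A1 / delta) * E1)).
pose N := maxn (maxn N0 N1) 1.
have N0N : (N0 <= N)%N by rewrite !leq_max leqnn.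
have Ngt0 : 0 < N%:R :> R by rewrite ltr0n leq_max orbT.
have NP : N0%:R ^+ 4 * (8 * A1 / delta / N%:R) * E1 <= 1 / 2.
  have -> : N0%:R ^+ 4 * (8 * A1 / delta / N%:R) * E1 =
      N0%:R ^+ 4 * (8 * A1 / delta) * E1 / N%:R by ring.
  rewrite ler_pdivrMr//.
  have : N1%:R <= N%:R :> R by rewrite ler_nat !leq_max leqnn orbT.
  lra.
(* The box has at most 8 N^2 points, and at each of them the squared defect is at most 4 B (B /
   2^j). *)
pose hj j := C0 ^+ 2 * (8 * N%:R ^+ 2 * (4 * (B * (B / 2 ^+ j)))).
have hj0 j : 0 <= hj j.
  have : 0 <= B / 2 ^+ j by apply: divr_ge0 => //; exact: exprn_ge0.
  by move=> h; rewrite /hj !mulr_ge0 ?sqr_ge0.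
have [j jP] := exists_nat_ge (2 * (N0%:R ^+ 4 * (hj 0%N * T) * E1)).
have hjP : N0%:R ^+ 4 * (hj j * T) * E1 <= 1 / 2.
  have -> : N0%:R ^+ 4 * (hj j * T) * E1 = N0%:R ^+ 4 * (hj 0%N * T) * E1 / 2 ^+ j.
    by rewrite /hj expr0; field; rewrite expf_neq0.
  rewrite ler_pdivrMr ?exprn_gt0//.
  have : j%:R <= 2 ^+ j :> R by rewrite -natrX ler_nat ltnW// ltn_expl.
  lra.
have [w [w0 wS]] := picard_exists M nu x0 F N.
have [a [g [ag0 aB gB wa wg]]] :=
  picard_majorant C00 MC0 nu0 w0 wS (ltW eta0) T0 (@smallT N) (cA N) etaB.
pose y s := \sum_(n <- box N) \sum_p ((x p n s - w j.+1 p n s) / (fnorm n)%:R) ^+ 2.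
pose wd p n s := - (nu * lam R n) * w j.+1 p n s +
   (F p n + quad M N (fun q k => w j q k s) (fun q k => w j q k s) p n).
pose dy s := \sum_(n <- box N) \sum_p 2 * ((x p n s - w j.+1 p n s) / (fnorm n)%:R) *
   ((xd p n s - wd p n s) / (fnorm n)%:R).
have [cG Gz GE GA] := GamP N; have [cQ Qz QE QA] := QP N.
pose S s := \sum_p sqnorm 2 N (fun n => x p n s).
pose gg s := cI * (2 * C0 * (g0 + g1 * S s) + 1).
pose GG s := cI * (2 * C0 * (g0 * s + g1 * Gam N s) + s).
pose hh s := hj j + 8 * N%:R / delta * q N s ^+ 2.
pose HH s := hj j * s + 8 * N%:R / delta * Q N s.
have cw p n i : continuous (w i p n) by have [] := wS i p n.
have cy : continuous y.
  apply: continuous_bigsum => n; apply: continuous_bigsum => p s.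
  have cd : {for s, continuous (fun s => (x p n s - w j.+1 p n s) / (fnorm n)%:R)}.
    by apply: cvgM; [apply: cvgB; [exact: cx|exact: cw]|exact: cvg_cst].
  exact: (cvgM cd cd).
have yE s : 0 < s < T -> is_derive s 1 y (dy s).
  move=> sT; apply: is_derive_bigsum => n _; apply: is_derive_bigsum => p _.
  have wE : is_derive s 1 (w j.+1 p n) (wd p n s).
    by have [_ _ h] := wS j p n; apply: h; case/andP: sT.
  have h : is_derive s 1 (fun s => (x p n s - w j.+1 p n s) / (fnorm n)%:R)
      ((xd p n s - wd p n s) * (fnorm n)%:R^-1 + (x p n s - w j.+1 p n s) * 0).
    by apply: is_deriveM1; apply: is_deriveB; exact: xdE.
  apply: (is_derive_eq' (is_deriveM1 h h)); ring.
have cGG : continuous GG.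
  move=> s; apply: cvgM; first exact: cvg_cst.
  apply: cvgD; last exact: cvg_id.
  apply: cvgM; first exact: cvg_cst.
  apply: cvgD; first exact: continuous_linear.
  by apply: cvgM; [exact: cvg_cst|exact: cG].
have cHH : continuous HH.
  move=> s; apply: cvgD; first exact: continuous_linear.
  by apply: cvgM; [exact: cvg_cst|exact: cQ].
have GGE s : 0 < s < T -> is_derive s 1 GG (gg s).
  move=> sT.
  apply: is_deriveZ1; apply: is_deriveD; apply: is_deriveZ1.
  apply: is_deriveD; first exact: is_derive_linear.
  by apply: is_deriveZ1; exact: GE.
have HHE s : 0 < s < T -> is_derive s 1 HH (hh s).
  move=> sT; apply: is_deriveD; first exact: is_derive_linear.
  by apply: is_deriveZ1; exact: QE.
have d0 : 0 <= 8 * N%:R / delta.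
  exact: (divr_ge0 (mulr_ge0 (ler0n _ 8) (ler0n _ N)) (ltW delta0)).
have y00 s : 0 <= y s by apply: sumr_ge0 => n _; apply: sumr_ge0 => p _; exact: sqr_ge0.
have ineq s : 0 < s < T -> dy s <= gg s * y s + hh s.
  move=> sT; have sT' : 0 <= s <= T by case/andP: sT => ? ?; rewrite !ltW.
  have := @energy_derivative_le R I M C0 C00 MC0 nu nu0 N F (fun p n => x p n s)
    (fun p n => w j.+1 p n s) (fun p n => w j p n s) (fun p n => xd p n s)
    (fun p n => wd p n s) (a j.+1) (a j) (g j) (q N s).
  rewrite -/cI -/e -/delta -/(dy s) -/(y s).
  set X := fun n => _ + a j.+1 n => h.
  have {h} := h (fun n => (ag0 _ n).1) (fun n => wa j.+1 s n sT')
    (fun n => wa j s n sT') (fun n => wg j s n sT')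
    (fun p n nN => ode N p n s nN sT) (fun p n => erefl).
  move=> h; apply: (le_trans h) => {h}.
  have X0K : sqnorm 0 N X <= K2.
    apply: (le_trans (sqnormD_le _ _ _ _)); apply: lerD; rewrite ler_wpM2l//.
      by apply: (le_trans (sqnorm_mag_le _ _ _)); rewrite ler_wpM2l ?bound.
    exact: le_trans (sqnorm0_le2 _ _) (aB _).
  have X2S : sqnorm 2 N X <= 2 * (cI * S s) + 2 * B.
    apply: (le_trans (sqnormD_le _ _ _ _)); apply: lerD; rewrite ler_wpM2l//.
    exact: sqnorm_mag_le.
  have X20 := sqnorm_ge0 2 N X; have X00 := sqnorm_ge0 0 N X.
  apply: lerD.
    apply: ler_wpM2r => //; rewrite [leLHS]mulrC; apply: ler_wpM2l => //; rewrite lerD2r.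
    apply: ler_wpM2l; first by rewrite mulr_ge0.
    have i1 : 64 / e ^+ 3 * (2 + 2 * (sqnorm 0 N X * sqnorm 2 N X)) <=
        128 / e ^+ 3 + 128 / e ^+ 3 * K2 * sqnorm 2 N X.
      have -> : 128 / e ^+ 3 + 128 / e ^+ 3 * K2 * sqnorm 2 N X =
        64 / e ^+ 3 * (2 + 2 * (K2 * sqnorm 2 N X)) by field; rewrite gt_eqF.
      apply: ler_wpM2l; first by apply: divr_ge0 => //; apply: exprn_ge0; exact: ltW.
      by rewrite lerD2l ler_wpM2l// ler_wpM2r.
    have i2 : k * sqnorm 2 N X <= k * (2 * (cI * S s) + 2 * B) by exact: ler_wpM2l.
    rewrite /g0 /g1; move: i1 i2; rewrite {1}/k; lra.
  rewrite lerD2r ler_wpM2l ?sqr_ge0//.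
  apply: (@le_trans _ _ (\sum_(n <- box N) 1 * (4 * (B * (B / 2 ^+ j))))).
    apply: ler_sum => n _; rewrite mul1r.
    have b0 : 0 <= B / 2 ^+ j by apply: divr_ge0 => //; exact: exprn_ge0.
    have cv1 : conv N (a j.+1) (g j) n ^+ 2 <= B * (B / 2 ^+ j).
      apply: (le_trans (sqr_conv_le _ _ _ _)); apply: ler_pM; rewrite ?sqnorm_ge0//;
        apply: (le_trans (sqnorm0_le2 _ _)); [exact: aB|exact: gB].
    have cv2 : conv N (g j) (a j) n ^+ 2 <= B * (B / 2 ^+ j).
      rewrite convC.
      apply: (le_trans (sqr_conv_le _ _ _ _)); apply: ler_pM; rewrite ?sqnorm_ge0//;
        apply: (le_trans (sqnorm0_le2 _ _)); [exact: aB|exact: gB].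
    have := sqr_ge0 (conv N (a j.+1) (g j) n - conv N (g j) (a j) n).
    move: cv1 cv2; lra.
  rewrite -mulr_suml ler_wpM2r ?sum_box1//.
  apply: mulr_ge0 => //; apply: mulr_ge0 => //; apply: divr_ge0 => //; exact: exprn_ge0.
have S0 s : 0 <= S s by apply: sumr_ge0 => p _; exact: sqnorm_ge0.
have GG0 s : 0 < s < T -> 0 <= GG s.
  move=> sT; have sT' : 0 <= s <= T by case/andP: sT => ? ?; rewrite !ltW.
  have /andP[h _] := GA s sT'; have s0 : 0 <= s by case/andP: sT'.
  apply: mulr_ge0 => //; apply: addr_ge0 => //; apply: mulr_ge0; first exact: mulr_ge0.
  by apply: addr_ge0; exact: mulr_ge0.
have hh0 s : 0 < s < T -> 0 <= hh s.
  by move=> _; apply: addr_ge0 => //; apply: mulr_ge0 => //; exact: sqr_ge0.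
have GGz : GG 0 = 0 by rewrite /GG Gz !mulr0 !addr0 !mulr0.
have HHz : HH 0 = 0 by rewrite /HH Qz !mulr0 addr0.
have yz : y 0 = 0.
  rewrite /y big1// => n _; rewrite big1// => p _.
  by have [_ h _] := wS j p n; rewrite xz h subrr mul0r expr0n.
have := gronwall cy cGG cHH yE GGE HHE GGz HHz ineq GG0 hh0 tT.
rewrite yz add0r => yle.
have [t0 tT1] := andP tT.
have HHle : HH t <= hj j * T + 8 * A1 / delta / N%:R.
  apply: lerD; first exact: ler_wpM2l.
  have -> : 8 * A1 / delta / N%:R = 8 * N%:R / delta * (A1 / N%:R ^+ 2).
    by field; rewrite !gt_eqF.
  rewrite ler_wpM2l// ler_pdivlMr ?exprn_gt0// mulrC; exact: QA.
have GGle : expR (GG t) <= E1.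
  rewrite ler_expR ler_wpM2l//; apply: lerD => //; apply: ler_wpM2l; first exact: mulr_ge0.
  by apply: lerD; apply: ler_wpM2l => //; have /andP[_] := GA t tT.
have yle1 : N0%:R ^+ 4 * y t <= 1.
  have h1 : HH t * expR (GG t) <= (hj j * T + 8 * A1 / delta / N%:R) * E1.
    apply: (@le_trans _ _ ((hj j * T + 8 * A1 / delta / N%:R) * expR (GG t))).
      by rewrite ler_wpM2r ?expR_ge0.
    rewrite ler_wpM2l// addr_ge0//; first by rewrite mulr_ge0 ?hj0// ltW.
    exact: (divr_ge0 (divr_ge0 (mulr_ge0 (ler0n _ 8) A10) (ltW delta0)) (ltW Ngt0)).
  have N40 : 0 <= N0%:R ^+ 4 :> R by rewrite exprn_ge0.
  apply: (le_trans (ler_wpM2l N40 (le_trans yle h1))).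
  have -> : N0%:R ^+ 4 * ((hj j * T + 8 * A1 / delta / N%:R) * E1) =
     N0%:R ^+ 4 * (hj j * T) * E1 + N0%:R ^+ 4 * (8 * A1 / delta / N%:R) * E1 by ring.
  by apply: (le_trans (lerD hjP NP)); rewrite -splitr.
apply: (@le_trans _ _ (2 * (\sum_p sqnorm 2 N0 (fun n => w j.+1 p n t)) +
    2 * \sum_p sqnorm 2 N0 (fun n => x p n t - w j.+1 p n t))).
  rewrite !mulr_sumr -big_split /=; apply: ler_sum => p _.
  apply: le_trans (sqnormD_le _ _ _ _); rewrite le_eqVlt; apply/orP; left; apply/eqP.
  by apply: eq_bigr => n _; rewrite addrC subrK.
apply: lerD; rewrite -[leRHS]mulr1 ?mulr1.
  rewrite ler_wpM2l//; apply: le_trans (aB j.+1).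
  apply: (le_trans (sum_sqnorm_le_mag _ _ _)).
  rewrite /sqnorm -(sum_box_filter _ N0N).
  apply: (@le_trans _ _ (\sum_(n <- box N) (fnorm n)%:R ^+ 2 * mag (fun p n => w j.+1 p n t) n ^+ 2)).
    by apply: (@ler_sum_subpred _ _ _ _ xpredT) => // n; rewrite mulr_ge0 ?sqr_ge0.
  rewrite big_seq [leRHS]big_seq; apply: ler_sum => n nN.
  by rewrite ler_wpM2l ?sqr_ge0// ler_pXn2r ?nnegrE ?mag_ge0 ?(ag0 _ _).1// wa.
rewrite -[leRHS]mulr1 ler_wpM2l//; apply: le_trans yle1.
rewrite /sqnorm exchange_big /= -(sum_box_filter _ N0N) /y mulr_sumr.
apply: (@le_trans _ _ (\sum_(n <- box N | (fnorm n <= N0)%N)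
  N0%:R ^+ 4 * \sum_p ((x p n t - w j.+1 p n t) / (fnorm n)%:R) ^+ 2)).
  rewrite big_seq_cond [leRHS]big_seq_cond; apply: ler_sum => n /andP[nN nN0].
  rewrite mulr_sumr; apply: ler_sum => p _.
  have n1 := fnorm_ge1 R nN.
  have -> : (fnorm n)%:R ^+ 2 * (x p n t - w j.+1 p n t) ^+ 2 =
     (fnorm n)%:R ^+ 4 * ((x p n t - w j.+1 p n t) / (fnorm n)%:R) ^+ 2.
    by field; exact: lt0r_neq0 (lt_le_trans ltr01 n1).
  by rewrite ler_wpM2r ?sqr_ge0// lerXn2r ?nnegrE// ler_nat.
apply: (@ler_sum_subpred _ _ _ _ xpredT) => // n.
by apply: mulr_ge0; [exact: exprn_ge0|apply: sumr_ge0 => p _; exact: sqr_ge0].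
Qed.

(** * Smooth functions and plane waves *)

Section SmoothFunctions.
Variable R : realType.
Implicit Types (f g : R -> R).

(** Each level carries an explicit derivative, so closure under sums, products and affine
    substitutions follows by induction from the rules of differentiation. *)
Fixpoint Cn (n : nat) f : Prop :=
  if n is m.+1 then exists2 g, (forall x : R, is_derive x 1 f (g x)) & Cn m g
  else continuous f.

Definition Cinf f := forall n, Cn n f.

Lemma CnW n f : Cn n.+1 f -> Cn n f.
Proof.
elim: n f => [|n IH] f; first by move=> [g fg _]; exact: continuous_of_is_derive fg.
by move=> [g fg /IH gn]; exists g.
Qed.

Lemma CnD n f g : Cn n f -> Cn n g -> Cn n (fun x => f x + g x).
Proof.
elim: n f g => [|n IH] f g; first by move=> cf cg x; apply: cvgD; [exact: cf|exact: cg].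
move=> [f' ff' f'n] [g' gg' g'n]; exists (fun x => f' x + g' x); last exact: IH.
by move=> x; exact: is_deriveD.
Qed.

Lemma Cn_cst n (c : R) : Cn n (fun=> c).
Proof.
elim: n c => [|n IH] c; first by move=> x; exact: cvg_cst.
by exists (fun=> 0); [move=> x; exact: is_derive_cst|exact: IH].
Qed.

Lemma CnM n f g : Cn n f -> Cn n g -> Cn n (fun x => f x * g x).
Proof.
elim: n f g => [|n IH] f g; first by move=> cf cg x; apply: cvgM; [exact: cf|exact: cg].
move=> /[dup] fn [f' ff' f'n] /[dup] gn [g' gg' g'n].
exists (fun x => f' x * g x + f x * g' x).
  by move=> x; exact: is_deriveM1.
by apply: CnD; apply: IH => //; exact: CnW.
Qed.

Lemma Cn_affine n f (a b : R) : Cn n f -> Cn n (fun x => f (a * x + b)).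
Proof.
have ad (x : R) : is_derive x 1 (fun x => a * x + b) a.
  rewrite -[X in is_derive _ _ _ X]addr0; apply: is_deriveD.
  exact: is_derive_linear.
have ca : continuous (fun x : R => a * x + b) by exact: continuous_of_is_derive ad.
elim: n f => [|n IH] f.
  by move=> cf x; apply: (@continuous_comp _ _ _ (fun x => a * x + b) f); [exact: ca|exact: cf].
move=> [f' ff' f'n]; exists (fun x => f' (a * x + b) * a).
  by move=> x; exact: (@is_derive1_comp _ f (fun x => a * x + b) x).
by apply: CnM; [exact: IH|exact: Cn_cst].
Qed.

Lemma CinfD f g : Cinf f -> Cinf g -> Cinf (fun x => f x + g x).
Proof. by move=> cf cg n; exact: CnD. Qed.

Lemma CinfM f g : Cinf f -> Cinf g -> Cinf (fun x => f x * g x).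
Proof. by move=> cf cg n; exact: CnM. Qed.

Lemma Cinf_cst (c : R) : Cinf (fun=> c).
Proof. by move=> n; exact: Cn_cst. Qed.

Lemma Cinf_affine f (a b : R) : Cinf f -> Cinf (fun x => f (a * x + b)).
Proof. by move=> cf n; exact: Cn_affine. Qed.

Lemma Cinf_is_derive f (x : R) : Cinf f -> is_derive x 1 f (derive1 f x).
Proof.
by move=> /(_ 1%N)[g fg _]; rewrite derive1E; have := fg x => -[d _]; exact: DeriveDef.
Qed.

Lemma derive1_of_is_derive f g : (forall x : R, is_derive x 1 f (g x)) -> derive1 f = g.
Proof. by move=> fg; apply/funext => x; rewrite derive1E; have := fg x => -[]. Qed.

Lemma Cinf_derive f : Cinf f -> Cinf (derive1 f).
Proof.
move=> cf n; have [g fg gn] := cf n.+1.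
by rewrite (derive1_of_is_derive fg).
Qed.

Lemma Cinf_continuous f : Cinf f -> continuous f.
Proof. by move=> /(_ 0%N). Qed.

Lemma Cinf_primitive F f : (forall x : R, is_derive x 1 F (f x)) -> Cinf f -> Cinf F.
Proof.
move=> Ff cf [|n]; last by exists f.
exact: continuous_of_is_derive Ff.
Qed.

(** The flat function exp (- 1 / x), multiplied by powers of 1 / x to obtain a family whose
    derivatives are combinations of its members; all are then smooth by one induction. *)
Definition psi (k : nat) (x : R) : R := if 0 < x then x^-1 ^+ k * expR (- x^-1) else 0.

Lemma psi_ge0 k x : 0 <= psi k x.
Proof.
rewrite /psi; case: ifP => // x0.
by rewrite mulr_ge0 ?expR_ge0// exprn_ge0// invr_ge0 ltW.
Qed.

Lemma pow_expRN_le (k : nat) (y : R) : 0 < y -> y ^+ k.+1 * expR (- y) <= k.+1%:R ^+ k.+1.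
Proof.
move=> y0; rewrite expRN ler_pdivrMr ?expR_gt0//.
have k0 : 0 < k.+1%:R :> R by rewrite ltr0n.
have -> : expR y = expR (y / k.+1%:R) ^+ k.+1.
  by rewrite -expRM_natl mulrC divfK// gt_eqF.
rewrite -exprMn ler_pXn2r ?nnegrE ?mulr_ge0 ?expR_ge0 ?(ltW y0)//.
rewrite mulrC -ler_pdivrMr//; apply: le_trans (expR_ge1Dx _).
by rewrite lerDr.
Qed.

Lemma psi_le k (x : R) : 0 < x -> psi k x <= k.+1%:R ^+ k.+1 * x.
Proof.
move=> x0; rewrite /psi x0.
have xi0 : 0 < x^-1 by rewrite invr_gt0.
rewrite -ler_pdivrMr//; have := pow_expRN_le k xi0.
by have -> : x^-1 ^+ k * expR (- x^-1) / x = x^-1 ^+ k.+1 * expR (- x^-1) by rewrite exprS; ring.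
Qed.

Lemma is_derive_of_quotient f (l x : R) :
  (fun h => h^-1 * (f (h + x) - f x)) @ 0^' --> l -> is_derive x 1 f l.
Proof.
move=> fl.
have E : (fun h : R => h^-1 *: ((f \o shift x) (h *: 1) - f x)) =
    (fun h => h^-1 * (f (h + x) - f x)).
  by apply/funext => h /=; rewrite /GRing.scale/= mulr1.
apply: DeriveDef; first by rewrite /derivable E; apply/cvg_ex; exists l.
by rewrite /derive E; exact: cvg_lim.
Qed.

Lemma is_derive_psi k (x : R) : is_derive x 1 (psi k) (psi k.+2 x - k%:R * psi k.+1 x).
Proof.
have [x0|x0|->] := ltgtP x 0.
- apply: (@near_eq_is_derive _ _ _ (fun=> 0)).
    near=> y; rewrite /psi ifF//; apply/negbTE; rewrite -leNgt; apply: ltW.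
    by near: y; exact: lt_nbhsl.
  rewrite /psi !(lt_gtF x0) mulr0 subr0; exact: is_derive_cst.
- apply: (@near_eq_is_derive _ _ _ (fun y : R => y^-1 ^+ k * expR (- y^-1))).
    by near=> y; rewrite /psi ifT//; near: y; exact: lt_nbhsr.
  have iv : is_derive x 1 (fun y : R => y^-1) (- x^-1 ^+ 2).
    have xn0 : id x != 0 by rewrite gt_eqF.
    apply: (is_derive_eq' (is_deriveV xn0 (is_derive_id x 1))).
    by rewrite /GRing.scale/= mulr1 exprVn.
  have h1 : is_derive x 1 (fun y : R => y^-1 ^+ k) (k%:R * x^-1 ^+ k.-1 * (- x^-1 ^+ 2)).
    have -> : (fun y : R => y^-1 ^+ k) = (fun y : R => y^-1) ^+ k.
      by apply/funext => y; rewrite exprfctE.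
    apply: (is_derive_eq' (is_deriveX k iv)).
    by rewrite /GRing.scale/= mulr_natl.
  have h2 := is_derive_expR_comp (is_deriveN iv).
  apply: (is_derive_eq' (is_deriveM1 h1 h2)).
  rewrite /psi x0.
  case: k {h1 h2} => [|k] /=.
    by rewrite !mul0r !add0r subr0 opprK expr0 mul1r expr2 mulrC.
  rewrite opprK !exprS; ring.
(* At the origin, on the positive side, the difference quotient is the next member of the family,
   which the exponential makes smaller than a multiple of h. *)
- have -> : psi k.+2 0 - k%:R * psi k.+1 0 = 0 by rewrite /psi ltxx mulr0 subr0.
  apply: is_derive_of_quotient.
  pose C : R := k.+2%:R ^+ k.+2.
  apply: (@squeeze_cvgr _ _ _ _ (fun=> 0) (fun h => C * `|h|)).
  + near=> h; rewrite addr0 /psi ltxx subr0.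
    have [h0|h0] := ltP 0 h; last first.
      by rewrite mulr0 lexx mulr_ge0// exprn_ge0.
    rewrite (gtr0_norm h0) mulrA -exprS; have := psi_le k.+1 h0.
    by rewrite /psi h0 => ->; rewrite mulr_ge0 ?expR_ge0// exprn_ge0// invr_ge0 ltW.
  + exact: cvg_cst.
  + rewrite -[X in _ --> X](mulr0 C) -[X in _ * X](@normr0 _ R).
    apply: cvgM; first exact: cvg_cst.
    by apply: cvg_norm; exact: cvg_within.
Unshelve. all: by end_near. Qed.

Lemma Cinf_psi k : Cinf (psi k).
Proof.
move=> n; elim: n k => [|n IH] k; first exact: continuous_of_is_derive (is_derive_psi k).
exists (fun x => psi k.+2 x - k%:R * psi k.+1 x); first exact: is_derive_psi.
have -> : (fun x => psi k.+2 x - k%:R * psi k.+1 x) =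
    (fun x => psi k.+2 x + (fun x => - k%:R) x * psi k.+1 x).
  by apply/funext => x; rewrite mulNr.
apply: CnD => //; apply: CnM => //; exact: Cn_cst.
Qed.

(** The normalised primitive of the bump psi_0(x) psi_0(1 - x). The sign of the derivative is
    recorded because it will serve as an averaging kernel. *)
Lemma smooth_step : exists th : R -> R,
  [/\ Cinf th, forall x, x <= 0 -> th x = 0, forall x, 1 <= x -> th x = 1 &
      forall x, 0 <= derive1 th x].
Proof.
pose rho x := psi 0 x * psi 0 (- 1 * x + 1).
have rhoC : Cinf rho by apply: CinfM; [|apply: (Cinf_affine (-1) 1)]; exact: Cinf_psi.
have rho0 x : 0 <= rho x by rewrite mulr_ge0 ?psi_ge0.
have rho_pos (x : R) : 0 < x < 1 -> 0 < rho x.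
  move=> /andP[x0 x1]; rewrite /rho /psi x0.
  have -> : 0 < - 1 * x + 1 by lra.
  by rewrite !expr0 !mul1r mulr_gt0 ?expR_gt0.
have rho_le x : x <= 0 -> rho x = 0 by rewrite /rho /psi; case: ltP => //; rewrite mul0r.
have rho_ge x : 1 <= x -> rho x = 0.
  by move=> x1; rewrite /rho [X in _ * X]/psi ifF ?mulr0//; apply/negbTE; rewrite -leNgt; lra.
have [F F0 FE] := primitive_line (Cinf_continuous rhoC).
have cF : continuous F by exact: continuous_of_is_derive FE.
have mvt (x y : R) : x < y -> exists2 c, x < c < y & F y - F x = rho c * (y - x).
  move=> xy; have FE' z : z \in `]x, y[ -> is_derive z 1 F (rho z) by move=> _; exact: FE.
  have [|c cxy E] := MVT xy FE'; first exact: continuous_subspaceT.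
  by exists c => //; rewrite in_itv/= in cxy.
have F1 : 0 < F 1.
  have [c c01] := mvt 0 1 ltr01; rewrite F0 !subr0 mulr1 => ->; exact: rho_pos.
have C1 : Cinf (fun x => (F 1)^-1 * F x).
  by apply: CinfM; [exact: Cinf_cst|exact: Cinf_primitive FE rhoC].
have D1 (x : R) : is_derive x 1 (fun x => (F 1)^-1 * F x) ((F 1)^-1 * rho x) by exact: is_deriveZ1.
exists (fun x => (F 1)^-1 * F x); split => //.
- move=> x; rewrite le_eqVlt => /predU1P[->|x0]; first by rewrite F0 mulr0.
  have [c /andP[_ c0]] := mvt x 0 x0; rewrite (rho_le c (ltW c0)) mul0r F0 sub0r.
  by move/eqP; rewrite oppr_eq0 => /eqP ->; rewrite mulr0.
- move=> x; rewrite le_eqVlt => /predU1P[<-|x1]; first by rewrite mulVf// gt_eqF.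
  have [c /andP[c1 _]] := mvt 1 x x1; rewrite (rho_ge c (ltW c1)) mul0r.
  by move/eqP; rewrite subr_eq0 => /eqP ->; rewrite mulVf// gt_eqF.
- move=> x; rewrite (derive1_of_is_derive D1).
  by rewrite mulr_ge0// invr_ge0 ltW.
Qed.

End SmoothFunctions.

Section WaveFunctions.
Variables (R : realType) (V : normedModType R).

Lemma is_derive_line (g : V -> R) (v z : V) (l : R) :
  is_derive (0 : R) 1 (fun h : R => g (h *: v + z)) l -> is_derive z v g l.
Proof.
move=> [d1 d2].
have E : (fun h : R => h^-1 *: (((fun h : R => g (h *: v + z)) \o shift 0) (h *: 1) -
    g (0 *: v + z))) = (fun h : R => h^-1 *: ((g \o shift z) (h *: v) - g z)).
  by apply/funext => h /=; rewrite scale0r add0r addr0 /GRing.scale /= mulr1.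
by apply: DeriveDef; [move: d1|move: d2]; rewrite /derivable /derive E.
Qed.

Variables (a b : V -> R).
Hypothesis aL : forall h v z, a (h *: v + z) = h * a v + a z.
Hypothesis bL : forall h v z, b (h *: v + z) = h * b v + b z.
Hypothesis ca : continuous a.
Hypothesis cb : continuous b.

(** With [a] and [b] linear, these functions are closed under every directional derivative, which is
    the form in which [smooth] asks for regularity. They cover the trigonometric functions ([a]
    zero) and their products with a function of time ([a] the time). *)
Definition wave (f g : R -> R) (z : V) : R := f (a z) * cos (b z) + g (a z) * sin (b z).

Lemma is_derive_wave f g (v z : V) : Cinf f -> Cinf g ->
  is_derive z v (wave f g)
    (wave (fun s => a v * derive1 f s + b v * g s) (fun s => a v * derive1 g s - b v * f s) z).
Proof.
move=> fC gC; apply: is_derive_line.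
under eq_fun do rewrite /wave aL bL.
have da : is_derive (0 : R) 1 (fun h => h * a v + a z) (a v).
  rewrite -[X in is_derive _ _ _ X]addr0; apply: is_deriveD.
  under eq_fun do rewrite mulrC; exact: is_derive_linear.
have db : is_derive (0 : R) 1 (fun h => h * b v + b z) (b v).
  rewrite -[X in is_derive _ _ _ X]addr0; apply: is_deriveD.
  under eq_fun do rewrite mulrC; exact: is_derive_linear.
have comp (f1 l : R -> R) (df : R) : is_derive (f1 (0 : R)) 1 l df -> forall r, is_derive (0 : R) 1 f1 r ->
   is_derive (0 : R) 1 (fun h => l (f1 h)) (df * r).
  by move=> h1 r h2; exact: is_derive1_comp.
have h0 (c : V -> R) : 0 * c v + c z = c z by rewrite mul0r add0r.
have df := comp _ _ _ (Cinf_is_derive (0 * a v + a z) fC) _ da.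
have dg := comp _ _ _ (Cinf_is_derive (0 * a v + a z) gC) _ da.
have dc := comp _ _ _ (is_derive_cos (0 * b v + b z)) _ db.
have ds := comp _ _ _ (is_derive_sin (0 * b v + b z)) _ db.
apply: (is_derive_eq' (is_deriveD (is_deriveM1 df dc) (is_deriveM1 dg ds))).
rewrite !h0 /wave; ring.
Qed.

Lemma continuous_wave f g : continuous f -> continuous g -> continuous (wave f g).
Proof.
move=> cf cg z; apply: cvgD; apply: cvgM.
- by apply: (@continuous_comp _ _ _ a f); [exact: ca|exact: cf].
- by apply: (@continuous_comp _ _ _ b cos); [exact: cb|exact: continuous_cos].
- by apply: (@continuous_comp _ _ _ a g); [exact: ca|exact: cg].
- by apply: (@continuous_comp _ _ _ b sin); [exact: cb|exact: continuous_sin].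
Qed.

Lemma smooth_wave f g : Cinf f -> Cinf g -> smooth (wave f g).
Proof.
move=> fC gC vs.
suff [f' [g' [f'C g'C ->]]] : exists f' g', [/\ Cinf f', Cinf g' &
    iter_derive vs (wave f g) = wave f' g'].
  split; first by apply: continuous_wave; exact: Cinf_continuous.
  by move=> v x; have [] := is_derive_wave v x f'C g'C.
elim: vs => [|v vs [f' [g' [f'C g'C E]]]]; first by exists f, g.
exists (fun s => a v * derive1 f' s + b v * g' s), (fun s => a v * derive1 g' s + - b v * f' s).
split.
- by apply: CinfD; apply: CinfM => //; [exact: Cinf_cst|exact: Cinf_derive|exact: Cinf_cst].
- by apply: CinfD; apply: CinfM => //; [exact: Cinf_cst|exact: Cinf_derive|exact: Cinf_cst].
- apply/funext => z /=; rewrite E; have [_ ->] := is_derive_wave v z f'C g'C.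
  by congr wave; apply/funext => s; rewrite mulNr.
Qed.

End WaveFunctions.

(** * Square integrable functions on the cell *)

Section L2.
Variable R : realType.
Local Notation T2 := (measurableTypeR R * measurableTypeR R)%type.
Implicit Types (g h : R * R -> R).

Lemma twopi_gt0 : 0 < 2 * pi :> R.
Proof. by rewrite mulr_gt0// pi_gt0. Qed.

Lemma measurable_cell : measurable (cell R : set T2).
Proof. by apply: measurableX; exact: measurable_itv. Qed.

Lemma area_cell : area R (cell R) = ((2 * pi) ^+ 2)%:E.
Proof.
pose I : set R := `[0, 2 * pi]%classic.
have -> : area R (cell R) = (@lebesgue_measure R I * @lebesgue_measure R I)%E.
  by apply: product_measure1E; exact: measurable_itv.
by rewrite /I lebesgue_measure_itv/= lte_fin twopi_gt0 sube0 -EFinM expr2.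
Qed.

Lemma area_cell_lty : (area R (cell R) < +oo)%E.
Proof. by rewrite area_cell ltry. Qed.

(** Neither periodicity nor zero mean is imposed, in contrast with [in_L2]: products with
    trigonometric functions must stay in the class. *)
Definition L2f g : Prop := measurable_fun (setT : set T2) g /\
  (\int[area R]_(x in cell R) ((g x) ^+ 2)%:E < +oo)%E.

Definition int_cell g : R := \int[area R]_(x in cell R) g x.

Definition cell_integrable g := (area R).-integrable (cell R) (EFin \o g).

Lemma cell_integrable_le g h : measurable_fun (setT : set T2) g ->
  (forall x, `|g x| <= h x) -> cell_integrable h -> cell_integrable g.
Proof.
move=> mg gh; apply: le_integrable; first exact: measurable_cell.
  by apply/measurable_EFinP; apply: measurable_funTS.
by move=> x _ /=; rewrite lee_fin; apply: (le_trans (gh x)); exact: ler_norm.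
Qed.

Lemma L2f_sqr g : L2f g -> cell_integrable (fun x => g x ^+ 2).
Proof.
move=> [mg ig]; apply/integrableP; split.
  apply/measurable_EFinP; apply: measurable_funTS.
  by apply: measurable_funX.
under eq_integral do rewrite /= ger0_norm ?sqr_ge0//.
exact: ig.
Qed.

Lemma cell_integrableD g h : cell_integrable g -> cell_integrable h ->
  cell_integrable (fun x => g x + h x).
Proof.
move=> ig ih; have := integrableD measurable_cell ig ih; rewrite /cell_integrable.
by congr (_.-integrable _ _); apply/funext => x /=; rewrite EFinD.
Qed.

Lemma cell_integrableZ (c : R) g : cell_integrable g -> cell_integrable (fun x => c * g x).
Proof.
move=> ig; have := integrableZl measurable_cell c ig; rewrite /cell_integrable.
by congr (_.-integrable _ _); apply/funext => x /=; rewrite EFinM.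
Qed.

Lemma L2fP g : measurable_fun (setT : set T2) g -> cell_integrable (fun x => g x ^+ 2) ->
  L2f g.
Proof.
move=> mg /integrableP[_ ig]; split => //; apply: le_lt_trans ig.
rewrite le_eqVlt; apply/orP; left; apply/eqP; apply: eq_integral => x _ /=.
by rewrite ger0_norm// sqr_ge0.
Qed.

Lemma cell_integrable_bounded g (K : R) : measurable_fun (setT : set T2) g ->
  (forall x, `|g x| <= K) -> cell_integrable g.
Proof.
move=> mg gK; apply: measurable_bounded_integrable.
- exact: measurable_cell.
- exact: area_cell_lty.
- exact: measurable_funTS.
- exists K; split; first exact: num_real.
  by move=> M KM x _; apply: (le_trans (gK x)); exact: ltW.
Qed.

Lemma L2f_bounded g (K : R) : measurable_fun (setT : set T2) g ->
  (forall x, `|g x| <= K) -> L2f g.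
Proof.
move=> mg gK; apply: L2fP => //; apply: (@cell_integrable_bounded _ (K ^+ 2)).
  exact: measurable_funX.
by move=> x; rewrite normrX lerXn2r ?nnegrE//; exact: le_trans (gK x).
Qed.

Lemma L2fM g h : L2f g -> L2f h -> cell_integrable (fun x => g x * h x).
Proof.
move=> Lg Lh; apply: (@cell_integrable_le _ (fun x => g x ^+ 2 + h x ^+ 2)).
- by apply: measurable_funM; [exact: Lg.1|exact: Lh.1].
- move=> x; rewrite normrM.
  rewrite -(@real_normK _ (g x)) ?num_real// -(@real_normK _ (h x)) ?num_real//.
  have := sqr_ge0 (`|g x| - `|h x|); have := sqr_ge0 `|g x|; have := sqr_ge0 `|h x|; nra.
- by apply: cell_integrableD; exact: L2f_sqr.
Qed.

Lemma L2fD g h : L2f g -> L2f h -> L2f (fun x => g x + h x).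
Proof.
move=> Lg Lh; have mgh : measurable_fun (setT : set T2) (fun x => g x + h x).
  by apply: measurable_funD; [exact: Lg.1|exact: Lh.1].
apply: L2fP => //.
apply: (@cell_integrable_le _ (fun x => 2 * g x ^+ 2 + 2 * h x ^+ 2)).
- exact: measurable_funX.
- move=> x; rewrite ger0_norm ?sqr_ge0//; have := sqr_ge0 (g x - h x); nra.
- by apply: cell_integrableD; apply: cell_integrableZ; exact: L2f_sqr.
Qed.

Lemma L2fZ (c : R) g : L2f g -> L2f (fun x => c * g x).
Proof.
move=> Lg; apply: L2fP.
  by apply: measurable_funM => //; exact: Lg.1.
under eq_fun do rewrite exprMn.
by apply: cell_integrableZ; exact: L2f_sqr.
Qed.

Lemma L2fB g h : L2f g -> L2f h -> L2f (fun x => g x - h x).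
Proof.
move=> Lg Lh; have -> : (fun x => g x - h x) = (fun x => g x + -1 * h x).
  by apply/funext => x; rewrite mulN1r.
by apply: L2fD => //; exact: L2fZ.
Qed.

Lemma L2f0 : L2f (fun=> 0).
Proof. by apply: (@L2f_bounded _ 0) => // x; rewrite normr0. Qed.

Lemma L2f_sum (J : Type) (s : seq J) (P : pred J) (F : J -> R * R -> R) :
  (forall j, L2f (F j)) -> L2f (fun x => \sum_(j <- s | P j) F j x).
Proof.
move=> LF; elim: s => [|j s IH].
  by under eq_fun do rewrite big_nil; exact: L2f0.
under eq_fun do rewrite big_cons.
by case: (P j) => //; exact: L2fD.
Qed.

Lemma int_cellD g h : cell_integrable g -> cell_integrable h ->
  int_cell (fun x => g x + h x) = int_cell g + int_cell h.
Proof. by move=> ig ih; apply: RintegralD => //; exact: measurable_cell. Qed.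

Lemma int_cellZ (c : R) g : cell_integrable g -> int_cell (fun x => c * g x) = c * int_cell g.
Proof. by move=> ig; apply: RintegralZl => //; exact: measurable_cell. Qed.

Lemma cell_integrable0 : cell_integrable (fun=> 0).
Proof. by apply: (@cell_integrable_bounded _ 0) => // x; rewrite normr0. Qed.

Lemma int_cell0 : int_cell (fun=> 0) = 0.
Proof.
by rewrite /int_cell Rintegral_cst ?mul0r//; exact: measurable_cell.
Qed.

Lemma cell_integrable_sum (J : Type) (s : seq J) (P : pred J) (F : J -> R * R -> R) :
  (forall j, cell_integrable (F j)) -> cell_integrable (fun x => \sum_(j <- s | P j) F j x).
Proof.
move=> LF; elim: s => [|j s IH].
  by under eq_fun do rewrite big_nil; exact: cell_integrable0.
under eq_fun do rewrite big_cons.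
by case: (P j) => //; exact: cell_integrableD.
Qed.

Lemma int_cell_sum (J : Type) (s : seq J) (P : pred J) (F : J -> R * R -> R) :
  (forall j, cell_integrable (F j)) ->
  int_cell (fun x => \sum_(j <- s | P j) F j x) = \sum_(j <- s | P j) int_cell (F j).
Proof.
move=> LF; elim: s => [|j s IH].
  by rewrite big_nil; under eq_fun do rewrite big_nil; exact: int_cell0.
rewrite big_cons; under eq_fun do rewrite big_cons.
case: (P j) => //; rewrite int_cellD ?IH//; exact: cell_integrable_sum.
Qed.

Definition ip g h : R := int_cell (fun x => g x * h x).

Lemma ipC g h : ip g h = ip h g.
Proof. by congr int_cell; apply/funext => x; rewrite mulrC. Qed.

Lemma ipDl g g' h : L2f g -> L2f g' -> L2f h ->
  ip (fun x => g x + g' x) h = ip g h + ip g' h.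
Proof.
move=> Lg Lg' Lh; rewrite /ip -int_cellD; try exact: L2fM.
by congr int_cell; apply/funext => x; rewrite mulrDl.
Qed.

Lemma ipZl (c : R) g h : L2f g -> L2f h -> ip (fun x => c * g x) h = c * ip g h.
Proof.
move=> Lg Lh; rewrite /ip -int_cellZ; last exact: L2fM.
by congr int_cell; apply/funext => x; rewrite mulrA.
Qed.

Lemma ipBl g g' h : L2f g -> L2f g' -> L2f h ->
  ip (fun x => g x - g' x) h = ip g h - ip g' h.
Proof.
move=> Lg Lg' Lh; have -> : (fun x => g x - g' x) = (fun x => g x + -1 * g' x).
  by apply/funext => x; rewrite mulN1r.
by rewrite ipDl// ?ipZl// ?mulN1r//; exact: L2fZ.
Qed.

Lemma ip_suml (J : Type) (s : seq J) (P : pred J) (F : J -> R * R -> R) h :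
  (forall j, L2f (F j)) -> L2f h ->
  ip (fun x => \sum_(j <- s | P j) F j x) h = \sum_(j <- s | P j) ip (F j) h.
Proof.
move=> LF Lh; rewrite /ip -int_cell_sum; last by move=> j; exact: L2fM.
by congr int_cell; apply/funext => x; rewrite mulr_suml.
Qed.

Definition sqn g : R := ip g g.

Lemma sqnE g : sqn g = int_cell (fun x => g x ^+ 2).
Proof. by congr int_cell; apply/funext => x; rewrite expr2. Qed.

Lemma sqn_ge0 g : 0 <= sqn g.
Proof. by rewrite sqnE; apply: Rintegral_ge0 => x _; exact: sqr_ge0. Qed.

Lemma sqnD g h : L2f g -> L2f h ->
  sqn (fun x => g x + h x) = sqn g + 2 * ip g h + sqn h.
Proof.
move=> Lg Lh; have Lgh := L2fD Lg Lh.
rewrite /sqn ipDl// (ipC g) (ipC h) !ipDl// (ipC h g); ring.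
Qed.

Lemma sqnZ (c : R) g : L2f g -> sqn (fun x => c * g x) = c ^+ 2 * sqn g.
Proof.
move=> Lg; have Lcg := L2fZ c Lg.
by rewrite /sqn ipZl// ipC ipZl// mulrA.
Qed.

Lemma sqnB g h : L2f g -> L2f h ->
  sqn (fun x => g x - h x) = sqn g - 2 * ip g h + sqn h.
Proof.
move=> Lg Lh; have -> : (fun x => g x - h x) = (fun x => g x + -1 * h x).
  by apply/funext => x; rewrite mulN1r.
rewrite sqnD ?sqnZ// ?(ipC g) ?ipZl//; [rewrite (ipC h); ring|exact: L2fZ].
Qed.

Lemma cauchy_ip g h : L2f g -> L2f h -> ip g h ^+ 2 <= sqn g * sqn h.
Proof.
move=> Lg Lh.
have key (s t : R) : 0 <= s ^+ 2 * sqn g + 2 * (s * t) * ip g h + t ^+ 2 * sqn h.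
  have := sqn_ge0 (fun x => s * g x + t * h x).
  rewrite sqnD; try exact: L2fZ.
  by rewrite !sqnZ// ipZl// ?(ipC g) ?ipZl// ?(ipC h); [lra|exact: L2fZ].
have g0 := sqn_ge0 g; have h0 := sqn_ge0 h.
have [gp|gz] := ltP 0 (sqn g).
  have := key (- ip g h) (sqn g).
  have -> : (- ip g h) ^+ 2 * sqn g + 2 * (- ip g h * sqn g) * ip g h + sqn g ^+ 2 * sqn h =
    sqn g * (sqn g * sqn h - ip g h ^+ 2) by ring.
  by rewrite pmulr_rge0// subr_ge0.
have {}gz : sqn g = 0 by apply/eqP; rewrite eq_le gz g0.
(* With [sqn g] zero the form is affine in s, and this pair makes it a negative multiple of
   [ip g h ^+ 2]. *)
rewrite gz mul0r; have := key (- (sqn h + 1)) (ip g h); rewrite gz.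
have := sqr_ge0 (ip g h); nra.
Qed.

Lemma sqnD_le g h : L2f g -> L2f h -> sqn (fun x => g x + h x) <= 2 * sqn g + 2 * sqn h.
Proof.
move=> Lg Lh; have := sqn_ge0 (fun x => g x - h x); rewrite sqnB// sqnD//; lra.
Qed.

Definition phase (n : int * int) (x : R * R) : R := n.1%:~R * x.1 + n.2%:~R * x.2.

(** The real Fourier basis. The bit turns differentiation into negation and the product formulas
    into exclusive or. *)
Definition trg (b : bool) (n : int * int) (x : R * R) : R :=
  if b then sin (phase n x) else cos (phase n x).

Lemma measurable_phase n : measurable_fun (setT : set T2) (phase n).
Proof.
apply: measurable_funD; apply: measurable_funM => //.
Qed.

Lemma measurable_trg b n : measurable_fun (setT : set T2) (trg b n).
Proof.
rewrite /trg; case: b.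
  apply: (measurableT_comp _ (measurable_phase n)).
  by apply: continuous_measurable_fun; exact: continuous_sin.
apply: (measurableT_comp _ (measurable_phase n)).
by apply: continuous_measurable_fun; exact: continuous_cos.
Qed.

Lemma trg_le1 b n x : `|trg b n x| <= 1.
Proof.
rewrite /trg ler_norml; case: b; first by rewrite sin_geN1 sin_le1.
by rewrite cos_geN1 cos_le1.
Qed.

Lemma L2f_trg b n : L2f (trg b n).
Proof. apply: (@L2f_bounded _ 1); [exact: measurable_trg|exact: trg_le1]. Qed.

Lemma cell_integrable_trg b n : cell_integrable (trg b n).
Proof. apply: (@cell_integrable_bounded _ 1); [exact: measurable_trg|exact: trg_le1]. Qed.

End L2.

(** * Fourier projections *)

Section Trigonometric.
Variable R : realType.
Local Notation T2 := (measurableTypeR R * measurableTypeR R)%type.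
Local Notation leb := (@lebesgue_measure R).
Implicit Types (g h u v : R * R -> R) (n m k : int * int).

Lemma ftc_line (F f : R -> R) (a b : R) : a < b -> continuous f ->
  (forall x : R, is_derive x 1 F (f x)) ->
  (\int[leb]_(x in `[a, b]) (f x)%:E = (F b - F a)%:E)%E.
Proof.
move=> ab cf Ff; have cF := continuous_of_is_derive Ff.
rewrite (@continuous_FTC2 _ f F a b ab) ?EFinB//.
- exact: continuous_subspaceT.
- split.
  + by move=> x _; have [] := Ff x.
  + exact: cvg_at_right_filter (cF a).
  + exact: cvg_at_left_filter (cF b).
- by move=> x _; rewrite derive1E; have [] := Ff x.
Qed.

Lemma cos_int_period (x : R) (i : int) : cos (x + i%:~R * (2 * pi)) = cos x.
Proof.
have h (n : nat) (y : R) : cos (y + n%:R * (2 * pi)) = cos y.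
  by rewrite mulr_natl [2 * _]mulr_natl; exact: (periodicn (@cosD2pi R)).
case: i => n; first by rewrite -pmulrn h.
by rewrite NegzE intrN mulNr -(h n.+1 (_ - _)) -pmulrn subrK.
Qed.

Lemma sin_int_period (x : R) (i : int) : sin (x + i%:~R * (2 * pi)) = sin x.
Proof.
have h (n : nat) (y : R) : sin (y + n%:R * (2 * pi)) = sin y.
  by rewrite mulr_natl [2 * _]mulr_natl; exact: (periodicn (@sinD2pi R)).
case: i => n; first by rewrite -pmulrn h.
by rewrite NegzE intrN mulNr -(h n.+1 (_ - _)) -pmulrn subrK.
Qed.

Lemma is_derive_affine (a c x : R) : is_derive x 1 (fun y => a * y + c) a.
Proof.
rewrite -[X in is_derive _ _ _ X]addr0; apply: is_deriveD; exact: is_derive_linear.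
Qed.

Lemma integral_trig_period (b : bool) (i : int) (c : R) : i != 0 ->
  (\int[leb]_(x in `[0%R, (2 * pi)%R]) ((if b then sin else cos) (i%:~R * x + c))%:E = 0)%E.
Proof.
move=> i0; have a0 : (i%:~R : R) != 0 by rewrite intr_eq0.
set a : R := i%:~R in a0 *.
have ca : continuous (fun x : R => a * x + c).
  exact: (continuous_of_is_derive (fun x => is_derive_affine a c x)).
case: b.
  have cf : continuous (fun x => sin (a * x + c)).
    by move=> x; apply: (@continuous_comp _ _ _ (fun x => a * x + c) sin);
      [exact: ca|exact: continuous_sin].
  have Ff (x : R) : is_derive x 1 (fun x => - a^-1 * cos (a * x + c)) (sin (a * x + c)).
    apply: (is_derive_eq' (is_deriveZ1 _ (is_derive1_comp (is_derive_cos _)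
      (is_derive_affine a c x)))); by field.
  rewrite (ftc_line (twopi_gt0 R) cf Ff).
  by rewrite mulr0 add0r [_ + c]addrC cos_int_period subrr.
have cf : continuous (fun x => cos (a * x + c)).
  by move=> x; apply: (@continuous_comp _ _ _ (fun x => a * x + c) cos);
    [exact: ca|exact: continuous_cos].
have Ff (x : R) : is_derive x 1 (fun x => a^-1 * sin (a * x + c)) (cos (a * x + c)).
  apply: (is_derive_eq' (is_deriveZ1 _ (is_derive1_comp (is_derive_sin _)
    (is_derive_affine a c x)))); by field.
rewrite (ftc_line (twopi_gt0 R) cf Ff).
by rewrite mulr0 add0r [_ + c]addrC sin_int_period subrr.
Qed.

(** Fubini with the inner integral in a coordinate of nonzero frequency, over a whole number of
    periods. The integrand is extended by zero to the plane for this. *)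
Lemma int_cell_trg_neq0 b n : n != 0 -> int_cell (@trg R b n) = 0.
Proof.
move=> n0; pose I : set R := `[0, 2 * pi]%classic.
pose f : T2 -> \bar R := (EFin \o @trg R b n) \_ (cell R).
have imf : (area R).-integrable setT f.
  have h := (integrable_mkcond (mu := area R) (EFin \o @trg R b n) (@measurable_cell R)).1 (cell_integrable_trg R b n).
  exact: h.
rewrite /int_cell /Rintegral integral_mkcond -/f.
have [n1|n2] : n.1 != 0 \/ n.2 != 0.
  case: n n0 {f imf} => x y /=; have [->|] := eqVneq x 0; last by left.
  by have [->|] := eqVneq y 0; [|right].
- rewrite -[X in fine X](integral21_prod_meas1 imf).
  rewrite integral0_eq// => y _.
  have [yI|yI] := boolP (y \in I); last first.
    apply: integral0_eq => x _; rewrite /f patchE memNset//.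
    by move=> [_ yI']; move: yI; rewrite mem_set.
  transitivity (\int[leb]_(x in I) (trg b n (x, y))%:E)%E.
    rewrite integral_mkcond; apply: eq_integral => x _; rewrite /f !patchE /=.
    have [xI|xI] := boolP (x \in I).
      by rewrite mem_set//; split; rewrite /= -/I; apply/set_mem.
    by rewrite memNset// => -[xI' _]; move: xI; rewrite mem_set.
  have := @integral_trig_period b n.1 (n.2%:~R * y) n1.
  by apply: etrans; apply: eq_integral => x _ /=; rewrite /trg /phase/=; case: (b).
- rewrite -[X in fine X](integral12_prod_meas1 imf).
  rewrite integral0_eq// => x _.
  have [xI|xI] := boolP (x \in I); last first.
    apply: integral0_eq => y _; rewrite /f patchE memNset//.
    by move=> [xI' _]; move: xI; rewrite mem_set.
  transitivity (\int[leb]_(y in I) (trg b n (x, y))%:E)%E.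
    rewrite integral_mkcond; apply: eq_integral => y _; rewrite /f !patchE /=.
    have [yI|yI] := boolP (y \in I).
      by rewrite mem_set//; split; rewrite /= -/I; apply/set_mem.
    by rewrite memNset// => -[_ yI']; move: yI; rewrite mem_set.
  have := @integral_trig_period b n.2 (n.1%:~R * x) n2.
  by apply: etrans; apply: eq_integral => y _ /=; rewrite /trg /phase/= addrC; case: (b).
Qed.

Lemma trg0 b x : @trg R b 0 x = (~~ b)%:R.
Proof. by rewrite /trg /phase !mul0r addr0; case: b; rewrite ?sin0 ?cos0. Qed.

Lemma int_cell_trg b n : int_cell (@trg R b n) = ((n == 0) && ~~ b)%:R * (2 * pi) ^+ 2.
Proof.
have [->|n0] := eqVneq n 0; last by rewrite mul0r int_cell_trg_neq0.
have -> : @trg R b 0 = fun=> (~~ b)%:R by apply/funext => x; rewrite trg0.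
rewrite /int_cell Rintegral_cst; last exact: measurable_cell.
by have := area_cell R; rewrite /area => ->.
Qed.

Lemma phaseD n m x : phase (n + m) x = phase n x + phase m x :> R.
Proof. by rewrite /phase /= !intrD; ring. Qed.

Lemma phaseN n x : phase (- n) x = - phase n x :> R.
Proof. by rewrite /phase /= !intrN; ring. Qed.

Lemma trgN b n x : @trg R b (- n) x = (-1) ^+ b * @trg R b n x.
Proof. by rewrite /trg phaseN; case: b; rewrite ?cosN ?sinN ?expr1 ?expr0 ?mulN1r ?mul1r. Qed.

Lemma trgM b b' n m x : @trg R b n x * @trg R b' m x =
  2^-1 * ((-1) ^+ ((~~ b) && b') * @trg R (b (+) b') (n - m) x +
   (-1) ^+ (b && b') * @trg R (b (+) b') (n + m) x).
Proof.
rewrite /trg !phaseD phaseN; case: b; case: b' => /=;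
  rewrite ?expr0 ?expr1 !(cosD, sinD, cosN, sinN); by field.
Qed.

Definition coef u b n : R := ip u (@trg R b n).

Lemma coefN u b n : L2f u -> coef u b (- n) = (-1) ^+ b * coef u b n.
Proof.
move=> Lu; rewrite /coef ipC -(ipC (@trg R b n)) -ipZl//; last exact: L2f_trg.
by congr ip; apply/funext => x; rewrite trgN.
Qed.

Lemma ip_trg b b' n m : ip (@trg R b n) (@trg R b' m) =
  (b == b')%:R * (2 * pi) ^+ 2 / 2 * ((n == m)%:R + (-1) ^+ b * (n == - m)%:R).
Proof.
pose s1 : R := (-1) ^+ ((~~ b) && b').
have -> : ip (@trg R b n) (@trg R b' m) = int_cell (fun x =>
    2^-1 * s1 * @trg R (b (+) b') (n - m) x + 2^-1 * (-1) ^+ (b && b') * @trg R (b (+) b') (n + m) x).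
  by congr int_cell; apply/funext => x; rewrite trgM /s1; ring.
have I k c : cell_integrable (@trg R c k) := cell_integrable_trg R c k.
rewrite int_cellD; try exact: cell_integrableZ.
rewrite !int_cellZ// !int_cell_trg subr_eq0 addr_eq0 /s1 {s1}.
by case: b; case: b'; case: (n == m); case: (n == - m) => /=;
  rewrite ?expr0 ?expr1; by field.
Qed.

Lemma sum_box_delta N m (F : int * int -> R) :
  \sum_(n <- box N) (n == m)%:R * F n = (m \in box N)%:R * F m.
Proof.
have [mN|mN] := boolP (m \in box N).
  rewrite (bigD1_seq m)//= ?uniq_box// eqxx !mul1r big1 ?addr0// => n /negbTE ->.
  by rewrite mul0r.
rewrite mul0r big_seq big1// => n nN.
by rewrite (negbTE (memPn mN n nN)) mul0r.
Qed.

(* The box contains both n and - n, hence no factor 2. *)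
Definition proj N u x : R := (2 * pi) ^- 2 *
  \sum_(n <- box N) \sum_(b : bool) coef u b n * @trg R b n x.

Lemma L2f_proj N u : L2f (proj N u).
Proof.
apply: L2fZ; apply: L2f_sum => n; apply: L2f_sum => b; apply: L2fZ; exact: L2f_trg.
Qed.

Lemma ip_proj N u h : L2f h ->
  ip (proj N u) h = (2 * pi) ^- 2 * \sum_(n <- box N) \sum_(b : bool) coef u b n * coef h b n.
Proof.
move=> Lh; have Lt b n : L2f (fun x => coef u b n * @trg R b n x).
  by apply: L2fZ; exact: L2f_trg.
rewrite /proj ipZl//; last by apply: L2f_sum => n; exact: L2f_sum.
congr (_ * _); rewrite ip_suml//; last by move=> n; exact: L2f_sum.
apply: eq_bigr => n _; rewrite ip_suml//; apply: eq_bigr => b _.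
by rewrite ipZl//; [rewrite [ip (@trg R b n) h]ipC|exact: L2f_trg].
Qed.

Lemma twopi2_neq0 : (2 * pi) ^+ 2 != 0 :> R.
Proof. by rewrite expf_neq0// gt_eqF// twopi_gt0. Qed.

Lemma coef_proj N u b m : L2f u -> coef (proj N u) b m = (m \in box N)%:R * coef u b m.
Proof.
move=> Lu; rewrite /coef ip_proj; last exact: L2f_trg.
have -> : \sum_(n <- box N) \sum_(b' : bool) coef u b' n * coef (@trg R b m) b' n =
  (2 * pi) ^+ 2 / 2 * (\sum_(n <- box N) (n == m)%:R * coef u b n +
   (-1) ^+ b * \sum_(n <- box N) (n == - m)%:R * coef u b n).
  rewrite mulr_sumr -big_split /= mulr_sumr; apply: eq_bigr => n _.
  rewrite (bigD1 b)//= big1 ?addr0; last first.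
    by move=> b' /negbTE bb; rewrite /coef ip_trg eq_sym bb !mul0r mulr0.
  rewrite {2}/coef ip_trg eqxx mul1r [m == n]eq_sym.
  have -> : (m == - n) = (n == - m) by rewrite eq_sym eqr_oppLR.
  ring.
rewrite !sum_box_delta boxN coefN// -/(coef u b m).
have -> : (-1) ^+ b * ((m \in box N)%:R * ((-1) ^+ b * coef u b m)) =
   (m \in box N)%:R * coef u b m.
  by rewrite mulrCA [_ ^+ b * (_ * _)]mulrA -expr2 sqrr_sign mul1r.
have := twopi2_neq0; move: ((2 * pi) ^+ 2) => c c0; by field.
Qed.

Lemma sqn_proj N u : L2f u ->
  sqn (proj N u) = (2 * pi) ^- 2 * \sum_(n <- box N) \sum_(b : bool) coef u b n ^+ 2.
Proof.
move=> Lu; rewrite /sqn ip_proj; last exact: L2f_proj.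
congr (_ * _); rewrite big_seq [RHS]big_seq; apply: eq_bigr => n nN.
by apply: eq_bigr => b _; rewrite coef_proj// nN mul1r expr2.
Qed.

Lemma sqn_sub_proj N u : L2f u -> sqn (fun x => u x - proj N u x) =
  sqn u - (2 * pi) ^- 2 * \sum_(n <- box N) \sum_(b : bool) coef u b n ^+ 2.
Proof.
move=> Lu; have Lp := L2f_proj N u.
rewrite sqnB// ipC ip_proj// sqn_proj//.
under eq_bigr do under eq_bigr do rewrite -expr2.
ring.
Qed.

Lemma bessel N u : L2f u ->
  \sum_(n <- box N) \sum_(b : bool) coef u b n ^+ 2 <= (2 * pi) ^+ 2 * sqn u.
Proof.
move=> Lu; have := sqn_ge0 (fun x => u x - proj N u x); rewrite sqn_sub_proj// subr_ge0.
have p0 : 0 < (2 * pi) ^+ 2 :> R by rewrite exprn_gt0// twopi_gt0.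
by rewrite mulrC ler_pdivrMr// mulrC.
Qed.

End Trigonometric.

(** * Density of trigonometric polynomials *)

Section TrigPolynomials.
Variable R : realType.
Local Notation T2 := (measurableTypeR R * measurableTypeR R)%type.
Implicit Types (g h p q : R * R -> R).

Inductive trigpoly : (R * R -> R) -> Prop :=
| trigpoly_trg b n : trigpoly (trg b n)
| trigpolyD p q : trigpoly p -> trigpoly q -> trigpoly (fun x => p x + q x)
| trigpolyZ c p : trigpoly p -> trigpoly (fun x => c * p x).

Lemma L2f_trigpoly p : trigpoly p -> L2f p.
Proof.
elim=> [b n|q r _ Lq _ Lr|c q _ Lq]; [exact: L2f_trg|exact: L2fD|exact: L2fZ].
Qed.

Lemma trigpoly_ext p q : (forall x, p x = q x) -> trigpoly p -> trigpoly q.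
Proof. by move=> pq tp; rewrite (_ : q = p)//; apply/funext => x; rewrite pq. Qed.

Lemma trigpolyM p q : trigpoly p -> trigpoly q -> trigpoly (fun x => p x * q x).
Proof.
move=> tp; elim: tp q => [b n|p1 p2 _ IH1 _ IH2|c p1 _ IH] q tq; last first.
- by apply: trigpoly_ext (trigpolyZ c (IH q tq)) => x; rewrite mulrA.
- by apply: trigpoly_ext (trigpolyD (IH1 q tq) (IH2 q tq)) => x; rewrite mulrDl.
elim: tq => [b' m|q1 q2 _ IH1 _ IH2|c q1 _ IH].
- apply: trigpoly_ext (trigpolyZ 2^-1 (trigpolyD
    (trigpolyZ ((-1) ^+ ((~~ b) && b')) (trigpoly_trg (b (+) b') (n - m)))
    (trigpolyZ ((-1) ^+ (b && b')) (trigpoly_trg (b (+) b') (n + m))))) => x.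
  by rewrite trgM.
- by apply: trigpoly_ext (trigpolyD IH1 IH2) => x; rewrite mulrDr.
- by apply: trigpoly_ext (trigpolyZ c IH) => x; rewrite mulrCA.
Qed.

Lemma trigpoly_cst (c : R) : trigpoly (fun=> c).
Proof.
by apply: trigpoly_ext (trigpolyZ c (trigpoly_trg false 0)) => x; rewrite trg0 mulr1.
Qed.

Lemma trigpolyX p k : trigpoly p -> trigpoly (fun x => p x ^+ k).
Proof.
move=> tp; elim: k => [|k IH]; first exact: trigpoly_cst.
by apply: trigpoly_ext (trigpolyM tp IH) => x; rewrite exprS.
Qed.

Lemma trigpoly_affine (a c : R) p : trigpoly p -> trigpoly (fun x => c + a * p x).
Proof. by move=> tp; apply: trigpolyD (trigpolyZ a tp); exact: trigpoly_cst. Qed.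

(* Brosowski-Deutsch: converges boundedly on [0, 1] to a step function. *)
Definition step_poly (m : nat) (w : R) : R := (1 - w ^+ m) ^+ (2 ^ m).

Lemma step_poly01 m w : 0 <= w <= 1 -> 0 <= step_poly m w <= 1.
Proof.
move=> /andP[w0 w1].
have a0 : 0 <= 1 - w ^+ m by rewrite subr_ge0 exprn_ile1.
have a1 : 1 - w ^+ m <= 1 by rewrite gerBl exprn_ge0.
by rewrite /step_poly exprn_ge0//= exprn_ile1.
Qed.

Lemma bernoulli_ge (x : R) k : -1 <= x -> 1 + k%:R * x <= (1 + x) ^+ k.
Proof.
move=> x1; elim: k => [|k IH]; first by rewrite mul0r addr0 expr0.
rewrite exprS; apply: (@le_trans _ _ ((1 + x) * (1 + k%:R * x))); last first.
  by apply: ler_wpM2l => //; lra.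
rewrite -subr_ge0 -natr1.
have -> : (1 + x) * (1 + k%:R * x) - (1 + (k%:R + 1) * x) = k%:R * x ^+ 2 by ring.
by rewrite mulr_ge0 ?sqr_ge0.
Qed.

(** Bernoulli's inequality gives (1 - w^m)^(2^m) >= 1 - (2 w)^m. *)
Lemma step_poly_cvg1 w : 0 <= w < 2^-1 -> (fun m => step_poly m w) @ \oo --> (1 : R).
Proof.
move=> /andP[w0 w1].
apply: (@squeeze_cvgr _ _ _ _ (fun m => 1 - (2 * w) ^+ m) (fun=> 1)).
- near=> m.
  have wm : 0 <= w ^+ m <= 1 by rewrite exprn_ge0//= exprn_ile1//; lra.
  have /andP[_ ->] : 0 <= step_poly m w <= 1 by apply: step_poly01; rewrite w0; lra.
  rewrite andbT /step_poly; apply: le_trans (@bernoulli_ge (- w ^+ m) (2 ^ m) _); last first.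
    by rewrite lerN2; case/andP: wm.
  by rewrite mulrN exprMn natrX.
- rewrite -[X in _ --> X]subr0; apply: cvgB; first exact: cvg_cst.
  apply: cvg_expr; rewrite ger0_norm ?mulr_ge0//.
  by rewrite -ltr_pdivlMl// mulr1.
- exact: cvg_cst.
Unshelve. all: by end_near. Qed.

(** The product of (1 - w^m)^(2^m) and (1 + w^m)^(2^m) is at most 1, and Bernoulli's inequality
    bounds the second factor below by (2 w)^m. *)
Lemma step_poly_cvg0 w : 2^-1 < w <= 1 -> (fun m => step_poly m w) @ \oo --> (0 : R).
Proof.
move=> /andP[w0 w1].
have iw : 0 < (2 * w)^-1 by rewrite invr_gt0 mulr_gt0//; lra.
apply: (@squeeze_cvgr _ _ _ _ (fun=> 0) (fun m => (2 * w)^-1 ^+ m)).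
- near=> m.
  have w0' : 0 <= w by lra.
  have /andP[-> _] : 0 <= step_poly m w <= 1 by apply: step_poly01; rewrite w0'.
  have wm : 0 <= w ^+ m <= 1 by rewrite exprn_ge0//= exprn_ile1.
  rewrite /= /step_poly exprVn -div1r ler_pdivlMr; last first.
    by rewrite exprn_gt0// mulr_gt0//; lra.
  have /andP[wm0 wm1] := wm.
  apply: (@le_trans _ _ ((1 - w ^+ m) ^+ (2 ^ m) * (1 + w ^+ m) ^+ (2 ^ m))).
    apply: ler_wpM2l; first by rewrite exprn_ge0// subr_ge0.
    apply: le_trans (@bernoulli_ge (w ^+ m) (2 ^ m) _); last by lra.
    by rewrite exprMn natrX; lra.
  rewrite -exprMn exprn_ile1//; first by rewrite mulr_ge0// ?subr_ge0//; lra.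
  have := sqr_ge0 (w ^+ m); nra.
- exact: cvg_cst.
- apply: cvg_expr; rewrite ger0_norm ?(ltW iw)//.
  by rewrite invf_lt1; lra.
Unshelve. all: by end_near. Qed.

Definition ray (s : R) : set R := `]-oo, s[%classic.

(** On the circle, the arc from 0 to s consists of the points at distance at most s / 2 from its
    midpoint. A single cosine, decreasing in that distance, separates the arc from its
    complement. *)
Lemma cos_lt_center (s y : R) : 0 < s <= 2 * pi -> 0 <= y <= 2 * pi ->
  y != 0 -> y != s -> y != 2 * pi ->
  (y < s -> cos (s / 2) < cos (y - s / 2)) /\ (s < y -> cos (y - s / 2) < cos (s / 2)).
Proof.
move=> /andP[s0 s2] /andP[y0 y2] n0 ns n2.
have {n0}y0 : 0 < y by rewrite lt_neqAle eq_sym n0.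
have {n2}y2 : y < 2 * pi by rewrite lt_neqAle n2.
have decr (x z : R) : 0 <= x -> x < z -> z <= pi -> cos z < cos x.
  move=> x0 xz zpi; rewrite ltr_cos ?in_itv/= //; lra.
have p0 := pi_gt0 R.
split => h.
- have [c|c] := leP 0 (y - s / 2); first by apply: decr; lra.
  by rewrite -[cos (y - s / 2)]cosN; apply: decr; lra.
- have [c|c] := leP (y - s / 2) pi; first by apply: decr; lra.
  have -> : cos (y - s / 2) = cos (2 * pi - (y - s / 2)).
    by rewrite -[in RHS]cosN -[in RHS](cos_int_period _ 1) mul1r; congr cos; lra.
  by apply: decr; lra.
Qed.

Lemma ray_approx (s : R) : exists S : nat -> R -> R,
  [/\ forall m, trigpoly (fun x => S m x.1), forall m, trigpoly (fun x => S m x.2),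
      forall m y, 0 <= S m y <= 1 &
      forall y, 0 <= y <= 2 * pi -> y != 0 -> y != s -> y != 2 * pi ->
        (fun m => S m y) @ \oo --> (\1_(ray s) y : R)].
Proof.
have p0 := pi_gt0 R.
have [s0|s0] := leP s 0.
  exists (fun _ _ => 0); split => //; try by move=> m; exact: trigpoly_cst.
    by move=> _ _; rewrite lexx ler01.
  move=> y /andP[y0 _] _ _ _; rewrite indicE memNset; first exact: cvg_cst.
  by rewrite /ray /= in_itv/= => ys; lra.
have [s2|s2] := ltP (2 * pi) s.
  exists (fun _ _ => 1); split => //; try by move=> m; exact: trigpoly_cst.
    by move=> _ _; rewrite lexx ler01.
  move=> y /andP[_ y2] _ _ _; rewrite indicE mem_set; first exact: cvg_cst.
  by rewrite /ray /= in_itv/=; lra.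
(* An affine image of the cosine with values in [0, 1], equal to 1 / 2 at the two ends of the arc,
   below it inside and above it outside, as the limits of [step_poly] require. *)
pose w (y : R) := 2^-1 + (cos (s / 2) - cos (y - s / 2)) / 4.
have w01 y : 0 <= w y <= 1.
  rewrite /w; have := cos_le1 (s / 2); have := cos_geN1 (s / 2).
  have := cos_le1 (y - s / 2); have := cos_geN1 (y - s / 2); lra.
have tw (P : R * R -> R) : (forall b, exists n, forall x, trg b n x = if b then sin (P x) else cos (P x)) ->
    trigpoly (fun x => w (P x)).
  move=> hP; have [n1 h1] := hP true; have [n2 h2] := hP false.
  apply: trigpoly_ext (trigpoly_affine (- 4^-1) (2^-1 + cos (s / 2) / 4)
    (trigpolyD (trigpolyZ (cos (s / 2)) (trigpoly_trg false n2))
      (trigpolyZ (sin (s / 2)) (trigpoly_trg true n1)))) => x.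
  by rewrite h1 h2 /w cosB; field.
have tS (P : R * R -> R) m : trigpoly (fun x => w (P x)) ->
    trigpoly (fun x => step_poly m (w (P x))).
  move=> tP; apply: trigpolyX.
  apply: trigpoly_ext (trigpoly_affine (-1) 1 (trigpolyX m tP)) => x.
  by rewrite mulN1r.
exists (fun m y => step_poly m (w y)); split.
- move=> m; apply: tS; apply: tw => b; exists (1, 0) => x.
  by rewrite /trg /phase /= mul1r mul0r addr0.
- move=> m; apply: tS; apply: tw => b; exists (0, 1) => x.
  by rewrite /trg /phase /= mul1r mul0r add0r.
- by move=> m y; exact: step_poly01.
- move=> y yI n0 ns n2; have s02 : 0 < s <= 2 * pi by rewrite s0.
  have [lt gt] := cos_lt_center s02 yI n0 ns n2.
  have /andP[wy0 wy1] := w01 y.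
  have [ys|sy] := ltP y s.
    rewrite indicE mem_set; last by rewrite /ray /= in_itv.
    by apply: step_poly_cvg1; rewrite wy0 /w; have := lt ys; lra.
  have {}sy : s < y by rewrite lt_neqAle eq_sym ns.
  rewrite indicE memNset; last by rewrite /ray /= in_itv/= ltNge (ltW sy).
  by apply: step_poly_cvg0; rewrite wy1 andbT /w; have := gt sy; lra.
Qed.

Definition approximable g := L2f g /\
  forall e : R, 0 < e -> exists2 p, trigpoly p & sqn (fun x => g x - p x) < e.

Lemma approximable_trigpoly p : trigpoly p -> approximable p.
Proof.
move=> tp; split; first exact: L2f_trigpoly.
move=> e e0; exists p => //; rewrite (_ : (fun x => p x - p x) = fun=> 0).
  by rewrite /sqn /ip (_ : (fun x => 0 * 0) = fun=> 0) ?int_cell0//; apply/funext => x; rewrite mulr0.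
by apply/funext => x; rewrite subrr.
Qed.

Lemma approximable_lim g : L2f g ->
  (forall e : R, 0 < e -> exists2 h, approximable h & sqn (fun x => g x - h x) < e) ->
  approximable g.
Proof.
move=> Lg gh; split => // e e0; have e4 : 0 < e / 4 by lra.
have [h [Lh hp] gh4] := gh _ e4; have [p tp hp4] := hp _ e4.
have Lp := L2f_trigpoly tp.
exists p => //; have := sqnD_le (L2fB Lg Lh) (L2fB Lh Lp).
have -> : (fun x => g x - h x + (h x - p x)) = (fun x => g x - p x).
  by apply/funext => x; rewrite addrA subrK.
lra.
Qed.

Lemma approximableD g h : approximable g -> approximable h ->
  approximable (fun x => g x + h x).
Proof.
move=> [Lg ag] [Lh ah]; split; first exact: L2fD.
move=> e e0; have e4 : 0 < e / 4 by lra.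
have [p tp gp] := ag _ e4; have [q tq hq] := ah _ e4.
have Lp := L2f_trigpoly tp; have Lq := L2f_trigpoly tq.
exists (fun x => p x + q x); first exact: trigpolyD.
have := sqnD_le (L2fB Lg Lp) (L2fB Lh Lq).
have -> : (fun x => g x - p x + (h x - q x)) = (fun x => g x + h x - (p x + q x)).
  by apply/funext => x; ring.
lra.
Qed.

Lemma approximableZ (c : R) g : approximable g -> approximable (fun x => c * g x).
Proof.
move=> [Lg ag]; split; first exact: L2fZ.
move=> e e0; have c1 : 0 < c ^+ 2 + 1 by rewrite ltr_wpDl ?sqr_ge0.
have [p tp gp] := ag (e / (c ^+ 2 + 1)) (divr_gt0 e0 c1).
exists (fun x => c * p x); first exact: trigpolyZ.
have -> : (fun x => c * g x - c * p x) = (fun x => c * (g x - p x)).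
  by apply/funext => x; rewrite mulrBr.
rewrite sqnZ; last exact: L2fB Lg (L2f_trigpoly tp).
move: gp; rewrite ltr_pdivlMr//; have := sqn_ge0 (fun x => g x - p x); nra.
Qed.

Lemma sqn_cvg0 (h : nat -> R * R -> R) g G : L2f g -> L2f G -> (forall m, L2f (h m)) ->
  (forall m x, `|g x - h m x| <= G x) ->
  {ae area R, forall x, cell R x -> (fun m => h m x) @ \oo --> g x} ->
  forall e : R, 0 < e -> exists m, sqn (fun x => g x - h m x) < e.
Proof.
move=> Lg LG Lh hG hcvg e e0.
pose f_ m x := ((g x - h m x) ^+ 2)%:E.
have LB m := L2fB Lg (Lh m).
have [|||||] := @dominated_convergence _ _ _ (area R) (cell R) (@measurable_cell R)
  f_ (cst 0%E) (fun x => (G x ^+ 2)%:E).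
- move=> m; apply/measurable_EFinP; apply: measurable_funTS; apply: measurable_funX.
  by have [] := LB m.
- exact: measurable_cst.
- move: hcvg; apply: (@filterS _ _ (ae_filter_ringOfSetsType (area R))) => x hx /hx {}hx; rewrite /f_ /cst.
  apply: cvg_EFin; first by near=> m.
  rewrite (_ : fine \o _ = fun m => (g x - h m x) ^+ 2)//.
  have -> : 0 = (g x - g x) * (g x - g x) :> R by rewrite subrr mul0r.
  under eq_fun do rewrite expr2.
  by apply: cvgM; apply: cvgB => //; exact: cvg_cst.
- exact: L2f_sqr.
- apply: aeW => x m _; rewrite /f_ /= lee_fin ger0_norm ?sqr_ge0//.
  rewrite -(@real_normK _ (g x - h m x)) ?num_real// lerXn2r ?nnegrE//.
  exact: le_trans (hG m x).
move=> _ _; rewrite integral0 => hc.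
have hc' : (fun m => sqn (fun x => g x - h m x)) @ \oo --> (0 : R).
  have := fine_cvg hc; rewrite /= => {}hc.
  have -> : (fun m => sqn (fun x => g x - h m x)) = fine \o (fun m => \int[area R]_(x in cell R) f_ m x)%E.
    by apply/funext => m; rewrite sqnE.
  exact: hc.
have /= := cvgr_dist_lt _ _ hc' _ e0.
move=> [M _ hM]; exists M; have := hM M (leqnn M).
by rewrite /= sub0r normrN ger0_norm ?sqn_ge0.
Unshelve. all: by end_near. Qed.

Lemma approximable_cvg (h : nat -> R * R -> R) g G : L2f g -> L2f G ->
  (forall m, approximable (h m)) ->
  (forall m x, `|g x - h m x| <= G x) ->
  {ae area R, forall x, cell R x -> (fun m => h m x) @ \oo --> g x} ->
  approximable g.
Proof.
move=> Lg LG ah hG hcvg; apply: approximable_lim => // e e0.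
have Lh m := (ah m).1.
by have [m hm] := sqn_cvg0 Lg LG Lh hG hcvg e0; exists (h m).
Qed.

End TrigPolynomials.

(** * Approximation of all square integrable functions, and tails of Fourier projections *)

Section Density.
Variable R : realType.
Local Notation T2 := (measurableTypeR R * measurableTypeR R)%type.
Local Notation mR := (measurableTypeR R).
Implicit Types (g h p q u : R * R -> R).

Lemma approximable_ext g h : measurable_fun (setT : set T2) h ->
  (forall x, cell R x -> g x = h x) -> approximable g -> approximable h.
Proof.
move=> mh gh [Lg ag].
have E p : int_cell (fun x => g x * p x) = int_cell (fun x => h x * p x).
  by apply: eq_Rintegral => x /set_mem xc; rewrite gh.
split.
  apply: L2fP => //.
  have := L2f_sqr Lg; apply: (@eq_integrable _ _ _ (area R)); first exact: measurable_cell.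
  by move=> x /set_mem xc /=; rewrite gh.
move=> e e0; have [p tp gp] := ag e e0; exists p => //.
rewrite sqnE; move: gp; rewrite sqnE; congr (_ < _).
by apply: eq_Rintegral => x /set_mem xc; rewrite gh.
Qed.

Lemma indic_le1 (T : Type) (A : set T) x : 0 <= (\1_A x : R) <= 1.
Proof. by rewrite indicE; case: (x \in A); rewrite /= ?lexx ?ler01. Qed.

(** Dynkin's argument prepared for three uses: [phi] is either coordinate, with [k] an indicator in
    the other variable held fixed, or the identity with [k] equal to 1. *)
Lemma lambda_approximable d (T : measurableType d) (phi : T2 -> T) (k : R * R -> R) :
  measurable_fun setT phi -> (forall x, 0 <= k x <= 1) -> approximable k ->
  lambda_system setT [set A : set T | measurable A /\
    approximable (fun x => \1_A (phi x) * k x)].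
Proof.
move=> mphi k01 ak; have mk : measurable_fun (setT : set T2) k by case: ak.1.
have mA (A : set T) : measurable A -> measurable_fun (setT : set T2) (fun x => \1_A (phi x) * k x : R).
  move=> mA; apply: measurable_funM => //.
  apply: (measurableT_comp (f := (\1_A : T -> R))) => //.
split.
- by [].
- split; first exact: measurableT.
  apply: approximable_ext ak => //; first exact: mA.
  by move=> x _; rewrite indicE mem_set// mul1r.
- move=> A B BA [mA' aA] [mB aB]; split; first exact: measurableD.
  apply: approximable_ext (approximableD aA (approximableZ (-1) aB)).
    by apply: mA; exact: measurableD.
  move=> x _; rewrite mulN1r -mulrBl; congr (_ * _); rewrite !indicE in_setD.
  have [xB|xB] := boolP (phi x \in B); last by rewrite andbT subr0.
  by rewrite andbF mem_set ?subrr//; apply/BA/set_mem.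
- move=> F ndF HF; have mF n := (HF n).1.
  have mU : measurable (\bigcup_n F n) by exact: bigcup_measurable.
  split => //.
  apply: (@approximable_cvg _ (fun n x => \1_(F n) (phi x) * k x) _ (fun=> 1)).
  + apply: (@L2f_bounded _ _ 1); first exact: mA.
    move=> x; have /andP[a0 a1] := indic_le1 (\bigcup_n F n) (phi x).
    have /andP[? ?] := k01 x.
    by rewrite ger0_norm ?mulr_ge0// mulr_ile1.
  + by apply: (@L2f_bounded _ _ 1) => // x; rewrite normr1.
  + by move=> n; have [] := HF n.
  + move=> n x; have /andP[a0 a1] := indic_le1 (\bigcup_n F n) (phi x).
    have /andP[b0 b1] := indic_le1 (F n) (phi x); have /andP[? ?] := k01 x.
    rewrite -mulrBl normrM; apply: mulr_ile1 => //.
      by rewrite ler_norml; apply/andP; split; lra.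
    by rewrite ger0_norm.
  + apply: aeW => x _; apply: cvgM; last exact: cvg_cst.
    have [[n _ xn]|xU] := pselect ((\bigcup_n F n) (phi x)).
      apply: cvg_near_cst; near=> m; rewrite !indicE !mem_set//; first by exists n.
      have nm : (n <= m)%N by near: m; exists n.
      by move/ndF : nm => /subsetPset; exact.
    apply: cvg_near_cst; near=> m; rewrite !indicE !memNset//.
    by move=> xm; apply: xU; exists m.
Unshelve. all: by end_near. Qed.

Lemma negligible_lines (s t : R) : (area R).-negligible
  [set x : R * R | x.1 = s \/ x.2 = t].
Proof.
apply: (@negligibleS _ T2 R (area R) (([set s] `*` setT) `|` (setT `*` [set t]))).
  by move=> x /= [->|->]; [left|right].
have ms (r : R) : measurable ([set r] : set mR) by exact: measurable_set1.
have E1 : area R ([set s] `*` setT) = 0%E.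
  rewrite (_ : area R _ = @lebesgue_measure R [set s] * @lebesgue_measure R setT)%E.
    by rewrite lebesgue_measure_set1 mul0e.
  exact: product_measure1E.
have E2 : area R (setT `*` [set t]) = 0%E.
  rewrite (_ : area R _ = @lebesgue_measure R setT * @lebesgue_measure R [set t])%E.
    by rewrite lebesgue_measure_set1 mule0.
  exact: product_measure1E.
apply: negligibleU.
- by exists ([set s] `*` setT); split => //; exact: measurableX.
- by exists (setT `*` [set t]); split => //; exact: measurableX.
Qed.

Lemma measurable_ray (s : R) : measurable (ray s : set mR).
Proof. exact: measurable_itv. Qed.

Lemma approximable_rays (s t : R) :
  approximable (fun x => \1_(ray s) x.1 * \1_(ray t) x.2 : R).
Proof.
have [S [S1 _ S01 Sc]] := ray_approx s; have [S' [_ S2 S'01 S'c]] := ray_approx t.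
have m1 : measurable_fun (setT : set T2) (fun x => \1_(ray s) x.1 * \1_(ray t) x.2 : R).
  apply: measurable_funM.
    apply: (measurableT_comp (f := (\1_(ray s) : mR -> R))) => //.
    by apply: measurable_indic; exact: measurable_ray.
  apply: (measurableT_comp (f := (\1_(ray t) : mR -> R))) => //.
  by apply: measurable_indic; exact: measurable_ray.
apply: (@approximable_cvg _ (fun m x => S m x.1 * S' m x.2) _ (fun=> 1)).
- apply: (@L2f_bounded _ _ 1) => // x.
  have /andP[? ?] := indic_le1 (ray s) x.1; have /andP[? ?] := indic_le1 (ray t) x.2.
  by rewrite ger0_norm ?mulr_ge0// mulr_ile1.
- by apply: (@L2f_bounded _ _ 1) => // x; rewrite normr1.
- by move=> m; apply: approximable_trigpoly; exact: trigpolyM.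
- move=> m x.
  have /andP[a0 a1] := indic_le1 (ray s) x.1; have /andP[b0 b1] := indic_le1 (ray t) x.2.
  have /andP[c0 c1] := S01 m x.1; have /andP[d0 d1] := S'01 m x.2.
  rewrite ler_norml; apply/andP; split.
    have : 0 <= \1_(ray s) x.1 * \1_(ray t) x.2 :> R by rewrite mulr_ge0.
    have : S m x.1 * S' m x.2 <= 1 by rewrite mulr_ile1.
    lra.
  have : 0 <= S m x.1 * S' m x.2 :> R by rewrite mulr_ge0.
  have : \1_(ray s) x.1 * \1_(ray t) x.2 <= 1 :> R by rewrite mulr_ile1.
  lra.
(* Convergence may fail only at the ends of the arcs and of the cell, that is, on six lines. *)
- have : (area R).-negligible ([set x : R * R | x.1 = 0 \/ x.2 = 0] `|`
      [set x : R * R | x.1 = s \/ x.2 = t] `|` [set x : R * R | x.1 = 2 * pi \/ x.2 = 2 * pi]).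
    by apply: negligibleU; [apply: negligibleU|]; exact: negligible_lines.
  apply: negligibleS => x /= nx.
  apply: contrapT => H; apply: nx => -[/= x1 x2].
  have N1 : x.1 != 0 by apply/eqP => h; apply: H; left; left; left.
  have N2 : x.1 != s by apply/eqP => h; apply: H; left; right; left.
  have N3 : x.1 != 2 * pi by apply/eqP => h; apply: H; right; left.
  have N4 : x.2 != 0 by apply/eqP => h; apply: H; left; left; right.
  have N5 : x.2 != t by apply/eqP => h; apply: H; left; right; right.
  have N6 : x.2 != 2 * pi by apply/eqP => h; apply: H; right; right.
  by apply: cvgM; [apply: Sc => //|apply: S'c => //].
Qed.

Lemma setI_closed_rays : setI_closed (@RGenInftyO.G R).
Proof.
move=> _ _ [x ->] [y ->]; exists (Num.min x y); apply/seteqP; split => z /=.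
  by rewrite !in_itv/= lt_min => -[-> ->].
by rewrite !in_itv/= lt_min => /andP[].
Qed.

Lemma borel_rays (H : set (set mR)) : lambda_system setT H ->
  (forall s, H (ray s)) -> forall A, measurable A -> H A.
Proof.
move=> lH Hr A mA.
have : <<s (@RGenInftyO.G R) >> `<=` H.
  by apply: (lambda_system_subset setI_closed_rays lH) => // _ [s ->]; exact: Hr.
apply; rewrite -[X in X A]/((@RGenInftyO.G R).-sigma.-measurable) -RGenInftyO.measurableE.
exact: mA.
Qed.

(** Rays are replaced by Borel sets in one variable at a time, by the pi-lambda theorem. The ray up
    to 2 pi + 1 covers the cell and serves as the constant 1. *)
Lemma approximable_rect (A B : set mR) : measurable A -> measurable B ->
  approximable (fun x => \1_A x.1 * \1_B x.2 : R).
Proof.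
have ak (t : R) : approximable (fun x => \1_(ray t) x.2 : R).
  apply: approximable_ext (approximable_rays (2 * pi + 1) t).
    apply: (measurableT_comp (f := (\1_(ray t) : mR -> R))) => //.
    by apply: measurable_indic; exact: measurable_ray.
  move=> x [/= x1 _]; rewrite [X in X * _]indicE mem_set ?mul1r// /ray /= in_itv/=.
  by move: x1; rewrite in_itv/= => /andP[_]; lra.
have step1 (t : R) (C : set mR) : measurable C ->
    approximable (fun x => \1_C x.1 * \1_(ray t) x.2 : R).
  move=> mC; have [] // := borel_rays (lambda_approximable measurable_fst
    (fun x => indic_le1 (ray t) x.2) (ak t)) _ mC.
  by move=> s; split; [exact: measurable_ray|exact: approximable_rays].
move=> mA mB.
have akA : approximable (fun x => \1_A x.1 : R).
  apply: approximable_ext (step1 (2 * pi + 1) A mA).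
    apply: (measurableT_comp (f := (\1_A : mR -> R))) => //.
  move=> x [/= _ x2]; rewrite [X in _ * X]indicE mem_set ?mulr1// /ray /= in_itv/=.
  by move: x2; rewrite in_itv/= => /andP[_]; lra.
have [] // := borel_rays (lambda_approximable measurable_snd
    (fun x => indic_le1 A x.1) akA) _ mB.
  move=> s; split; first exact: measurable_ray.
  by under eq_fun do rewrite mulrC; exact: step1.
by move=> _; under eq_fun do rewrite mulrC.
Qed.

Lemma approximable_indic (A : set T2) : measurable A -> approximable (\1_A : R * R -> R).
Proof.
move=> mA.
have a1 : approximable (fun=> 1 : R).
  by apply: approximable_trigpoly; exact: trigpoly_cst.
have k01 (x : R * R) : 0 <= (fun=> 1 : R) x <= 1 by rewrite ler01 lexx.
have lam := @lambda_approximable _ T2 id (fun=> 1) (@measurable_id _ T2 setT) k01 a1.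
suff : [set B : set T2 | measurable B /\ approximable (fun x => \1_B (id x) * 1 : R)] A.
  by move=> [_]; under eq_fun do rewrite mulr1.
have : <<s [set C `*` D | C in @measurable _ mR & D in @measurable _ mR] >> `<=`
    [set B : set T2 | measurable B /\ approximable (fun x => \1_B (id x) * 1 : R)].
  apply: (lambda_system_subset _ lam) => //.
    move=> _ _ [C1 mC1 [D1 mD1 <-]] [C2 mC2 [D2 mD2 <-]].
    exists (C1 `&` C2); first exact: measurableI.
    exists (D1 `&` D2); first exact: measurableI.
    by rewrite setXI.
  move=> _ [C mC [D mD <-]]; split; first exact: measurableX.
  have -> : (fun x : R * R => \1_(C `*` D) (id x) * 1 : R) = (fun x => \1_C x.1 * \1_D x.2).
    apply/funext => x; rewrite mulr1 !indicE /= -natrM mulnb; congr (_%:R); congr nat_of_bool.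
    by apply/idP/andP => [/set_mem[? ?]|[/set_mem ? /set_mem ?]]; rewrite ?mem_set.
  exact: approximable_rect.
by apply; rewrite -measurable_prod_measurableType.
Qed.

Lemma approximable_ge0 g : L2f g -> (forall x, 0 <= g x) -> approximable g.
Proof.
move=> Lg g0; have mg : measurable_fun (setT : set T2) (EFin \o g).
  by apply/measurable_EFinP; exact: Lg.1.
pose h n (x : R * R) : R := nnsfun_approx measurableT mg n x.
have g0' x : setT x -> (0 <= (EFin \o g) x)%E by move=> _; rewrite lee_fin.
have hc x : (fun n => h n x) @ \oo --> g x.
  exact: (fine_cvg (cvg_nnsfun_approx measurableT mg g0' (x := x) I)).
have h0 n x : 0 <= h n x by exact: fun_ge0.
have hg n x : h n x <= g x.
  have -> : g x = lim ((fun n => h n x) @ \oo) by apply/esym/cvg_lim => //; exact: hc.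
  apply: nondecreasing_cvgn_le; last by apply/cvg_ex; exists (g x); exact: hc.
  move=> a b ab; exact: (lefP _ _ (nd_nnsfun_approx measurableT mg ab)).
have ah n : approximable (h n).
  rewrite (_ : h n = fun x => \sum_(y <- fset_set (range (h n))) y * \1_(h n @^-1` [set y]) x).
    have : forall y, approximable (fun x => y * \1_(h n @^-1` [set y]) x).
      move=> y; apply: approximableZ; apply: approximable_indic.
      exact: measurable_sfunP.
    move=> ay; elim: (fset_set _ : seq R) => [|y s IH].
      under eq_fun do rewrite big_nil.
      by apply: approximable_trigpoly; exact: trigpoly_cst.
    under eq_fun do rewrite big_cons; exact: approximableD.
  apply/funext => x; rewrite {1}/h fimfunE -fsbig_finite//; exact: (@fimfunP _ _ (nnsfun_approx measurableT mg n)).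
apply: (approximable_cvg Lg Lg ah).
- by move=> n x; rewrite ger0_norm ?subr_ge0// gerBl.
- by apply: aeW => x _; exact: hc.
Qed.

Theorem approximable_L2f g : L2f g -> approximable g.
Proof.
move=> Lg.
have La : L2f (fun x => `|g x|).
  apply: L2fP; first exact: measurableT_comp Lg.1.
  rewrite (_ : (fun x => `|g x| ^+ 2) = (fun x => g x ^+ 2)); first exact: L2f_sqr.
  by apply/funext => x; rewrite real_normK// num_real.
have a1 : approximable (fun x => 2^-1 * (`|g x| + g x)).
  apply: approximable_ge0; first by apply: L2fZ; exact: L2fD.
  by move=> x; rewrite mulr_ge0// -lerBlDr sub0r -normrN ler_norm.
have a2 : approximable (fun x => 2^-1 * (`|g x| - g x)).
  apply: approximable_ge0; first by apply: L2fZ; exact: L2fB.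
  by move=> x; rewrite mulr_ge0// subr_ge0 ler_norm.
have := approximableD a1 (approximableZ (-1) a2).
by congr approximable; apply/funext => x; field.
Qed.

Lemma ip_sub_proj_trigpoly u p : L2f u -> coef u false 0 = 0 -> trigpoly p ->
  exists M, forall N, (M <= N)%N -> ip (proj N u) p = ip u p.
Proof.
move=> Lu u0; elim=> [b n|q r tq [M1 h1] tr [M2 h2]|c q tq [M h]].
- exists (fnorm n) => N nN; rewrite -/(coef (proj N u) b n) coef_proj// mem_box nN andbT.
  (* The box omits the origin, so for the constant mode the claim rests on the zero mean of [u]. *)
  have [|_] := posnP (fnorm n); last by rewrite mul1r.
  move/eqP; rewrite fnorm0 => /eqP ->; rewrite mul0r.
  case: b; last exact: esym u0.
  by rewrite /ip (_ : (fun x => _) = fun=> 0) ?int_cell0//; apply/funext => x; rewrite trg0 mulr0.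
- exists (maxn M1 M2) => N; rewrite geq_max => /andP[N1 N2].
  have Lq := L2f_trigpoly tq; have Lr := L2f_trigpoly tr; have Lp := L2f_proj N u.
  by rewrite ipC [RHS]ipC !ipDl// ![ip _ (proj N u)]ipC ![ip _ u]ipC h1// h2.
- exists M => N MN; have Lq := L2f_trigpoly tq; have Lp := L2f_proj N u.
  by rewrite ipC [RHS]ipC !ipZl// ![ip _ (proj N u)]ipC ![ip _ u]ipC h.
Qed.

(** Once [proj N u] and [u] have the same product with a trigonometric polynomial p, the squared
    error of p exceeds that of the projection by the squared norm of [proj N u] - p. *)
Lemma sqn_sub_proj_cvg u (e : R) : L2f u -> coef u false 0 = 0 -> 0 < e ->
  exists M, forall N, (M <= N)%N -> sqn (fun x => u x - proj N u x) < e.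
Proof.
move=> Lu u0 e0; have [_ /(_ e e0)[p tp up]] := approximable_L2f Lu.
have [M hM] := ip_sub_proj_trigpoly Lu u0 tp; exists M => N MN.
have Lp := L2f_trigpoly tp; have Lr := L2f_proj N u.
apply: le_lt_trans up; rewrite sqn_sub_proj// -sqn_proj// sqnB// -(hM N MN).
have := sqn_ge0 (fun x => proj N u x - p x); rewrite sqnB//; lra.
Qed.

(** By density the error is, up to e, a sum over N < |n| <= M' for some large M', and there |n|^2
    exceeds N^2. *)
Lemma sqn_sub_proj_le u N (S : R) : L2f u -> coef u false 0 = 0 -> (0 < N)%N ->
  (forall M, \sum_(n <- box M) (fnorm n)%:R ^+ 2 * (\sum_(b : bool) coef u b n ^+ 2) <= S) ->
  sqn (fun x => u x - proj N u x) <= (2 * pi) ^- 2 * S / N%:R ^+ 2.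
Proof.
move=> Lu u0 N0 hS; apply/ler_addgt0Pr => e e0.
have [M hM] := sqn_sub_proj_cvg Lu u0 e0.
pose M' := maxn M N; have NM : (N <= M')%N by rewrite leq_maxr.
have := hM M' (leq_maxl _ _).
have c0 : 0 <= (2 * pi) ^- 2 :> R by rewrite invr_ge0 sqr_ge0.
have NR : 0 < N%:R ^+ 2 :> R by rewrite exprn_gt0// ltr0n.
rewrite !sqn_sub_proj// => h.
suff : (2 * pi) ^- 2 * (\sum_(n <- box M') \sum_(b : bool) coef u b n ^+ 2 -
    \sum_(n <- box N) \sum_(b : bool) coef u b n ^+ 2) <= (2 * pi) ^- 2 * S / N%:R ^+ 2.
  by move: h; lra.
rewrite -mulrA; apply: ler_wpM2l => //; rewrite ler_pdivlMr//.
apply: le_trans (hS M').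
rewrite (bigID (fun n => (fnorm n <= N)%N)) /= sum_box_filter// addrC addrK.
rewrite mulr_suml [leRHS](bigID (fun n => (fnorm n <= N)%N)) /= -[leLHS]add0r.
have s0 n : 0 <= \sum_(b : bool) coef u b n ^+ 2 by apply: sumr_ge0 => b _; exact: sqr_ge0.
apply: lerD; first by apply: sumr_ge0 => n _; rewrite mulr_ge0// sqr_ge0.
apply: ler_sum => n; rewrite -ltnNge => nN; rewrite mulrC; apply: ler_wpM2r => //.
by rewrite lerXn2r ?nnegrE// ler_nat ltnW.
Qed.

End Density.

(** * Products and continuity in time *)

Section Products.
Variable R : realType.
Local Notation T2 := (measurableTypeR R * measurableTypeR R)%type.
Implicit Types (g h u v : R * R -> R) (n k : int * int).

Lemma L2fM_trg g b n : L2f g -> L2f (fun x => g x * trg b n x).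
Proof.
move=> Lg; have mgt : measurable_fun (setT : set T2) (fun x => g x * trg b n x).
  by apply: measurable_funM; [exact: Lg.1|exact: measurable_trg].
apply: L2fP => //; apply: (cell_integrable_le _ _ (L2f_sqr Lg)).
  exact: measurable_funX.
move=> x; rewrite ger0_norm ?sqr_ge0// exprMn ler_piMr ?sqr_ge0//.
by rewrite -(@real_normK _ (trg b n x)) ?num_real// exprn_ile1// trg_le1.
Qed.

Lemma sqnM_trg_le g b n : L2f g -> sqn (fun x => g x * trg b n x) <= sqn g.
Proof.
move=> Lg; rewrite !sqnE; apply: le_Rintegral.
- exact: measurable_cell.
- exact: L2f_sqr (L2fM_trg b n Lg).
- exact: L2f_sqr Lg.
- move=> x _; rewrite exprMn ler_piMr ?sqr_ge0//.
  by rewrite -(@real_normK _ (trg b n x)) ?num_real// exprn_ile1// trg_le1.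
Qed.

Definition tint g h b n : R := int_cell (fun x => g x * h x * trg b n x).

Lemma tintE g h b n : tint g h b n = ip g (fun x => h x * trg b n x).
Proof. by congr int_cell; apply/funext => x; rewrite mulrA. Qed.

Lemma tintC g h b n : tint g h b n = tint h g b n.
Proof. by congr int_cell; apply/funext => x; rewrite [g x * _]mulrC. Qed.

Lemma sqr_tint_le g h b n : L2f g -> L2f h -> tint g h b n ^+ 2 <= sqn g * sqn h.
Proof.
move=> Lg Lh; rewrite tintE; apply: (le_trans (cauchy_ip Lg (L2fM_trg b n Lh))).
by apply: ler_wpM2l; [exact: sqn_ge0|exact: sqnM_trg_le].
Qed.

Lemma tintBl g g' h b n : L2f g -> L2f g' -> L2f h ->
  tint (fun x => g x - g' x) h b n = tint g h b n - tint g' h b n.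
Proof. by move=> Lg Lg' Lh; rewrite !tintE ipBl//; exact: L2fM_trg. Qed.

Lemma tint_sub g h g' h' b n : L2f g -> L2f h -> L2f g' -> L2f h' ->
  tint g h b n - tint g' h' b n =
  tint (fun x => g x - g' x) h b n + tint (fun x => h x - h' x) g' b n.
Proof.
by move=> Lg Lh Lg' Lh'; rewrite !tintBl// [tint h g' b n]tintC [tint h' g' b n]tintC; ring.
Qed.

Lemma coefM_trg g b b' n k : L2f g -> coef (fun x => g x * trg b n x) b' k =
  2^-1 * ((-1) ^+ ((~~ b) && b') * coef g (b (+) b') (n - k) +
          (-1) ^+ (b && b') * coef g (b (+) b') (n + k)).
Proof.
move=> Lg; have Lt c m : L2f (@trg R c m) := L2f_trg R c m.
rewrite mulrDr !mulrA /coef ![ip g _]ipC -!ipZl//.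
rewrite -ipDl; try by [exact: L2fZ|].
by congr int_cell; apply/funext => x; rewrite -mulrA trgM; ring.
Qed.

Lemma sign_andN (b b' : bool) :
  (-1) ^+ (b && b') = (-1) ^+ ((~~ b) && b') * (-1) ^+ b' :> R.
Proof. by case: b; case: b' => /=; rewrite ?expr0 ?expr1; ring. Qed.

(** The product formula gives two terms, at n - k and n + k, with a factor 1 / 2. The change of k to
    - k, under which the box is invariant, identifies their sums and cancels the factor. *)
Lemma tint_proj N u v b n : L2f u -> L2f v ->
  tint (proj N u) (proj N v) b n = (2 * pi) ^- 2 *
  \sum_(k <- box N | n - k \in box N) \sum_(b' : bool)
    (-1) ^+ ((~~ b) && b') * (coef v b' k * coef u (b (+) b') (n - k)).
Proof.
move=> Lu Lv; have Lp := L2f_proj N u.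
rewrite tintC tintE ip_proj; last exact: L2fM_trg.
congr (_ * _).
pose f k b' := 2^-1 * ((-1) ^+ ((~~ b) && b') * ((n - k \in box N)%:R *
   (coef v b' k * coef u (b (+) b') (n - k)))).
transitivity (\sum_(k <- box N) \sum_(b' : bool) f k b' +
  \sum_(k <- box N) \sum_(b' : bool) f (- (- k)) b').
  have -> : \sum_(k <- box N) \sum_(b' : bool) f (- (- k)) b' =
     \sum_(k <- box N) \sum_(b' : bool) f (- k) b'.
    rewrite -[LHS](big_map (fun k => - k) xpredT (fun k => \sum_(b' : bool) f (- k) b')).
    apply: perm_big; apply: uniq_perm; rewrite ?uniq_box//.
      by rewrite map_inj_uniq ?uniq_box//; exact: oppr_inj.
    move=> k; apply/mapP/idP => [[l lN ->]|kN]; first by rewrite boxN.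
    by exists (- k); rewrite ?boxN// opprK.
  rewrite -big_split /=; apply: eq_bigr => k _; rewrite -big_split /=.
  apply: eq_bigr => b' _; rewrite coefM_trg// !coef_proj// /f coefN// opprK.
  rewrite mulrDr mulrDr; congr (_ + _); first by ring.
  by rewrite sign_andN; ring.
rewrite (eq_bigr (fun k => \sum_(b' : bool) f k b')); last by move=> k _.
under [X in _ + X]eq_bigr do rewrite opprK.
rewrite -mulr2n -mulr_natl [RHS]big_mkcond /= mulr_sumr; apply: eq_bigr => k _.
rewrite /f; case: ifP => _; last first.
  by rewrite big1 ?mulr0// => b' _; rewrite mul0r !mulr0.
by rewrite mulr_sumr; apply: eq_bigr => b' _; rewrite mul1r; field.
Qed.

End Products.

Section TimeContinuity.
Variable R : realType.
Implicit Types (U V : R -> R * R -> R).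

Definition L2cont U := (forall t, L2f (U t)) /\
  forall (t e : R), 0 < e -> \forall s \near t, sqn (fun x => U s x - U t x) < e.

Lemma cvg_of_sqr (f d : R -> R) (t K : R) : 0 <= K ->
  (\forall s \near t, (f s - f t) ^+ 2 <= K * d s) ->
  (forall e : R, 0 < e -> \forall s \near t, d s < e) -> f @ t --> f t.
Proof.
move=> K0 fd de; apply/cvgrPdist_lt => e e0.
have e1 : 0 < e ^+ 2 / (K + 1) by rewrite divr_gt0 ?exprn_gt0// ltr_wpDl.
near=> s.
have h1 : (f s - f t) ^+ 2 <= K * d s by near: s.
have h2 : d s < e ^+ 2 / (K + 1) by near: s; exact: de.
rewrite distrC -(@ltr_pXn2r _ 2) ?nnegrE// ?(ltW e0)//.
rewrite real_normK ?num_real//; apply: (le_lt_trans h1).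
move: h2; rewrite ltr_pdivlMr; last by rewrite ltr_wpDl.
have [d0|d0] := leP 0 (d s); first by lra.
by move=> _; apply: le_lt_trans (_ : 0 < _); [rewrite nmulr_lle0|rewrite exprn_gt0].
Unshelve. all: by end_near. Qed.

Lemma continuous_ip U h : L2cont U -> L2f h -> continuous (fun t => ip (U t) h).
Proof.
move=> [LU cU] Lh t.
apply: (@cvg_of_sqr _ (fun s => sqn (fun x => U s x - U t x)) t (sqn h)).
- exact: sqn_ge0.
- near=> s; rewrite -ipBl// mulrC; apply: cauchy_ip => //; exact: L2fB.
- by move=> e e0; exact: cU.
Unshelve. all: by end_near. Qed.

Lemma continuous_tint U V b n : L2cont U -> L2cont V ->
  continuous (fun t => tint (U t) (V t) b n).
Proof.
move=> [LU cU] [LV cV] t.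
pose K := 4 * (sqn (V t) + 1) + 2 * sqn (U t).
have u0 := sqn_ge0 (U t); have v0 := sqn_ge0 (V t).
apply: (@cvg_of_sqr _ (fun s => sqn (fun x => U s x - U t x) + sqn (fun x => V s x - V t x)) t K).
- by rewrite /K; lra.
- near=> s.
  have Vs : sqn (V s) <= 2 * (sqn (V t) + 1).
    have h : sqn (fun x => V s x - V t x) < 1 by near: s; exact: cV.
    have := sqnD_le (L2fB (LV s) (LV t)) (LV t).
    have -> : (fun x => V s x - V t x + V t x) = V s by apply/funext => x; rewrite subrK.
    lra.
  rewrite tint_sub//.
  have LUB := L2fB (LU s) (LU t); have LVB := L2fB (LV s) (LV t).
  have h1 := sqr_tint_le b n LUB (LV s); have h2 := sqr_tint_le b n LVB (LU t).
  have a0 := sqn_ge0 (fun x => U s x - U t x); have b0 := sqn_ge0 (fun x => V s x - V t x).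
  move: h1 h2; set X := tint _ _ _ _; set Y := tint _ _ _ _ => h1 h2.
  have h3 : X ^+ 2 <= sqn (fun x => U s x - U t x) * (2 * (sqn (V t) + 1)).
    by apply: (le_trans h1); exact: ler_wpM2l.
  have h4 : (X + Y) ^+ 2 <= 2 * X ^+ 2 + 2 * Y ^+ 2 by have := sqr_ge0 (X - Y); lra.
  apply: (le_trans h4); rewrite /K; nra.
- move=> e e0; have e2 : 0 < e / 2 by lra.
  near=> s.
  have h1 : sqn (fun x => U s x - U t x) < e / 2 by near: s; exact: cU.
  have h2 : sqn (fun x => V s x - V t x) < e / 2 by near: s; exact: cV.
  lra.
Unshelve. all: by end_near. Qed.

Lemma continuous_sqn U : L2cont U -> continuous (fun t => sqn (U t)).
Proof.
move=> cU; have -> : (fun t => sqn (U t)) = (fun t => tint (U t) (U t) false 0).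
  by apply/funext => t; congr int_cell; apply/funext => x; rewrite trg0 mulr1.
exact: continuous_tint.
Qed.

Lemma continuous_bounded (f : R -> R) (T : R) : continuous f ->
  exists K : R, forall t, 0 <= t <= T -> f t <= K.
Proof.
move=> cf; have [T0|T0] := leP 0 T; last first.
  by exists 0 => t /andP[t0 tT]; have := le_trans t0 tT; rewrite leNgt T0.
have [c _ hc] := EVT_max T0 (continuous_subspaceT cf).
by exists (f c) => t tT; apply: hc; rewrite in_itv.
Qed.

End TimeContinuity.

(** * Weak derivatives in time *)

Section WeakDerivative.
Variable R : realType.
Local Notation leb := (@lebesgue_measure R).
Implicit Types (f g chi : R -> R).

Lemma le_of_derive f df (a b : R) : a <= b -> (forall x : R, is_derive x 1 f (df x)) ->
  (forall x, a < x < b -> df x <= 0) -> f b <= f a.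
Proof.
rewrite le_eqVlt => /predU1P[->//|ab] fd df0.
have fd' x : x \in `]a, b[ -> is_derive x 1 f (df x) by move=> _; exact: fd.
have [|c] := MVT ab fd'; first exact: continuous_subspaceT (continuous_of_is_derive fd).
rewrite in_itv/= => cab E; rewrite -subr_le0 E mulr_le0_ge0 ?df0// subr_ge0 ltW//.
Qed.

Lemma derive1_eq0_of_locally f (c x : R) : (\near x, f x = c) -> derive1 f x = 0.
Proof.
move=> fc; have h : is_derive x 1 f 0.
  apply: (@near_eq_is_derive _ _ _ (fun=> c)).
  by apply: filterS fc => y ->.
by rewrite derive1E; have [] := h.
Qed.

Lemma compact_support_integral g (D : set (measurableTypeR R)) (a b : R) : measurable D ->
  continuous g -> (forall r, ~ (a <= r <= b) -> g r = 0) ->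
  (forall r, a <= r <= b -> D r) ->
  leb.-integrable D (EFin \o g) /\
  \int[leb]_(r in D) g r = \int[leb]_(r in `[a, b]) g r.
Proof.
move=> mD cg g0 abD.
have gE (C : set R) : (forall r, a <= r <= b -> C r) -> g \_ C = g.
  move=> hC; apply/funext => r; rewrite patchE; case: ifPn => // rC.
  apply/esym/g0 => /hC Cr; by move: rC; rewrite mem_set.
have hI : forall r, a <= r <= b -> `[a, b]%classic r by move=> r; rewrite /= in_itv.
have mI : measurable (`[a, b]%classic : set (measurableTypeR R)) by exact: measurable_itv.
split; last by rewrite Rintegral_mkcond gE// [RHS]Rintegral_mkcond gE.
have : leb.-integrable `[a, b] (EFin \o g).
  apply: continuous_compact_integrable; first exact: segment_compact.
  exact: continuous_subspaceT.
move=> /(integrable_mkcond _ mI).1; rewrite restrict_EFin gE// => h.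
by apply/(integrable_mkcond _ mD); rewrite restrict_EFin gE.
Qed.

(** [V b - V a] is the integral of E against the derivative of a rescaled step, that is, an average
    of E over [s, s + e]. It is kept as the increment of a primitive, so that the bound follows from
    monotonicity. *)
Lemma mollified_le (th E V : R -> R) (s e a b eta : R) : 0 < e ->
  Cinf th -> (forall x, x <= 0 -> th x = 0) -> (forall x, 1 <= x -> th x = 1) ->
  (forall x, 0 <= derive1 th x) ->
  a <= s -> s + e <= b ->
  (forall r, s <= r <= s + e -> `|E r - E s| <= eta) ->
  (forall r : R, is_derive r 1 V (derive1 (fun x => th (e^-1 * x + - (s / e))) r * E r)) ->
  `|V b - V a - E s| <= eta.
Proof.
move=> e0 thC th0 th1 dth sa sb Es VE.
have ei0 : 0 < e^-1 by rewrite invr_gt0.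
pose A x := th (e^-1 * x + - (s / e)).
have AC : Cinf A by exact: Cinf_affine.
have AE x : derive1 A x = derive1 th (e^-1 * x + - (s / e)) * e^-1.
  have h : is_derive x 1 A (derive1 th (e^-1 * x + - (s / e)) * e^-1).
    exact: (is_derive1_comp (Cinf_is_derive _ thC) (is_derive_affine _ _ _)).
  by rewrite derive1E; have [] := h.
have argE x : e^-1 * x + - (s / e) = (x - s) / e by field; rewrite gt_eqF.
have A0 x : x <= s -> A x = 0.
  by move=> xs; rewrite /A argE th0// pmulr_lle0// subr_le0.
have A1 x : s + e <= x -> A x = 1.
  by move=> xs; rewrite /A argE th1// ler_pdivlMr// mul1r; lra.
have dA0 x : 0 <= derive1 A x by rewrite AE mulr_ge0// ltW.
have dA_lt x : x < s -> derive1 A x = 0.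
  move=> xs; apply: (@derive1_eq0_of_locally A 0).
  by near=> y; apply: A0; apply: ltW; near: y; exact: lt_nbhsl.
have dA_gt x : s + e < x -> derive1 A x = 0.
  move=> xs; apply: (@derive1_eq0_of_locally A 1).
  by near=> y; apply: A1; apply: ltW; near: y; exact: lt_nbhsr.
have AV (c : R) (r : R) : is_derive r 1 (fun x => V x + c * A x)
    (derive1 A r * E r + c * derive1 A r).
  by apply: is_deriveD; apply: is_deriveZ1; exact: Cinf_is_derive.
have ab : a <= b by lra.
have bnd r : derive1 A r != 0 -> `|E r - E s| <= eta.
  move=> dr; apply: Es; apply/andP; split; rewrite leNgt; apply/negP.
    by move=> /dA_lt; exact/eqP.
  by move=> /dA_gt; exact/eqP.
have Ab : A b = 1 by exact: A1.
have Aa : A a = 0 by exact: A0.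
have up : V b - V a <= E s + eta.
  have := @le_of_derive _ _ a b ab (AV (- (E s + eta))).
  rewrite Ab Aa mulr0 addr0 mulr1 => h; suff : V b + - (E s + eta) <= V a by lra.
  apply: h => x _.
  have [->|/bnd] := eqVneq (derive1 A x) 0; first by rewrite mul0r mulr0 addr0.
  rewrite ler_norml => /andP[_ h].
  have -> : derive1 A x * E x + - (E s + eta) * derive1 A x =
    derive1 A x * (E x - E s - eta) by ring.
  by rewrite mulr_ge0_le0//; lra.
have lo : E s - eta <= V b - V a.
  have dN (r : R) : is_derive r 1 (fun x => - (V x + - (E s - eta) * A x))
      (- (derive1 A r * E r + - (E s - eta) * derive1 A r)) by exact: is_deriveN.
  have := @le_of_derive _ _ a b ab dN.
  rewrite Ab Aa mulr0 addr0 mulr1 lerN2 => h; suff : V a <= V b + - (E s - eta) by lra.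
  apply: h => x _.
  have [->|/bnd] := eqVneq (derive1 A x) 0; first by rewrite mul0r mulr0 addr0 oppr0.
  rewrite ler_norml => /andP[h _].
  have -> : - (derive1 A x * E x + - (E s - eta) * derive1 A x) =
    - (derive1 A x * (E x - E s + eta)) by ring.
  by rewrite oppr_le0 mulr_ge0//; lra.
by rewrite ler_norml; apply/andP; split; lra.
Unshelve. all: by end_near. Qed.

(** Du Bois-Reymond: with Bp a primitive of b, the function E = c - Bp is constant on positive
    times. The test function is the difference of two mollified steps starting at s and t; it has
    compact support, and testing with it equates the averages of E just after s and just after t. *)
Lemma weak_derivative (c b : R -> R) : continuous c -> continuous b ->
  (forall chi, Cinf chi -> (exists l r, 0 < l /\ forall s, ~ (l <= s <= r) -> chi s = 0) ->
     \int[leb]_(s in `]0, +oo[) (derive1 chi s * c s + chi s * b s) = 0) ->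
  forall t : R, 0 < t -> is_derive t 1 c (b t).
Proof.
move=> cc cb weak.
have [Bp Bp0 BpE] := primitive_line cb.
have cBp := continuous_of_is_derive BpE.
pose E r := c r - Bp r.
have cE : continuous E by move=> r; apply: cvgB; [exact: cc|exact: cBp].
have [th [thC th0 th1 dth]] := smooth_step R.
have key (s t : R) : 0 < s -> s < t -> E s = E t.
  move=> s0 st; apply/eqP; rewrite -subr_eq0 -normr_le0; apply/ler_addgt0Pr => eta0 eta00.
  rewrite add0r; pose eta := eta0 / 2; have e0 : 0 < eta by rewrite divr_gt0.
  have [e [e00 est es et]] : exists e : R, [/\ 0 < e, e < t - s,
      forall r, s <= r <= s + e -> `|E r - E s| <= eta &
      forall r, t <= r <= t + e -> `|E r - E t| <= eta].
    have [d1 /= d10 hd1] := (nbhs_ballP _ _).1 (cvgr_dist_lt _ _ (cE s) _ e0).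
    have [d2 /= d20 hd2] := (nbhs_ballP _ _).1 (cvgr_dist_lt _ _ (cE t) _ e0).
    pose e := Num.min (Num.min (d1 / 2) (d2 / 2)) ((t - s) / 2).
    have e1 : e <= d1 / 2 by rewrite !ge_min lexx.
    have e2 : e <= d2 / 2 by rewrite !ge_min lexx orbT.
    have e3 : e <= (t - s) / 2 by rewrite ge_min lexx orbT.
    exists e; split.
    - by rewrite !lt_min !divr_gt0// subr_gt0.
    - by apply: (le_lt_trans e3); lra.
    - move=> r /andP[r1 r2]; rewrite distrC ltW//; apply: hd1.
      by rewrite /ball /= distrC ger0_norm; lra.
    - move=> r /andP[r1 r2]; rewrite distrC ltW//; apply: hd2.
      by rewrite /ball /= distrC ger0_norm; lra.
  pose A (z x : R) := th (e^-1 * x + - (z / e)).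
  have AC z : Cinf (A z) by exact: Cinf_affine.
  have argE z x : e^-1 * x + - (z / e) = (x - z) / e by field; rewrite gt_eqF.
  have A0 z x : x <= z -> A z x = 0.
    by move=> xs; rewrite /A argE th0// pmulr_lle0 ?invr_gt0// subr_le0.
  have A1 z x : z + e <= x -> A z x = 1.
    by move=> xs; rewrite /A argE th1// ler_pdivlMr// mul1r; lra.
  pose chi x := A s x + -1 * A t x.
  have chiC : Cinf chi by apply: CinfD => //; apply: CinfM => //; exact: Cinf_cst.
  have chi0 x : ~ (s <= x <= t + e) -> chi x = 0.
    rewrite /chi => h; have [xs|sx] := ltP x s.
      by rewrite !A0 ?mulr0 ?addr0//; lra.
    have [xt|tx] := leP x (t + e); first by case: h; rewrite sx.
    by rewrite !A1 ?mulr1 ?subrr//; lra.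
  have dchi x : derive1 chi x = derive1 (A s) x - derive1 (A t) x.
    have h : is_derive x 1 chi (derive1 (A s) x + -1 * derive1 (A t) x).
      apply: is_deriveD; first exact: Cinf_is_derive.
      by apply: is_deriveZ1; exact: Cinf_is_derive.
    by rewrite derive1E; have [_ ->] := h; rewrite mulN1r.
  have dchi0 x : ~ (s <= x <= t + e) -> derive1 chi x = 0.
    move=> h; apply: (@derive1_eq0_of_locally chi 0).
    have [xs|sx] := ltP x s.
      near=> y; apply: chi0 => /andP[sy _].
      have : y < s by near: y; exact: lt_nbhsl.
      by rewrite ltNge sy.
    have [xt|tx] := leP x (t + e); first by case: h; rewrite sx.
    near=> y; apply: chi0 => /andP[_ yt].
    have : t + e < y by near: y; exact: lt_nbhsr.
    by rewrite ltNge yt.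
  pose phi x := derive1 chi x * c x + chi x * b x.
  have cphi : continuous phi.
    move=> x; apply: cvgD; apply: cvgM.
    - exact: Cinf_continuous (Cinf_derive chiC) _.
    - exact: cc.
    - exact: Cinf_continuous chiC _.
    - exact: cb.
  have phi0 x : ~ (s <= x <= t + e) -> phi x = 0.
    by move=> h; rewrite /phi dchi0// chi0// !mul0r addr0.
  have subD r : s <= r <= t + e -> `]0, +oo[%classic r.
    by move=> /andP[sr _]; rewrite /= in_itv/= andbT (lt_le_trans s0).
  have [_ intE] := compact_support_integral (measurable_itv _) cphi phi0 subD.
  have {}intE : \int[leb]_(r in `[s, (t + e)]) phi r = 0.
    rewrite -intE; by apply: weak => //; exists s, (t + e).
  have [W _ WE] := primitive_line cphi.
  have ste : s < t + e by lra.
  have WW : W (t + e) = W s.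
    move: intE; rewrite /Rintegral (ftc_line ste cphi WE) /= => /eqP.
    by rewrite subr_eq0 => /eqP.
  have cAE z : continuous (fun r => derive1 (A z) r * E r).
    move=> x; apply: cvgM; first exact: Cinf_continuous (Cinf_derive (AC z)) _.
    exact: cE.
  have [V1 _ V1E] := primitive_line (cAE s); have [V2 _ V2E] := primitive_line (cAE t).
  have h1 := @mollified_le th E V1 s e s (t + e) eta e00 thC th0 th1 dth (lexx s) _ es V1E.
  have h2 := @mollified_le th E V2 t e s (t + e) eta e00 thC th0 th1 dth (ltW st) (lexx _) et V2E.
  have {}h1 : `|V1 (t + e) - V1 s - E s| <= eta by apply: h1; lra.
  (* Integration by parts, in the form of a function with zero derivative: the test integral
     vanishes, and so does [chi] at both ends. *)
  have VV : V1 (t + e) - V1 s = V2 (t + e) - V2 s.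
    pose H r := W r - chi r * Bp r - (V1 r - V2 r).
    have HE (r : R) : is_derive r 1 H (phi r - (derive1 chi r * Bp r + chi r * b r) -
        (derive1 (A s) r * E r - derive1 (A t) r * E r)).
      apply: is_deriveB; apply: is_deriveB => //.
      by apply: is_deriveM1; exact: Cinf_is_derive.
    have HE0 (r : R) : is_derive r 1 H 0.
      by apply: (is_derive_eq' (HE r)); rewrite /phi /E dchi; ring.
    have HN (r : R) : is_derive r 1 (fun x => - H x) 0.
      by apply: (is_derive_eq' (is_deriveN (HE0 r))); rewrite oppr0.
    have i1 := le_of_derive (ltW ste) HE0 (fun _ _ => lexx 0).
    have i2 := le_of_derive (ltW ste) HN (fun _ _ => lexx 0).
    have HH : H (t + e) = H s by apply/eqP; rewrite eq_le i1 -lerN2 i2.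
    have c1 : chi (t + e) = 0 by rewrite /chi !A1 ?mulN1r ?subrr//; lra.
    have c2 : chi s = 0 by rewrite /chi !A0 ?mulr0 ?addr0// ltW.
    move: HH; rewrite /H WW c1 c2 !mul0r subr0; lra.
  have -> : E s - E t = (V2 (t + e) - V2 s - E t) - (V1 (t + e) - V1 s - E s).
    by rewrite VV; ring.
  apply: (le_trans (ler_normB _ _)); apply: (le_trans (lerD h2 h1)).
  by rewrite -splitr.
move=> t t0.
have h : is_derive t 1 (fun r => Bp r + E t) (b t).
  by rewrite -[b t]addr0; apply: is_deriveD.
apply: near_eq_is_derive h; near=> r.
have r0 : 0 < r by near: r; exact: lt_nbhsr.
have -> : E t = E r.
  by have [rt|rt|->] := ltgtP r t => //; [apply/esym|]; exact: key.
by rewrite /E addrC subrK.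
Unshelve. all: by end_near. Qed.

End WeakDerivative.

(** * From the weak formulation to the modes *)

Section TestFunctions.
Variable R : realType.
Implicit Types (chi : R -> R) (b : bool) (n : int * int) (i j : 'I_2).

Definition freq_coord n j : R := (if j == 0 then n.1 else n.2)%:~R.

(** The sign in the derivative: sine goes to plus cosine, cosine to minus sine. *)
Definition trg_sign b : R := (-1) ^+ (~~ b).

Lemma trg_signM b : trg_sign b * trg_sign (~~ b) = -1.
Proof. by rewrite /trg_sign; case: b => /=; rewrite expr0 expr1 ?mulr1 ?mul1r. Qed.

Lemma sum_freq_coord_sqr n : \sum_(i < 2) freq_coord n i ^+ 2 = lam R n.
Proof. by rewrite !big_ord_recl big_ord0 addr0 /freq_coord /lam. Qed.

Lemma phase_linear n h (v x : R * R) : phase n (h *: v + x) = h * phase n v + phase n x.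
Proof. by rewrite /phase /=; rewrite /GRing.scale/=; ring. Qed.

Lemma phase_unit n j : phase n (unit_vec R j) = freq_coord n j.
Proof. by rewrite /phase /unit_vec /freq_coord; case: ifP => _ /=; ring. Qed.

Lemma continuous_phase n : continuous (@phase R n).
Proof.
move=> x; apply: cvgD; apply: cvgM; try exact: cvg_cst.
  exact: cvg_fst.
exact: cvg_snd.
Qed.

Lemma derive1_cst0 (c : R) : derive1 (fun=> c) = (fun=> 0 : R).
Proof. exact: (derive1_of_is_derive (fun x => is_derive_cst c x 1)). Qed.

Lemma trg_wave b n : @trg R b n =
  wave (fun=> 0) (@phase R n) (fun=> (~~ b)%:R) (fun=> b%:R).
Proof.
by apply/funext => x; rewrite /trg /wave; case: b; rewrite ?mul0r ?mul1r ?add0r ?addr0.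
Qed.

Let zero_linear h (v x : R * R) : (fun=> 0 : R) (h *: v + x) = h * (fun=> 0) v + (fun=> 0) x.
Proof. by rewrite mulr0 addr0. Qed.

Let continuous_zero : continuous (fun _ : R * R => 0 : R).
Proof. by move=> x; exact: cvg_cst. Qed.

Lemma test_fun_trg b n : test_fun (@trg R b n).
Proof.
split.
  rewrite trg_wave; apply: smooth_wave => //.
  - by move=> *; rewrite phase_linear.
  - exact: continuous_phase.
  - exact: Cinf_cst.
  - exact: Cinf_cst.
split=> x; rewrite /trg.
  have -> : phase n (x + (2 * pi, 0)) = phase n x + n.1%:~R * (2 * pi) by rewrite /phase /=; ring.
  by rewrite sin_int_period cos_int_period.
have -> : phase n (x + (0, 2 * pi)) = phase n x + n.2%:~R * (2 * pi) by rewrite /phase /=; ring.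
by rewrite sin_int_period cos_int_period.
Qed.

Lemma partial_trg j b n x :
  partial j (@trg R b n) x = trg_sign b * freq_coord n j * trg (~~ b) n x.
Proof.
rewrite /partial trg_wave.
have [_ ->] := @is_derive_wave R _ _ _ zero_linear (@phase_linear n) (fun=> (~~ b)%:R) (fun=> b%:R)
  (unit_vec R j) x (Cinf_cst _) (Cinf_cst _).
rewrite /wave !derive1_cst0 !phase_unit /trg /trg_sign; case: b => /=; rewrite ?expr0 ?expr1; ring.
Qed.

Definition st_wave chi b n (z : R * (R * R)) : R := chi z.1 * trg b n z.2.

Let st_phase n (z : R * (R * R)) : R := phase n z.2.

Let st_wave_wave chi b n : st_wave chi b n =
  wave (fun z : R * (R * R) => z.1) (st_phase n) (fun s => (~~ b)%:R * chi s) (fun s => b%:R * chi s).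
Proof.
apply/funext => z; rewrite /st_wave /trg /wave /st_phase.
by case: b => /=; rewrite ?mul0r ?mul1r ?add0r ?addr0.
Qed.

Let fst_linear h (v z : R * (R * R)) : (h *: v + z).1 = h * v.1 + z.1.
Proof. by []. Qed.

Let st_phase_linear n h (v z : R * (R * R)) : st_phase n (h *: v + z) = h * st_phase n v + st_phase n z.
Proof. exact: phase_linear. Qed.

Let continuous_fst2 : continuous (fun z : R * (R * R) => z.1).
Proof. by move=> z; exact: cvg_fst. Qed.

Let continuous_st_phase n : continuous (st_phase n).
Proof.
move=> z; apply: (@continuous_comp _ _ _ (fun z : R * (R * R) => z.2) (@phase R n)).
  exact: cvg_snd.
exact: continuous_phase.
Qed.

Let scaled_Cinf (c : R) chi : Cinf chi -> Cinf (fun s => c * chi s).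
Proof. by move=> hc; apply: CinfM => //; exact: Cinf_cst. Qed.

Lemma derive1_scaled (c : R) chi : Cinf chi ->
  derive1 (fun s => c * chi s) = (fun s => c * derive1 chi s).
Proof.
by move=> hc; apply: derive1_of_is_derive => x; apply: is_deriveZ1; exact: Cinf_is_derive.
Qed.

Lemma dt_st_wave chi b n : Cinf chi -> dt (st_wave chi b n) = st_wave (derive1 chi) b n.
Proof.
move=> hc; apply/funext => z; rewrite /dt [in LHS]st_wave_wave.
have [_ ->] := @is_derive_wave R _ _ _ fst_linear (@st_phase_linear n) _ _ (1, 0) z
  (scaled_Cinf (~~ b)%:R hc) (scaled_Cinf b%:R hc).
have p0 : st_phase n ((1, 0) : R * (R * R)) = 0 by rewrite /st_phase /phase /= !mulr0 addr0.
rewrite /wave !derive1_scaled// p0 /st_wave /trg /st_phase /=; case: b => /=; ring.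
Qed.

Lemma dx_st_wave i chi b n : Cinf chi ->
  dx i (st_wave chi b n) = st_wave (fun s => trg_sign b * freq_coord n i * chi s) (~~ b) n.
Proof.
move=> hc; apply/funext => z; rewrite /dx [in LHS]st_wave_wave.
have [_ ->] := @is_derive_wave R _ _ _ fst_linear (@st_phase_linear n) _ _ (0, unit_vec R i) z
  (scaled_Cinf (~~ b)%:R hc) (scaled_Cinf b%:R hc).
have p0 : st_phase n (0, unit_vec R i) = freq_coord n i by rewrite /st_phase phase_unit.
rewrite /wave !derive1_scaled// p0 /st_wave /trg /st_phase /trg_sign /=; case: b => /=; rewrite ?expr0 ?expr1; ring.
Qed.

Lemma st_test_st_wave chi b n (l r : R) : Cinf chi -> 0 < l ->
  (forall s, ~ (l <= s <= r) -> chi s = 0) -> st_test (st_wave chi b n).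
Proof.
move=> hc l0 chi0; exists l, r; split => //; split.
- rewrite st_wave_wave; apply: smooth_wave => //.
  + exact: scaled_Cinf.
  + exact: scaled_Cinf.
- move=> t; have [_ [t1 t2]] := test_fun_trg b n.
  by split=> x; rewrite /st_wave /=; [rewrite t1|rewrite t2].
- by move=> t x h; rewrite /st_wave /= chi0 ?mul0r.
Qed.

(* Fourier multiplier of the Leray projection. *)
Definition leray_mult (m j : 'I_2) n : R := (m == j)%:R - freq_coord n m * freq_coord n j / lam R n.

Lemma sum_leray_freq m n : lam R n != 0 -> \sum_(j < 2) leray_mult m j n * freq_coord n j = 0.
Proof.
move=> l0; rewrite /leray_mult.
under eq_bigr do rewrite mulrBl.
rewrite sumrB (bigD1 m)//= eqxx mul1r big1 ?addr0; last first.
  by move=> j /negbTE; rewrite eq_sym => ->; rewrite mul0r.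
have -> : \sum_(i < 2) freq_coord n m * freq_coord n i / lam R n * freq_coord n i =
    freq_coord n m / lam R n * \sum_(i < 2) freq_coord n i ^+ 2.
  by rewrite mulr_sumr; apply: eq_bigr => i _; ring.
by rewrite sum_freq_coord_sqr divfK// subrr.
Qed.

Lemma sum_leray_solenoidal m n (c : 'I_2 -> R) : \sum_(j < 2) freq_coord n j * c j = 0 ->
  \sum_(j < 2) leray_mult m j n * c j = c m.
Proof.
move=> c0; rewrite /leray_mult; under eq_bigr do rewrite mulrBl.
rewrite sumrB (bigD1 m)//= eqxx mul1r big1 ?addr0; last first.
  by move=> j /negbTE; rewrite eq_sym => ->; rewrite mul0r.
have -> : \sum_(i < 2) freq_coord n m * freq_coord n i / lam R n * c i =
    freq_coord n m / lam R n * \sum_(i < 2) freq_coord n i * c i.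
  by rewrite mulr_sumr; apply: eq_bigr => i _; ring.
by rewrite c0 mulr0 subr0.
Qed.

Lemma normr_leray_le1 m j n : `|leray_mult m j n| <= 1.
Proof.
have [l0|l0] := eqVneq (lam R n) 0.
  by rewrite /leray_mult l0 invr0 mulr0 subr0; case: eqP => _; rewrite ?normr1 ?normr0.
have lp : 0 < lam R n.
  by rewrite lt_neqAle eq_sym l0 addr_ge0 ?sqr_ge0.
have h1 : freq_coord n m ^+ 2 <= lam R n.
  by rewrite -sum_freq_coord_sqr (bigD1 m)//= lerDl sumr_ge0// => i _; exact: sqr_ge0.
have h2 : freq_coord n j ^+ 2 <= lam R n.
  by rewrite -sum_freq_coord_sqr (bigD1 j)//= lerDl sumr_ge0// => i _; exact: sqr_ge0.
rewrite /leray_mult; case: eqP => [->|_] /=.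
  have a0 : 0 <= freq_coord n j * freq_coord n j / lam R n by rewrite divr_ge0 ?(ltW lp)// -expr2 sqr_ge0.
  have a1 : freq_coord n j * freq_coord n j / lam R n <= 1 by rewrite ler_pdivrMr// mul1r -expr2.
  by rewrite mulr1n ler_norml; apply/andP; split; lra.
rewrite mulr0n sub0r normrN normrM normfV (gtr0_norm lp) ler_pdivrMr// mul1r.
rewrite -ler_sqr ?nnegrE ?(ltW lp)// real_normK ?num_real// exprMn [leRHS]expr2.
by rewrite ler_pM ?sqr_ge0.
Qed.

Lemma normr_freq_coord_le n j : `|freq_coord n j| <= (fnorm n)%:R.
Proof. by rewrite /freq_coord -intr_norm -natr_absz ler_nat /fnorm leq_max; case: ifP; rewrite leqnn ?orbT. Qed.

End TestFunctions.

(** * Mode equations of a weak solution *)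

Section LerayModes.
Variables (R : realType) (nu : R) (f : vdistr R) (u : R -> vfield R)
  (p : (R * (R * R) -> R) -> R).
Local Notation leb := (@lebesgue_measure R).
Hypothesis fL : forall j, is_distribution (f j).
Hypothesis pL : is_st_distribution p.
Hypothesis ns : navier_stokes nu f u p.
Hypothesis uL2 : forall t j, 0 <= t -> L2f (u t j).
Hypothesis udiv : forall t, 0 <= t -> div_free (distr_of (u t)).
(* constant for t <= 0, so that the coefficients are continuous on the whole line *)
Let U t := u (Num.max 0 t).
Hypothesis Ucont : forall j, L2cont (fun t => U t j).

Definition force_coef (m : 'I_2) (b : bool) (n : int * int) : R :=
  \sum_(j < 2) leray_mult R m j n * f j (trg b n).

Lemma solenoidal_coef t b n : 0 <= t -> \sum_(j < 2) freq_coord R n j * coef (u t j) b n = 0.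
Proof.
move=> t0; have := udiv t0 (test_fun_trg R (~~ b) n).
have -> : \sum_(j < 2) distr_of (u t) j (partial j (@trg R (~~ b) n)) =
    trg_sign R (~~ b) * \sum_(j < 2) freq_coord R n j * coef (u t j) b n.
  rewrite mulr_sumr; apply: eq_bigr => j _.
  have -> : distr_of (u t) j (partial j (@trg R (~~ b) n)) =
    int_cell (fun x => trg_sign R (~~ b) * freq_coord R n j * (u t j x * trg b n x)).
    by congr int_cell; apply/funext => x; rewrite partial_trg negbK; ring.
  rewrite int_cellZ ?mulrA//; apply: L2fM; [exact: uL2|exact: L2f_trg].
move/eqP; rewrite mulf_eq0 => /orP[|/eqP//].
by rewrite /trg_sign signr_eq0.
Qed.

Lemma distr_scale j (c : R) b n : f j (fun x => c * trg b n x) = c * f j (trg b n).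
Proof.
have [lin _] := fL j.
have t0 : test_fun (fun _ : R * R => 0 : R).
  have := test_fun_trg R true 0; rewrite (_ : @trg R true 0 = fun=> 0)//.
  by apply/funext => x; rewrite trg0.
have f0 : f j (fun=> 0) = 0.
  have := lin 1 _ _ t0 t0; rewrite (_ : (fun x => _ : R) = fun=> 0); first by move=> h; lra.
  by apply/funext => x; rewrite mulr0 addr0.
have := lin c _ _ (test_fun_trg R b n) t0; rewrite f0 addr0 => <-.
by congr (f j _); apply/funext => x; rewrite addr0.
Qed.

(** The weak formulation at one time, for the test field with components [leray_mult R m j n] chi
    trg; [a] and [a'] are the values of chi and of its derivative. As u is divergence free, the
    Leray multiplier acts on its coefficients as the identity. *)
Lemma spatial_integral t m b n (a a' : R) : 0 <= t ->
  \int[area R]_(x in cell R) (\sum_(j < 2)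
    (u t j x * (leray_mult R m j n * a' * trg b n x)
     + \sum_(i < 2) u t i x * u t j x * (trg_sign R b * freq_coord R n i * (leray_mult R m j n * a) * trg (~~ b) n x)
     + nu * u t j x * \sum_(i < 2)
         trg_sign R (~~ b) * freq_coord R n i * (trg_sign R b * freq_coord R n i * (leray_mult R m j n * a)) * trg b n x)) =
  a' * coef (u t m) b n + a * (- (nu * lam R n) * coef (u t m) b n +
    \sum_(j < 2) \sum_(i < 2) trg_sign R b * leray_mult R m j n * freq_coord R n i * tint (u t i) (u t j) (~~ b) n).
Proof.
move=> t0; rewrite -/(int_cell _).
have Lu j := uL2 j t0.
have it j : cell_integrable (fun x => u t j x * trg b n x).
  by apply: L2fM => //; exact: L2f_trg.
have itt i j : cell_integrable (fun x => u t i x * u t j x * trg (~~ b) n x).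
  have := L2fM (Lu i) (L2fM_trg (~~ b) n (Lu j)).
  by congr cell_integrable; apply/funext => x; rewrite mulrA.
have -> : (fun x => \sum_(j < 2)
    (u t j x * (leray_mult R m j n * a' * trg b n x)
     + \sum_(i < 2) u t i x * u t j x * (trg_sign R b * freq_coord R n i * (leray_mult R m j n * a) * trg (~~ b) n x)
     + nu * u t j x * \sum_(i < 2)
         trg_sign R (~~ b) * freq_coord R n i * (trg_sign R b * freq_coord R n i * (leray_mult R m j n * a)) * trg b n x)) =
  (fun x => \sum_(j < 2) ((leray_mult R m j n * (a' - nu * lam R n * a)) * (u t j x * trg b n x)
    + \sum_(i < 2) (a * (trg_sign R b * leray_mult R m j n * freq_coord R n i)) * (u t i x * u t j x * trg (~~ b) n x))).
  apply/funext => x; apply: eq_bigr => j _.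
  have -> : \sum_(i < 2)
         trg_sign R (~~ b) * freq_coord R n i * (trg_sign R b * freq_coord R n i * (leray_mult R m j n * a)) * trg b n x =
     - lam R n * (leray_mult R m j n * a * trg b n x).
    rewrite -sum_freq_coord_sqr -mulN1r -(trg_signM R b) mulr_sumr mulr_suml.
    by apply: eq_bigr => i _; ring.
  have -> : \sum_(i < 2) u t i x * u t j x * (trg_sign R b * freq_coord R n i * (leray_mult R m j n * a) * trg (~~ b) n x) =
    \sum_(i < 2) a * (trg_sign R b * leray_mult R m j n * freq_coord R n i) * (u t i x * u t j x * trg (~~ b) n x).
    by apply: eq_bigr => i _; ring.
  ring.
rewrite int_cell_sum; last first.
  move=> j; apply: cell_integrableD; first exact: cell_integrableZ.
  by apply: cell_integrable_sum => i; exact: cell_integrableZ.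
rewrite (eq_bigr (fun j => (a' - nu * lam R n * a) * (leray_mult R m j n * coef (u t j) b n) +
   a * \sum_(i < 2) trg_sign R b * leray_mult R m j n * freq_coord R n i * tint (u t i) (u t j) (~~ b) n)); last first.
  move=> j _.
  have i1 : cell_integrable (fun x => (leray_mult R m j n * (a' - nu * lam R n * a)) * (u t j x * trg b n x)).
    exact: cell_integrableZ.
  have i2 i : cell_integrable (fun x => (a * (trg_sign R b * leray_mult R m j n * freq_coord R n i)) *
      (u t i x * u t j x * trg (~~ b) n x)) by exact: cell_integrableZ.
  rewrite int_cellD//; last exact: cell_integrable_sum.
  rewrite int_cellZ// int_cell_sum// mulr_sumr; congr (_ + _).
    by rewrite mulrA [_ * leray_mult R m j n]mulrC.
  by apply: eq_bigr => i _; rewrite int_cellZ// -mulrA.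
rewrite big_split /= -!mulr_sumr sum_leray_solenoidal; last exact: solenoidal_coef.
ring.
Qed.

(** Because u is continuous into L^2, its coefficients and the integrals of its quadratic products
    are continuous in time, so the weak derivative is a classical one. *)
Lemma mode_equation m b n : lam R n != 0 -> forall t : R, 0 < t ->
  is_derive t 1 (fun s => coef (U s m) b n)
   (- (nu * lam R n) * coef (U t m) b n + (force_coef m b n +
    \sum_(j < 2) \sum_(i < 2) trg_sign R b * leray_mult R m j n * freq_coord R n i * tint (U t i) (U t j) (~~ b) n)).
Proof.
move=> l0.
pose c s := coef (U s m) b n.
pose N s := \sum_(j < 2) \sum_(i < 2) trg_sign R b * leray_mult R m j n * freq_coord R n i * tint (U s i) (U s j) (~~ b) n.
have cc : continuous c by apply: continuous_ip; [exact: Ucont|exact: L2f_trg].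
have cN : continuous N.
  apply: continuous_bigsum => j; apply: continuous_bigsum => i s.
  by apply: cvgM; [exact: cvg_cst|exact: continuous_tint].
pose bb s := - (nu * lam R n) * c s + (force_coef m b n + N s).
have cb : continuous bb.
  move=> s; apply: cvgD; first by apply: cvgM; [exact: cvg_cst|exact: cc].
  by apply: cvgD; [exact: cvg_cst|exact: cN].
apply: (@weak_derivative R c bb cc cb) => chi hc [l [r [l00 chi0]]].
(* this test field is divergence free, so the pressure drops out *)
pose phi (j : 'I_2) := st_wave (fun s => leray_mult R m j n * chi s) b n.
have hcj j : Cinf (fun s => leray_mult R m j n * chi s) by apply: CinfM => //; exact: Cinf_cst.
have phiT j : st_test (phi j).
  by apply: (@st_test_st_wave _ _ _ _ l r) => // s hs; rewrite chi0 ?mulr0.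
have := ns phiT.
have -> : (fun z => \sum_(j < 2) dx j (phi j) z) = fun=> 0.
  apply/funext => z; rewrite /phi.
  under eq_bigr do rewrite dx_st_wave// /st_wave.
  rewrite -mulr_suml (_ : \sum_(j < 2) _ = trg_sign R b * chi z.1 * \sum_(j < 2) leray_mult R m j n * freq_coord R n j).
    by rewrite sum_leray_freq// mulr0 mul0r.
  by rewrite mulr_sumr; apply: eq_bigr => j _; ring.
have p0 : p (fun=> 0) = 0.
  have t0 : st_test (fun _ : R * (R * R) => 0 : R).
    have -> : (fun _ : R * (R * R) => 0 : R) = st_wave (fun=> 0) false 0.
      by apply/funext => z; rewrite /st_wave mul0r.
    by apply: (@st_test_st_wave _ _ _ _ 1 1) => //; exact: Cinf_cst.
  have := pL.1 1 _ _ t0 t0; rewrite (_ : (fun x => _ : R) = fun=> 0); first by move=> h; lra.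
  by apply/funext => x; rewrite mulr0 addr0.
rewrite p0 subr0.
pose D : set (measurableTypeR R) := `]0, +oo[%classic.
have mD : measurable D by exact: measurable_itv.
have dchi0 s : ~ (l <= s <= r) -> derive1 chi s = 0.
  move=> h; apply: (@derive1_eq0_of_locally _ chi 0).
  have [sl|ls] := ltP s l.
    near=> y; apply: chi0 => /andP[ly _].
    have : y < l by near: y; exact: lt_nbhsl.
    by rewrite ltNge ly.
  have [sr|rs] := leP s r; first by case: h; rewrite ls.
  near=> y; apply: chi0 => /andP[_ yr].
  have : r < y by near: y; exact: lt_nbhsr.
  by rewrite ltNge yr.
have DU s : D s -> 0 <= s /\ U s = u s.
  by rewrite /D /= in_itv/= andbT => s0; rewrite /U max_r ltW.
have subD s : l <= s <= r -> D s.
  by move=> /andP[ls _]; rewrite /D /= in_itv/= andbT (lt_le_trans l00).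
(* The force is kept apart, as it is integrated separately in the weak formulation. Both integrands
   are continuous with compact support, so their integrals may be added. *)
pose g1 s := derive1 chi s * c s + chi s * (- (nu * lam R n) * c s + N s).
pose g2 s := chi s * force_coef m b n.
have -> : \int[leb]_(t in `]0, +oo[) (\sum_(j < 2) f j (fun x => phi j (t, x))) =
    \int[leb]_(t in D) g2 t.
  apply: eq_Rintegral => s _; rewrite /g2 /force_coef mulr_sumr; apply: eq_bigr => j _.
  by rewrite mulrA -distr_scale; congr (f j _); apply/funext => x; rewrite /phi /st_wave /=; ring.
set I1 := (X in - X = _ -> _).
have -> : I1 = \int[leb]_(t in D) g1 t.
  apply: eq_Rintegral => s /set_mem Ds; have [s0 Us] := DU s Ds.
  rewrite /g1 /c /N Us -spatial_integral//.
  apply: eq_Rintegral => x _; apply: eq_bigr => j _.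
  have E1 : dt (phi j) (s, x) = leray_mult R m j n * derive1 chi s * trg b n x.
    rewrite /phi dt_st_wave// /st_wave /=; congr (_ * _).
    by rewrite derive1_scaled.
  have hdx i : Cinf (fun s => trg_sign R b * freq_coord R n i * (leray_mult R m j n * chi s)).
    by apply: CinfM => //; exact: Cinf_cst.
  have E2 i : dx i (phi j) (s, x) = trg_sign R b * freq_coord R n i * (leray_mult R m j n * chi s) * trg (~~ b) n x.
    by rewrite /phi dx_st_wave.
  have E3 i : dx i (dx i (phi j)) (s, x) = trg_sign R (~~ b) * freq_coord R n i *
      (trg_sign R b * freq_coord R n i * (leray_mult R m j n * chi s)) * trg b n x.
    by rewrite /phi dx_st_wave// dx_st_wave// negbK.
  by rewrite E1; congr (_ + _ + _ * _); apply: eq_bigr => i _; rewrite ?E3 ?E2.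
have cchi := Cinf_continuous hc; have cdchi := Cinf_continuous (Cinf_derive hc).
have cg1 : continuous g1.
  move=> s; apply: cvgD; apply: cvgM; [exact: cdchi|exact: cc|exact: cchi|].
  by apply: cvgD; [apply: cvgM; [exact: cvg_cst|exact: cc]|exact: cN].
have cg2 : continuous g2.
  by move=> s; apply: cvgM; [exact: cchi|exact: cvg_cst].
have g10 s : ~ (l <= s <= r) -> g1 s = 0.
  by move=> h; rewrite /g1 dchi0// chi0// !mul0r addr0.
have g20 s : ~ (l <= s <= r) -> g2 s = 0 by move=> h; rewrite /g2 chi0// mul0r.
have [ig1 _] := compact_support_integral mD cg1 g10 subD.
have [ig2 _] := compact_support_integral mD cg2 g20 subD.
move=> h; have -> : (fun s => derive1 chi s * c s + chi s * bb s) = (fun s => g1 s + g2 s).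
  by apply/funext => s; rewrite /g1 /g2 /bb; ring.
by rewrite -/D (RintegralD mD ig1 ig2) -h addrC addNr.
Unshelve. all: by end_near.
Qed.

End LerayModes.

(** * Sobolev norms *)

Section SobolevNorm.
Variable R : realType.
Implicit Types (h : int * int -> R) (F : vdistr R) (s : R).

Lemma esum_box_ge h N : (forall n, 0 <= h n) ->
  ((\sum_(n <- box N) h n)%:E <= \esum_(n in [set n : int * int | n != 0%R]) (h n)%:E)%E.
Proof.
move=> h0; apply: esum_ge; exists [set` box N].
  by split=> [|n /=]; [exact: finite_seq|rewrite mem_box -fnorm0 lt0n => /andP[]].
by rewrite -fsbig_seq ?uniq_box// sumEFin.
Qed.

Lemma esum_box_le h (C : R) : (forall n, 0 <= h n) -> (forall N, \sum_(n <- box N) h n <= C) ->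
  (\esum_(n in [set n : int * int | n != 0%R]) (h n)%:E <= C%:E)%E.
Proof.
move=> h0 hC; apply: ge_ereal_sup => _ [A [finA A0] <-].
pose N := (\max_(n <- fset_set A) fnorm n)%N.
apply: (@le_trans _ _ (\sum_(n \in [set` box N]) (h n)%:E)%E); last first.
  by rewrite -fsbig_seq ?uniq_box// sumEFin lee_fin.
apply: lee_fsum_nneg_subset; [by []|exact: finite_seq| |by move=> n _; rewrite lee_fin].
move=> n /set_mem An; apply/mem_set; rewrite /= mem_box lt0n fnorm0 A0//=.
by rewrite /N (big_rem n)/=; [rewrite leq_maxl|by rewrite in_fset_set//; apply/mem_set].
Qed.

Lemma freq_norm_powR s n : freq_norm R n `^ (2 * s) = lam R n `^ s.
Proof. by rewrite powRrM powR_mulrn ?sqrtr_ge0// sqr_sqrtr// addr_ge0// sqr_ge0. Qed.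

Lemma normc_fourier (G : (R * R -> R) -> R) n :
  complex.ComplexField.Normc.normc (fourier G n) ^+ 2 = (2 * pi) ^- 4 * \sum_(b : bool) G (trg b n) ^+ 2.
Proof.
rewrite /fourier /complex.ComplexField.Normc.normc sqr_sqrtr ?addr_ge0 ?sqr_ge0//.
have -> : (2 * pi) ^- 4 = ((2 * pi) ^- 2) ^+ 2 :> R by rewrite exprVn -exprM.
by rewrite big_bool /trg /phase /=; ring.
Qed.

Definition modes_sqr F n : R := \sum_(j < 2) \sum_(b : bool) F j (trg b n) ^+ 2.

Lemma modes_sqr_ge0 F n : 0 <= modes_sqr F n.
Proof. by apply: sumr_ge0 => j _; apply: sumr_ge0 => b _; exact: sqr_ge0. Qed.

Lemma Hs_normE s F : Hs_norm s F =
  ((\esum_(n in [set n : int * int | n != 0%R])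
     ((2 * pi) ^- 4 * (lam R n `^ s * modes_sqr F n))%:E) `^ 2^-1)%E.
Proof.
rewrite /Hs_norm; congr (_ `^ _)%E; apply: eq_esum => n _; congr (_%:E).
rewrite freq_norm_powR mulrCA; congr (_ * _); rewrite /modes_sqr mulr_sumr.
by apply: eq_bigr => j _; exact: normc_fourier.
Qed.

Let twopi4_ge0 : 0 <= (2 * pi) ^- 4 :> R.
Proof. by rewrite invr_ge0 exprn_ge0// ltW// twopi_gt0. Qed.

Let term_ge0 s F n : 0 <= (2 * pi) ^- 4 * (lam R n `^ s * modes_sqr F n).
Proof. by rewrite mulr_ge0// mulr_ge0 ?powR_ge0 ?modes_sqr_ge0. Qed.

Lemma Hs_norm_box_ge s F N :
  (((2 * pi) ^- 4 * \sum_(n <- box N) lam R n `^ s * modes_sqr F n)%:E <= Hs_norm s F ^+ 2)%E.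
Proof.
rewrite Hs_normE; set E := esum _ _.
have -> : (E `^ 2^-1 ^+ 2 = E)%E.
  have E0 : (0 <= E)%E by apply: esum_ge0 => n _; rewrite lee_fin.
  move: E0; case: E => [r| |]//.
  - by rewrite lee_fin => r0; rewrite poweR_EFin -EFin_expe powR12_sqrt// sqr_sqrtr.
  - by move=> _; rewrite poweRyr// expe2 mulyy.
by rewrite mulr_sumr; exact: esum_box_ge.
Qed.

Lemma Hs_norm_le s F (C : R) : 0 <= C ->
  (forall N, \sum_(n <- box N) lam R n `^ s * modes_sqr F n <= C) ->
  (Hs_norm s F <= (Num.sqrt ((2 * pi) ^- 4 * C))%:E)%E.
Proof.
move=> C0 hC; rewrite Hs_normE -powR12_sqrt ?mulr_ge0// -poweR_EFin.
apply: gt0_ler_poweR => //.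
- by rewrite in_itv/= leey andbT; apply: esum_ge0 => n _; rewrite lee_fin.
- by rewrite in_itv/= leey andbT lee_fin mulr_ge0.
by apply: esum_box_le => // N; rewrite -mulr_sumr ler_wpM2l.
Qed.

End SobolevNorm.

(** * Trajectories *)

Section Trajectories.
Variable R : realType.
Implicit Types (v w : vfield R) (u : R -> vfield R).
Local Notation leb := (@lebesgue_measure R).

(* [Hs_norm] is not known to be measurable in time, so the larger function need not be. *)
Lemma ge0_le_integralW (f g : R -> \bar R) (D : set (measurableTypeR R)) :
  (forall t, D t -> (0 <= f t)%E) -> (forall t, D t -> (f t <= g t)%E) ->
  (\int[leb]_(t in D) f t <= \int[leb]_(t in D) g t)%E.
Proof.
move=> f0 fg; have g0 t : D t -> (0 <= g t)%E by move=> Dt; exact: le_trans (f0 _ Dt) (fg _ Dt).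
rewrite !ge0_integralE//; apply: le_ereal_sup => _ [h hf <-]; exists h => // t.
exact: le_trans (hf t) (lee_restrict fg t).
Qed.

Lemma L2f_of_in_L2 v j : in_L2 v -> L2f (v j).
Proof. by move=> /(_ j)[mv _ iv _]; split. Qed.

Lemma coef_in_L2_0 v j b : in_L2 v -> coef (v j) b 0 = 0.
Proof.
move=> /(_ j)[_ _ _ v0]; rewrite /coef /ip.
case: b; first by under eq_fun do rewrite trg0 mulr0; exact: int_cell0.
by under eq_fun do rewrite trg0 mulr1.
Qed.

Lemma sqn_sub_lt_of_L2_dist v w j (e : R) : 0 < e -> in_L2 v -> in_L2 w ->
  (L2_dist v w < (Num.sqrt e)%:E)%E -> sqn (fun x => v j x - w j x) < e.
Proof.
move=> e0 Lv Lw.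
have LB i : L2f (fun x => v i x - w i x) by apply: L2fB; exact: L2f_of_in_L2.
have iS : cell_integrable (fun x => \sum_(i < 2) (v i x - w i x) ^+ 2).
  by apply: cell_integrable_sum => i; exact: L2f_sqr.
pose S := \sum_(i < 2) sqn (fun x => v i x - w i x).
have S0 : 0 <= S by apply: sumr_ge0 => i _; exact: sqn_ge0.
have E : (\int[area R]_(x in cell R) (\sum_(i < 2) (v i x - w i x) ^+ 2)%:E = S%:E)%E.
  have -> : S = int_cell (fun x => \sum_(i < 2) (v i x - w i x) ^+ 2).
    rewrite int_cell_sum; last by move=> i; exact: L2f_sqr.
    by apply: eq_bigr => i _; rewrite sqnE.
  by rewrite /int_cell /Rintegral fineK//; apply: integrable_fin_num => //; exact: measurable_cell.
rewrite /L2_dist E poweR_EFin lte_fin powR12_sqrt// ltr_sqrt// => Se.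
apply: le_lt_trans Se; rewrite /S (bigD1 j)//= lerDl sumr_ge0// => i _; exact: sqn_ge0.
Qed.

Lemma L2cont_of_continuous_L2 u j : (forall tau, 0 < tau -> continuous_L2 tau u) ->
  L2cont (fun t => u (Num.max 0 t) j).
Proof.
move=> cu.
have Lu t : 0 <= t -> in_L2 (u t).
  move=> t0; have t1 : 0 < t + 1 by lra.
  by apply: (cu _ t1).1; rewrite t0/=; lra.
have m0 t : 0 <= Num.max 0 t :> R by rewrite le_max lexx.
split=> [t|t e e0]; first exact/L2f_of_in_L2/Lu.
pose t0 := Num.max 0 t; have t00 : 0 <= t0 := m0 t.
(* Continuity is used on [0, t0 + 1], so that all nonnegative times near t0 belong to the
   interval. *)
have tau0 : 0 < t0 + 1 by lra.
have tt : 0 <= t0 <= t0 + 1 by rewrite t00/=; lra.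
have se : (0 < (Num.sqrt e)%:E)%E by rewrite lte_fin sqrtr_gt0.
have := (cu _ tau0).2 t0 tt [set x | (x < (Num.sqrt e)%:E)%E].
case; first by apply: open_nbhs_nbhs; split => //; exact: open_ereal_lt_ereal.
move=> d /= d0 hd.
have : Num.max 0 s @[s --> t] --> Num.max 0 t.
  by apply: continuous_max; [exact: cvg_cst|exact: cvg_id].
move=> /cvgrPdist_lt /(_ (Num.min d 1)); rewrite lt_min d0 ltr01 => /(_ isT).
apply: filterS => s; rewrite -/t0 lt_min => /andP[sd s1].
apply: sqn_sub_lt_of_L2_dist => //; [exact: Lu|exact: Lu|].
apply: hd; first exact: sd.
rewrite /= in_itv/= m0/=; move: s1; rewrite ltr_norml => /andP[h _]; lra.
Qed.

End Trajectories.

(** * The Navier-Stokes nonlinearity *)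

Section Nonlinearity.
Variable R : realType.
Local Notation I := ('I_2 * bool)%type.
Implicit Types (U : 'I_2 -> R * R -> R) (p q r : I) (n : int * int) (F : vdistr R).

(* An index is a component with the choice of cosine (false) or sine (true);
   in the product u_i u_j the index q belongs to u_j and r to u_i. *)
Definition kernel p n q r : R := trg_sign R p.2 * leray_mult R p.1 q.1 n * freq_coord R n r.1 *
  ((2 * pi) ^- 2 * ((r.2 == ~~ p.2 (+) q.2)%:R * (-1) ^+ (p.2 && q.2))).

Definition modes U p n : R := coef (U p.1) p.2 n.

Definition nonlin (t : 'I_2 -> 'I_2 -> R) p n : R :=
  \sum_(j < 2) \sum_(i < 2) trg_sign R p.2 * leray_mult R p.1 j n * freq_coord R n i * t i j.

Lemma normr_trg_sign b : `|trg_sign R b| = 1.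
Proof. by rewrite /trg_sign normrX normrN1 expr1n. Qed.

Lemma twopi2_ge1 : 1 <= (2 * pi) ^+ 2 :> R.
Proof.
have p2 := @pi_ge2 R.
by apply: exprn_ege1; lra.
Qed.

Lemma normr_kernel_le p n q r : `|kernel p n q r| <= 1 * (fnorm n)%:R.
Proof.
have a1 := normr_leray_le1 R p.1 q.1 n; have a2 := normr_freq_coord_le R n r.1.
have a3 : `|(2 * pi) ^- 2 : R| <= 1.
  have h := twopi2_ge1.
  by rewrite ger0_norm ?invr_ge0 ?sqr_ge0// invf_le1//; lra.
have h1 : `|leray_mult R p.1 q.1 n| * `|freq_coord R n r.1| <= 1 * (fnorm n)%:R by apply: ler_pM.
have h2 : `|(2 * pi) ^- 2 : R| * (r.2 == ~~ p.2 (+) q.2)%:R <= 1 * 1.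
  by apply: ler_pM => //; case: (_ == _).
rewrite mul1r in h1; rewrite /kernel !normrM normr_trg_sign !mul1r normr_nat normrX normrN1 expr1n mulr1.
rewrite -[leRHS]mulr1 -[X in _ <= _ * X](mul1r 1); by apply: ler_pM => //; exact: mulr_ge0.
Qed.

Lemma nonlin_proj N U p n : (forall j, L2f (U j)) ->
  nonlin (fun i j => tint (proj N (U i)) (proj N (U j)) (~~ p.2) n) p n =
  quad kernel N (modes U) (modes U) p n.
Proof.
move=> LU; case: p => m b.
pose a j i : R := trg_sign R b * leray_mult R m j n * freq_coord R n i.
pose c (b' : bool) : R := (-1) ^+ (b && b').
have -> : quad kernel N (modes U) (modes U) (m, b) n =
  \sum_(k <- box N | n - k \in box N) \sum_(j < 2) \sum_(i < 2) a j i * ((2 * pi) ^- 2 *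
    \sum_(b' : bool) c b' * (coef (U j) b' k * coef (U i) (~~ b (+) b') (n - k))).
  apply: eq_bigr => k _.
  rewrite -(pair_bigA _ (fun j b' => \sum_r kernel (m, b) n (j, b') r *
     (modes U (j, b') k * modes U r (n - k)))) /=.
  apply: eq_bigr => j _.
  rewrite (eq_bigr (fun b' => \sum_(i < 2) a j i * ((2 * pi) ^- 2 *
      (c b' * (coef (U j) b' k * coef (U i) (~~ b (+) b') (n - k)))))).
    by rewrite exchange_big; apply: eq_bigr => i _; rewrite -!mulr_sumr.
  move=> b' _; rewrite -(pair_bigA _ (fun i b1 => kernel (m, b) n (j, b') (i, b1) *
     (modes U (j, b') k * modes U (i, b1) (n - k)))) /=.
  (* The parity of the second factor is determined by those of the mode and of the first factor. *)
  apply: eq_bigr => i _; rewrite (bigD1 (~~ b (+) b'))//= big1 ?addr0.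
    by rewrite /kernel /modes /a /c /= eqxx mulr1n mul1r !mulrA.
  by move=> b1 /negbTE b1E; rewrite /kernel /= b1E mulr0n mul0r !mulr0 mul0r.
rewrite /nonlin exchange_big /=; under [RHS]eq_bigr do rewrite exchange_big /=.
rewrite [RHS]exchange_big; apply: eq_bigr => i _.
rewrite [RHS]exchange_big; apply: eq_bigr => j _.
rewrite tint_proj// negbK -/(a j i) -!mulr_sumr; congr (_ * (_ * _)).
Qed.

Lemma sqn_proj_le N u : L2f u -> sqn (proj N u) <= sqn u :> R.
Proof.
move=> Lu; have := sqn_ge0 (fun x => u x - proj N u x).
by rewrite sqn_sub_proj// sqn_proj// subr_ge0.
Qed.

Definition tail N U : R := \sum_(j < 2) sqn (fun x => U j x - proj N (U j) x).

Lemma tail_ge0 N U : 0 <= tail N U.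
Proof. by apply: sumr_ge0 => j _; exact: sqn_ge0. Qed.

Lemma nonlin_sub_le N U p n (K : R) : (forall j, L2f (U j)) -> (forall j, sqn (U j) <= K) ->
  `|nonlin (fun i j => tint (U i) (U j) (~~ p.2) n) p n -
    nonlin (fun i j => tint (proj N (U i)) (proj N (U j)) (~~ p.2) n) p n| <=
  (fnorm n)%:R * (8 * Num.sqrt (tail N U * K)).
Proof.
move=> LU UK; pose e := Num.sqrt (tail N U * K).
have K0 : 0 <= K := le_trans (sqn_ge0 (U ord0)) (UK ord0).
have LP j := L2f_proj N (U j).
have LB j := L2fB (LU j) (LP j).
have small i (h : R * R -> R) b : L2f h -> sqn h <= K ->
    `|tint (fun x => U i x - proj N (U i) x) h b n| <= e.
  move=> Lh hK; rewrite -sqrtr_sqr; apply: ler_wsqrtr; apply: (le_trans (sqr_tint_le b n (LB i) Lh)).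
  apply: ler_pM => //; [exact: sqn_ge0|exact: sqn_ge0|].
  by rewrite /tail (bigD1 i)//= lerDl sumr_ge0// => j _; exact: sqn_ge0.
rewrite /nonlin -sumrB (le_trans (ler_norm_sum _ _ _))//.
(* Four pairs of components, and two terms for each: the truncation of either factor. *)
have -> : (fnorm n)%:R * (8 * e) = \sum_(j < 2) \sum_(i < 2) (fnorm n)%:R * (2 * e).
  by rewrite !sumr_const !card_ord !mulr2n; ring.
apply: ler_sum => j _; rewrite -sumrB (le_trans (ler_norm_sum _ _ _))//.
apply: ler_sum => i _; rewrite -mulrBr tint_sub// !normrM normr_trg_sign mul1r.
have hP : `|leray_mult R p.1 j n| * `|freq_coord R n i| <= 1 * (fnorm n)%:R.
  by apply: ler_pM => //; [exact: normr_leray_le1|exact: normr_freq_coord_le].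
rewrite mul1r in hP; apply: ler_pM; [exact: mulr_ge0|exact: normr_ge0|exact: hP|].
apply: (le_trans (ler_normD _ _)); rewrite mulr2n mulrDl mul1r; apply: lerD.
  exact: small.
by apply: small => //; apply: le_trans (sqn_proj_le N (LU i)) _.
Qed.

Lemma lam_le n : lam R n <= 2 * (fnorm n)%:R ^+ 2.
Proof.
have h (a : int) : (`|a| <= fnorm n)%N -> a%:~R ^+ 2 <= (fnorm n)%:R ^+ 2 :> R.
  move=> an; rewrite -[a%:~R ^+ 2]real_normK ?num_real// -intr_norm -natr_absz.
  by rewrite lerXn2r ?nnegrE// ler_nat.
by rewrite /lam mulr2n mulrDl mul1r; apply: lerD; apply: h; rewrite /fnorm leq_max leqnn ?orbT.
Qed.

Lemma sum_sqnormE m N (x : I -> int * int -> R) :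
  \sum_p sqnorm m N (x p) = \sum_(n <- box N) (fnorm n)%:R ^+ m * \sum_p x p n ^+ 2.
Proof. by rewrite exchange_big; apply: eq_bigr => n _; rewrite mulr_sumr. Qed.

Lemma modes_sqrE (v : vfield R) n : modes_sqr (distr_of v) n = \sum_p modes v p n ^+ 2.
Proof. by rewrite -(pair_bigA _ (fun j b => modes v (j, b) n ^+ 2)). Qed.

Lemma sum_sqnorm_modes_le N (v : vfield R) :
  \sum_p sqnorm 2 N (modes v p) <= \sum_(n <- box N) lam R n `^ 1 * modes_sqr (distr_of v) n.
Proof.
rewrite sum_sqnormE; apply: ler_sum => n _.
rewrite -modes_sqrE powRr1; last by rewrite addr_ge0 ?sqr_ge0.
by apply: ler_wpM2r; [exact: modes_sqr_ge0|exact: sqr_fnorm_le_lam].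
Qed.

Lemma le_sum_sqnorm_modes N (v : vfield R) :
  \sum_(n <- box N) lam R n `^ 1 * modes_sqr (distr_of v) n <= 2 * \sum_p sqnorm 2 N (modes v p).
Proof.
rewrite sum_sqnormE mulr_sumr; apply: ler_sum => n _.
rewrite -modes_sqrE powRr1 ?[2 * (_ * modes_sqr _ _)]mulrA; last by rewrite addr_ge0 ?sqr_ge0.
by apply: ler_wpM2r; [exact: modes_sqr_ge0|exact: lam_le].
Qed.

(** Division by lam turns H^-1 into H^1, since |n|^2 lam^-2 is at most lam^-1. The Leray multipliers
    are at most 1; the factor 4 is 2 from squaring a sum of two terms, times the number of
    components. *)
Lemma sum_sqnorm_force_le N F :
  \sum_p sqnorm 2 N (fun n => force_coef F p.1 p.2 n / lam R n) <=
  4 * \sum_(n <- box N) lam R n `^ (- 1) * modes_sqr F n.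
Proof.
rewrite sum_sqnormE mulr_sumr big_seq [leRHS]big_seq; apply: ler_sum => n nN.
have l0 := lam_gt0 R nN.
rewrite powRN powRr1 ?(ltW l0)//.
have fb (p : I) : force_coef F p.1 p.2 n ^+ 2 <= 2 * \sum_(j < 2) F j (trg p.2 n) ^+ 2.
  have hj j : `|leray_mult R p.1 j n * F j (trg p.2 n)| <= `|F j (trg p.2 n)|.
    by rewrite normrM ler_piMl// normr_leray_le1.
  have h (x y : R) : `|x| <= `|y| -> x ^+ 2 <= y ^+ 2.
    by move=> xy; rewrite -[x ^+ 2]real_normK ?num_real// -[y ^+ 2]real_normK ?num_real// lerXn2r ?nnegrE.
  have sum2 (a b c d : R) : `|a| <= `|c| -> `|b| <= `|d| -> (a + b) ^+ 2 <= 2 * (c ^+ 2 + d ^+ 2).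
    by move=> /h ac /h bd; have := sqr_ge0 (b - a); nra.
  by rewrite /force_coef !big_ord_recl !big_ord0 !addr0; apply: sum2; exact: hj.
have -> : \sum_p (force_coef F p.1 p.2 n / lam R n) ^+ 2 =
    (lam R n)^-1 ^+ 2 * \sum_(p : I) force_coef F p.1 p.2 n ^+ 2.
  by rewrite mulr_sumr; apply: eq_bigr => p _; rewrite exprMn mulrC.
have S : \sum_(p : I) force_coef F p.1 p.2 n ^+ 2 <= 4 * modes_sqr F n.
  apply: (le_trans (ler_sum _ (fun p _ => fb p))).
  rewrite -(pair_bigA _ (fun (m : 'I_2) b => 2 * \sum_(j < 2) F j (trg b n) ^+ 2)) /=.
  rewrite sumr_const card_ord /modes_sqr exchange_big /= -mulr_sumr; lra.
have n1 : (fnorm n)%:R ^+ 2 * (lam R n)^-1 <= 1.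
  by rewrite ler_pdivrMr// mul1r; exact: sqr_fnorm_le_lam.
have li : 0 <= (lam R n)^-1 by rewrite invr_ge0 ltW.
have S0 : 0 <= \sum_(p : I) force_coef F p.1 p.2 n ^+ 2 by apply: sumr_ge0 => p _; exact: sqr_ge0.
set s := \sum_(p : I) force_coef F p.1 p.2 n ^+ 2 in S S0 *.
have -> : (fnorm n)%:R ^+ 2 * ((lam R n)^-1 ^+ 2 * s) =
  (fnorm n)%:R ^+ 2 * (lam R n)^-1 * ((lam R n)^-1 * s) by ring.
apply: (@le_trans _ _ (1 * ((lam R n)^-1 * s))); first by apply: ler_wpM2r => //; exact: mulr_ge0.
by rewrite mul1r mulrCA; apply: ler_wpM2l.
Qed.

End Nonlinearity.

(** * The a priori bound *)

Section Assembly.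
Variable R : realType.
Local Notation I := ('I_2 * bool)%type.
Local Notation leb := (@lebesgue_measure R).
Implicit Types (v w : vfield R) (F : vdistr R).

(** Passes from the integral of the extended real function [H] to a bound on a primitive of [g], the
    form in which the Gronwall argument takes its coefficients. *)
Lemma primitive_bound (g : R -> R) (H : R -> \bar R) (c T : R) : 0 < T -> 0 < c ->
  continuous g -> (forall t, 0 <= g t) ->
  (forall t, 0 <= t -> ((c * g t)%:E <= H t)%E) ->
  (\int[leb]_(t in `[0%R, T]) H t < +oo)%E ->
  exists G : R -> R, [/\ continuous G, G 0 = 0, forall t : R, is_derive t 1 G (g t) &
    forall t, 0 <= t <= T -> 0 <= G t <= c^-1 * fine (\int[leb]_(t in `[0%R, T]) H t)%E].
Proof.
move=> T0 c0 cg g0 gH Hoo; have [G G0 GE] := primitive_line cg.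
exists G; split => //; first exact: continuous_of_is_derive GE.
have mono (a b : R) : a <= b -> G a <= G b.
  move=> ab; have dG (s : R) : is_derive s 1 (fun s => -1 * G s) (-1 * g s) by exact: is_deriveZ1.
  have := le_of_derive ab dG; rewrite !mulN1r lerN2; apply => s _.
  by rewrite mulN1r oppr_le0.
move=> t /andP[t0 tT]; rewrite -{1}G0 mono//= mulrC ler_pdivlMr// mulrC.
apply: (@le_trans _ _ (c * G T)); first by rewrite ler_pM2l// mono.
have dG (s : R) : is_derive s 1 (fun s => c * G s) (c * g s) by exact: is_deriveZ1.
have ccg : continuous (fun s => c * g s) by move=> s; apply: cvgM; [exact: cvg_cst|exact: cg].
have E := ftc_line T0 ccg dG; rewrite G0 mulr0 subr0 in E.
have inI s : (`[0%R, T]%classic : set R) s -> 0 <= s by rewrite /= in_itv/= => /andP[].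
have cg0 s : 0 <= c * g s by apply: mulr_ge0 => //; exact: ltW.
rewrite -lee_fin fineK; last first.
  rewrite ge0_fin_numE// integral_ge0// => s /inI s0; apply: le_trans (gH _ s0).
  by rewrite lee_fin.
rewrite -E; apply: ge0_le_integralW => [s _|s /inI s0]; first by rewrite lee_fin.
exact: gH.
Qed.

Lemma coef_ae_eq v w j b n : in_L2 v -> in_L2 w ->
  {ae area R, forall x, cell R x -> forall j, v j x = w j x} ->
  coef (v j) b n = coef (w j) b n.
Proof.
move=> Lv Lw vw; congr fine.
have mE (z : vfield R) : in_L2 z -> measurable_fun (cell R : set (measurableTypeR R * measurableTypeR R))
    (fun x => (z j x * trg b n x)%:E).
  move=> Lz; apply/measurable_EFinP; apply: measurable_funTS.
  by apply: measurable_funM; [exact: (L2f_of_in_L2 j Lz).1|exact: measurable_trg].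
apply: ae_eq_integral; [exact: measurable_cell|exact: mE|exact: mE|].
apply: (@filterS _ _ (ae_filter_ringOfSetsType (area R)) _ _ _ vw) => x vwx xc; by rewrite vwx.
Qed.

Lemma Hs_norm_box_bounded (s : R) F : (Hs_norm s F < +oo)%E ->
  exists2 A : R, 0 <= A & forall N, \sum_(n <- box N) lam R n `^ s * modes_sqr F n <= A.
Proof.
move=> Hoo; have h := Hs_norm_box_ge s F.
have c0 : 0 < (2 * pi) ^- 4 :> R by rewrite invr_gt0 exprn_gt0// twopi_gt0.
have : (0 <= Hs_norm s F)%E by exact: poweR_ge0.
move: Hoo h; case: (Hs_norm s F) => [r| |]// _ h _.
exists (r ^+ 2 / (2 * pi) ^- 4); first by rewrite divr_ge0 ?sqr_ge0// ltW.
by move=> N; rewrite ler_pdivlMr// mulrC -lee_fin EFin_expe; exact: h.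
Qed.

Lemma sqnorm_modes_le_Hs N v :
  (((2 * pi) ^- 4 * \sum_p sqnorm 2 N (modes v p))%:E <= Hs_norm 1 (distr_of v) ^+ 2)%E.
Proof.
apply: le_trans (Hs_norm_box_ge 1 (distr_of v) N); rewrite lee_fin.
apply: ler_wpM2l; first by rewrite invr_ge0 exprn_ge0// ltW// twopi_gt0.
exact: sum_sqnorm_modes_le.
Qed.

(** The power N^2 is the decay of the tail of an H^1 field; integrated in time it gives the decay of
    the truncation error. When the norm is infinite there is nothing to prove. *)
Lemma tail_le_Hs N v : in_L2 v ->
  (((2 * (2 * pi) ^+ 2)^-1 * (N%:R ^+ 2 * tail N v))%:E <= Hs_norm 1 (distr_of v) ^+ 2)%E.
Proof.
move=> Lv; have h M := sqnorm_modes_le_Hs M v.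
have p0 := twopi_gt0 R; have p20 : 0 < (2 * pi) ^+ 2 :> R by rewrite exprn_gt0.
have p40 : 0 < (2 * pi) ^+ 4 :> R by rewrite exprn_gt0.
have H0 : (0 <= Hs_norm 1 (distr_of v) ^+ 2)%E by rewrite expe_ge0// poweR_ge0.
move: H0 h; case: (_ ^+ 2)%E => [r| |]//; last by move=> _ _; rewrite leey.
rewrite lee_fin => r0 h; case: N => [|N]; first by rewrite expr0n mul0r mulr0.
have S M : \sum_p sqnorm 2 M (modes v p) <= (2 * pi) ^+ 4 * r.
  by have := h M; rewrite lee_fin mulrC ler_pdivrMr// mulrC.
have tj j : sqn (fun x => v j x - proj N.+1 (v j) x) <=
    (2 * pi) ^- 2 * ((2 * pi) ^+ 4 * r) / N.+1%:R ^+ 2.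
  apply: sqn_sub_proj_le => //; [exact: L2f_of_in_L2|exact: coef_in_L2_0|] => M.
  apply: le_trans (S M); rewrite sum_sqnormE; apply: ler_sum => n _.
  apply: ler_wpM2l; first exact: sqr_ge0.
  rewrite -modes_sqrE /modes_sqr (bigD1 j)//= lerDl sumr_ge0// => i _.
  by apply: sumr_ge0 => b _; exact: sqr_ge0.
have N0 : 0 < N.+1%:R ^+ 2 :> R by rewrite exprn_gt0// ltr0n.
have d0 : 0 < 2 * (2 * pi) ^+ 2 :> R by apply: mulr_gt0.
rewrite lee_fin mulrC ler_pdivrMr//.
have tN : tail N.+1 v <= ((2 * pi) ^- 2 * ((2 * pi) ^+ 4 * r) / N.+1%:R ^+ 2) *+ 2.
  by apply: (le_trans (ler_sum _ (fun j _ => tj j))); rewrite sumr_const card_ord.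
apply: (le_trans (ler_wpM2l (ltW N0) tN)); rewrite le_eqVlt; apply/orP; left; apply/eqP.
have y0 : N.+1%:R != 0 :> R by rewrite pnatr_eq0.
move: (N.+1%:R : R) y0 (2 * pi : R) (lt0r_neq0 p0) => y y0 z z0; rewrite -mulr_natl; field.
by rewrite z0 y0.
Qed.

End Assembly.

Section Main.
Variable R : realType.
Local Notation I := ('I_2 * bool)%type.
Local Notation leb := (@lebesgue_measure R).

Lemma mode_derive (nu : R) (f : vdistr R) (u : R -> vfield R) p :
  (forall j, is_distribution (f j)) -> is_st_distribution p -> navier_stokes nu f u p ->
  (forall tau, 0 < tau -> continuous_L2 tau u) ->
  (forall t, 0 <= t -> div_free (distr_of (u t))) ->
  let U t := u (Num.max 0 t) in
  forall (q : I) n (t : R), 0 < t -> is_derive t 1 (fun s => modes (U s) q n)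
    (if n == 0 then 0 else - (nu * lam R n) * modes (U t) q n +
      (force_coef f q.1 q.2 n + nonlin (fun i j => tint (U t i) (U t j) (~~ q.2) n) q n)).
Proof.
move=> fL pL ns cu udiv U q n t t0.
have Lu s : 0 <= s -> in_L2 (u s).
  by move=> s0; apply: (cu (s + 1) _).1; [lra|rewrite s0/=; lra].
(* At n = 0 the Leray projection has no meaning, but the mean of u vanishes at all times. *)
case: eqVneq => [->|n0].
  have -> : (fun s => modes (U s) q 0) = (fun=> 0).
    by apply/funext => s; rewrite /modes coef_in_L2_0//; apply: Lu; rewrite le_max lexx.
  exact: is_derive_cst.
apply: (mode_equation fL pL ns) => //.
- by move=> s j s0; apply/L2f_of_in_L2/Lu.
- by move=> j; exact: L2cont_of_continuous_L2.
- have nN : n \in box (fnorm n) by rewrite mem_box leqnn andbT lt0n fnorm0.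
  by rewrite gt_eqF// (lam_gt0 R nN).
Qed.

Lemma continuous_tail N (U : R -> vfield R) : (forall j, L2cont (fun t => U t j)) ->
  continuous (fun t => tail N (U t)).
Proof.
move=> cU; apply: continuous_bigsum => j.
have -> : (fun t => sqn (fun x => U t j x - proj N (U t j) x)) = (fun t => sqn (U t j) -
    (2 * pi) ^- 2 * \sum_(n <- box N) \sum_(b : bool) coef (U t j) b n ^+ 2).
  by apply/funext => t; rewrite sqn_sub_proj//; exact: (cU j).1.
move=> t; apply: cvgB; first exact: (continuous_sqn (cU j)).
apply: cvgM; first exact: cvg_cst.
apply: continuous_bigsum => n; apply: continuous_bigsum => b s.
by apply: cvgM; apply: continuous_ip; [exact: cU|exact: L2f_trg|exact: cU|exact: L2f_trg].
Qed.

Lemma continuous_sqnorm_modes N (U : R -> vfield R) : (forall j, L2cont (fun t => U t j)) ->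
  continuous (fun t => \sum_p sqnorm 2 N (modes (U t) p)).
Proof.
move=> cU; apply: continuous_bigsum => p; apply: continuous_bigsum => n t.
apply: cvgM; first exact: cvg_cst.
by apply: cvgM; apply: continuous_ip; [exact: cU|exact: L2f_trg|exact: cU|exact: L2f_trg].
Qed.

End Main.

Theorem theorem1p1 (R : realType) (nu : R) (f : vdistr R) (u0 : vfield R)
    (hnu : 0 < nu)
    (hf : in_Hs (- 1) f)
    (hu0L2 : in_L2 u0)
    (hu0 : in_Hs 1 (distr_of u0))
    (hdiv : div_free (distr_of u0)) :
  exists T : R, 0 < T /\
    forall u : R -> vfield R, leray_solution nu f u0 u ->
      forall t0 : R, 0 < t0 < T ->
        in_Linfty_Hs 1 t0 (fun t => distr_of (u t)).
Proof.
have [fL _ /Hs_norm_box_bounded[Af Af0 fA]] := hf.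
have [_ _ /Hs_norm_box_bounded[Au Au0 uA]] := hu0.
have x0A N : \sum_p sqnorm 2 N (modes u0 p) <= Au + 4 * Af.
  by apply: (le_trans (sum_sqnorm_modes_le N u0)); have := uA N; lra.
have FA N : \sum_(p : 'I_2 * bool) sqnorm 2 N (fun n => force_coef f p.1 p.2 n / lam R n) <= Au + 4 * Af.
  by apply: (le_trans (sum_sqnorm_force_le N f)); have := fA N; lra.
(* [T] and [B] come from the bounds on u0 and f, before u is introduced; the kernel constant is
   1. *)
have [T [B [T0 main]]] := quadratic_system_bound ler01 hnu (@normr_kernel_le R) x0A FA.
exists T; split=> // u [traj udiv init [p [pL ns]]] t0 /andP[t00 t0T].
have cu tau : 0 < tau -> continuous_L2 tau u by move=> /traj[].
have Lu t : 0 <= t -> in_L2 (u t).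
  by move=> h; apply: (cu (t + 1) _).1; [lra|rewrite h/=; lra].
pose U t := u (Num.max 0 t).
have UE t : 0 <= t -> U t = u t by move=> h; rewrite /U max_r.
have LU t : in_L2 (U t) by apply: Lu; rewrite le_max lexx.
have cU j : L2cont (fun t => U t j) by exact: L2cont_of_continuous_L2.
have [K' hK'] : exists K : R, forall t, 0 <= t <= T -> \sum_(j < 2) sqn (U t j) <= K.
  by apply: continuous_bounded; apply: continuous_bigsum => j; exact: (continuous_sqn (cU j)).
(* Kept positive for the division by 64 K below. *)
pose K := Num.max 1 K'.
have K1 : 1 <= K by rewrite le_max lexx.
have KU t j : 0 <= t <= T -> sqn (U t j) <= K.
  move=> tT; rewrite le_max; apply/orP; right; apply: le_trans (hK' t tT).
  by rewrite (bigD1 j)//= lerDl sumr_ge0// => i _; exact: sqn_ge0.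
have K0 : 0 < K by exact: lt_le_trans K1.
clearbody K.
pose H t := (Hs_norm 1 (distr_of (u t)) ^+ 2)%E.
have [_ [_ _ Hoo]] := traj T T0.
(* The bound of [nonlin_sub_le]. Its square is linear in the tail, hence integrable in time even
   with the weight N^2. *)
pose q N t := 8 * Num.sqrt (tail N (U t) * K).
have qE N t : q N t ^+ 2 = 64 * K * tail N (U t).
  rewrite /q exprMn sqr_sqrtr; last by rewrite mulr_ge0 ?tail_ge0//; lra.
  by ring.
have c4 : 0 < (2 * pi) ^- 4 :> R by rewrite invr_gt0 exprn_gt0// twopi_gt0.
have d0 : 0 < 2 * (2 * pi) ^+ 2 :> R by rewrite mulr_gt0// exprn_gt0// twopi_gt0.
have c2 : 0 < (2 * (2 * pi) ^+ 2)^-1 :> R by rewrite invr_gt0.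
pose a := fine (\int[@lebesgue_measure R]_(t in `[0%R, T]) H t)%E.
have a0 : 0 <= a by apply/fine_ge0/integral_ge0 => t _; rewrite expe_ge0// poweR_ge0.
have C0 : 0 <= 64 * K * (2 * (2 * pi) ^+ 2) * a.
  by apply: mulr_ge0; [apply: mulr_ge0; [lra|exact: ltW]|exact: a0].
have /choice[Gam GamP] N : exists G : R -> R, [/\ continuous G, G 0 = 0,
    forall t : R, is_derive t 1 G (\sum_p sqnorm 2 N (modes (U t) p)) &
    forall t, 0 <= t <= T -> 0 <= G t <= ((2 * pi) ^- 4)^-1 * a].
  apply: primitive_bound => //.
  - exact: continuous_sqnorm_modes.
  - by move=> t; apply: sumr_ge0 => r _; exact: sqnorm_ge0.
  - by move=> t h; rewrite UE//; exact: sqnorm_modes_le_Hs.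
have /choice[Q QP] N : exists G : R -> R, [/\ continuous G, G 0 = 0,
    forall t : R, is_derive t 1 G (q N t ^+ 2) &
    forall t, 0 <= t <= T -> N%:R ^+ 2 * G t <=
     64 * K * (2 * (2 * pi) ^+ 2) * a].
  have cq : continuous (fun t => q N t ^+ 2).
    under eq_fun do rewrite qE.
    by move=> t; apply: cvgM; [exact: cvg_cst|exact: continuous_tail].
  (* For N = 0 the constant [c] below would vanish, and the required bound is trivial. *)
  case: N cq => [|N] cq.
    have [G G0 GE] := primitive_line cq; exists G; split => //.
      exact: continuous_of_is_derive GE.
    by move=> t _; rewrite expr0n mul0r; exact: C0.
  have N0 : 0 < N.+1%:R ^+ 2 :> R by rewrite exprn_gt0// ltr0n.
  pose c := (2 * (2 * pi) ^+ 2)^-1 * (N.+1%:R ^+ 2 / (64 * K)).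
  have c0 : 0 < c by apply: mulr_gt0 => //; apply: divr_gt0 => //; lra.
  have [||G [cG G0 GE GB]] := primitive_bound T0 c0 cq _ _ Hoo.
  - by move=> t; exact: sqr_ge0.
  - move=> t h; have := tail_le_Hs N.+1 (LU t); rewrite UE//; congr (_%:E <= _)%E.
    rewrite qE UE// /c; move: ((2 * (2 * pi) ^+ 2)^-1 : R) (N.+1%:R ^+ 2 : R) => z y.
    by field; exact: lt0r_neq0.
  exists G; split => // t tT; have /andP[_ h] := GB t tT.
  apply: (le_trans (ler_wpM2l (ltW N0) h)); rewrite le_eqVlt; apply/orP; left; apply/eqP.
  rewrite mulrA; congr (_ * _); rewrite /c.
  move: (N.+1%:R ^+ 2 : R) N0 (2 * (2 * pi) ^+ 2 : R) d0 => y y0 z z0.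
  by field; rewrite !lt0r_neq0.
have B0 N t : 0 <= t <= T -> \sum_p sqnorm 2 N (modes (U t) p) <= B.
  pose xd (p : 'I_2 * bool) n t := if n == 0 then 0 else - (nu * lam R n) * modes (U t) p n +
      (force_coef f p.1 p.2 n + nonlin (fun i j => tint (U t i) (U t j) (~~ p.2) n) p n).
  apply: (main (fun p n t => modes (U t) p n) xd q Gam Q (2 * (2 * pi) ^+ 2 * K)
     (((2 * pi) ^- 4)^-1 * a + 64 * K * (2 * (2 * pi) ^+ 2) * a)).
  - by move=> p' n; apply: continuous_ip; [exact: cU|exact: L2f_trg].
  - by move=> p' n; rewrite UE//; apply: coef_ae_eq => //; exact: Lu.
  - by move=> p' n s /andP[s0 _]; exact: (mode_derive fL pL ns cu udiv).
  - move=> M p' n s nM /andP[s0 sT].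
    have n0 : n != 0 by apply: contraTneq nM => ->; rewrite box0F.
    rewrite /xd (negbTE n0) -nonlin_proj; last by move=> j; exact: L2f_of_in_L2.
    rewrite opprD addrACA subrr add0r opprD addrACA subrr add0r.
    apply: nonlin_sub_le => j; first exact: L2f_of_in_L2.
    by apply: KU; rewrite !ltW.
  - move=> M s sT; rewrite sum_sqnormE.
    rewrite (eq_bigr (fun n => \sum_(j < 2) \sum_(b : bool) coef (U s j) b n ^+ 2)); last first.
      by move=> n _; rewrite expr0 mul1r -modes_sqrE.
    rewrite exchange_big /=; apply: (@le_trans _ _ (\sum_(j < 2) (2 * pi) ^+ 2 * K)).
      apply: ler_sum => j _; apply: (le_trans (bessel M (L2f_of_in_L2 j (LU s)))).
      by apply: ler_wpM2l; [exact: sqr_ge0|exact: KU].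
    by rewrite sumr_const card_ord -[2 * _ * K]mulrA mulr2n [leRHS]mulrDl !mul1r.
  - move=> M; have [h1 h2 h3 h4] := GamP M.
    split; [exact: h1|exact: h2|by move=> s _; exact: h3|move=> s sT].
    by have /andP[-> /= h] := h4 s sT; apply: (le_trans h); rewrite lerDl.
  - move=> M; have [h1 h2 h3 h4] := QP M.
    split; [exact: h1|exact: h2|by move=> s _; exact: h3|move=> s sT].
    apply: (le_trans (h4 s sT)); rewrite lerDr; apply: mulr_ge0 => //.
    by rewrite invr_ge0 ltW.
have [m1 m2 _] := (traj t0 t00).2.
split=> //.
(* The 2 compares [lam] with the square of the max norm; (2 pi)^-4 is the normalisation of the
   squared Fourier coefficients. *)
exists (Num.sqrt ((2 * pi) ^- 4 * (2 * B))); apply: aeW => t /andP[h tt0].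
have tT : 0 <= t <= T by rewrite h (le_trans tt0)// ltW.
apply: Hs_norm_le.
  apply: mulr_ge0 => //; apply: le_trans (B0 0%N t tT).
  by apply: sumr_ge0 => r _; exact: sqnorm_ge0.
move=> N; apply: (le_trans (le_sum_sqnorm_modes N (u t))).
by rewrite ler_pM2l// -UE//; exact: B0.
Qed.
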